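(* Let $G=\langle\alpha,\beta\mid\alpha^2=\beta^3=e\rangle$, let $c$ be an isolated circular order of $G$ and let $\phi$ be a dynamical realization of $c$ based at $x_0\in S^1$. Then there exist subsets $[a],[b],[b^{-1}]\subset S^1$ such that $(a,b,[a],[b],[b^{-1}])$ with $a=\phi(\alpha)$, $b=\phi(\beta)$ is a Markov system.
   Context: A circular order on a countable group $H$ is a map $c:H^3\to\{0,\pm1\}$ with (1) $c(g_1,g_2,g_3)=0$ iff two of the $g_i$ coincide; (2) $c(g_2,g_3,g_4)-c(g_1,g_3,g_4)+c(g_1,g_2,g_4)-c(g_1,g_2,g_3)=0$; (3) $c(g_4g_1,g_4g_2,g_4g_3)=c(g_1,g_2,g_3)$. $CO(H)$ has the topology induced from $\{0,\pm1\}^{H^3}$; isolated means isolated in $CO(H)$. An action $\rho$ of $H$ on $S^1$ by orientation-preserving homeomorphisms is tight at $x_0$ if the stabilizer of $x_0$ is trivial and both endpoints of every gap of $\overline{\rho(H)x_0}$ lie in $\rho(H)x_0$. A dynamical realization of $c$ based at $x_0$ is an action tight at $x_0$ with $c(g_1,g_2,g_3)=\pm1$ according as $\rho(g_1)x_0,\rho(g_2)x_0,\rho(g_3)x_0$ are distinct and anticlockwise/clockwise. A Markov system is a tuple $(a,b,[a],[b],[b^{-1}])$ with $a$ an orientation-preserving involution of $S^1$, $b$ an orientation-preserving homeomorphism of $S^1$ of period three, and $[a],[b],[b^{-1}]\subset S^1$ such that: (A) they are pairwise disjoint, each a union of $k$ disjoint closed intervals ($k\in\mathbb{N}$); components are called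 $a$-, $b$-, $b^{-1}$-intervals; $X=[a]\cup[b]\cup[b^{-1}]$; (B) no two $a$-intervals are consecutive among the components of $X$ in circular order; likewise for $b$- and for $b^{-1}$-intervals; with principal gaps (gaps of $X$ between an $a$-interval and a $b^{\pm1}$-interval), complementary gaps (between a $b$- and a $b^{-1}$-interval), $b$-blocks (maximal intervals made of $b^{\pm1}$-intervals and complementary gaps), $[[b]]$ = union of $b$-blocks: (C) $a([a])=[[b]]$; (D) $b([a])=[b]$, $b([b])=[b^{-1}]$; (E) the graph on principal gaps joining $J$ to $a(J)$ and to the image of $J$ under the (unique) one of $b^{\pm1}$ mapping $J$ to a principal gap is connected (the principal gaps form one cycle). *)

(* Defs.v *)
From Stdlib Require Import Reals List Relations Bool ZArith.
Import ListNotations.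
Open Scope R_scope.

(* The group G = < alpha, beta | alpha^2 = beta^3 = e > = Z/2 * Z/3,  *)
(* realised by reduced words over the letters a, b, b^-1 in which     *)
(* letters from the two factors alternate.                            *)
Inductive letter : Set := LA | LB | LBi.

Definition fac (l : letter) : bool := match l with LA => true | _ => false end.

Fixpoint reducedb (w : list letter) : bool :=
  match w with
  | x :: ((y :: _) as w') => negb (Bool.eqb (fac x) (fac y)) && reducedb w'
  | _ => true
  end.

Definition push (l : letter) (w : list letter) : list letter :=
  match l, w with
  | LA, LA :: w' => w'
  | LB, LB :: w' => LBi :: w'
  | LB, LBi :: w' => w'
  | LBi, LB :: w' => w'
  | LBi, LBi :: w' => LB :: w'
  | _, _ => l :: w
  end.

Lemma reducedb_tail x w : reducedb (x :: w) = true -> reducedb w = true.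
Proof. destruct w as [|y w]; simpl; [reflexivity|]. now intros H; apply andb_prop in H. Qed.

Lemma push_reduced l w : reducedb w = true -> reducedb (push l w) = true.
Proof.
  intros H.
  destruct l, w as [|[] w]; simpl in *; try reflexivity;
    try (exact (reducedb_tail _ _ H)); try exact H;
    destruct w as [|[] w]; simpl in *; auto; discriminate.
Qed.

Lemma foldr_push_reduced u v :
  reducedb v = true -> reducedb (fold_right push v u) = true.
Proof. induction u; simpl; auto using push_reduced. Qed.

Definition G : Type := { w : list letter | reducedb w = true }.

Definition Gmul (g h : G) : G :=
  exist _ (fold_right push (proj1_sig h) (proj1_sig g))
          (foldr_push_reduced (proj1_sig g) _ (proj2_sig h)).

Definition Ge : G := exist _ [] eq_refl.
Definition alpha : G := exist _ [LA] eq_refl.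
Definition beta : G := exist _ [LB] eq_refl.

Definition is_circular_order (c : G -> G -> G -> Z) : Prop :=
  (forall g1 g2 g3, c g1 g2 g3 = 0%Z \/ c g1 g2 g3 = 1%Z \/ c g1 g2 g3 = (-1)%Z) /\
  (forall g1 g2 g3, c g1 g2 g3 = 0%Z <-> (g1 = g2 \/ g2 = g3 \/ g1 = g3)) /\
  (forall g1 g2 g3 g4,
      (c g2 g3 g4 - c g1 g3 g4 + c g1 g2 g4 - c g1 g2 g3 = 0)%Z) /\
  (forall g1 g2 g3 g4,
      c (Gmul g4 g1) (Gmul g4 g2) (Gmul g4 g3) = c g1 g2 g3).

(* isolated in CO(G) with the topology induced from {0,+-1}^(G^3):
   some basic (finite-coordinate) neighbourhood contains only c *)
Definition isolated_CO (c : G -> G -> G -> Z) : Prop :=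
  is_circular_order c /\
  exists F : list (G * G * G),
    forall c', is_circular_order c' ->
      (forall g1 g2 g3, In (g1, g2, g3) F -> c' g1 g2 g3 = c g1 g2 g3) ->
      forall g1 g2 g3, c' g1 g2 g3 = c g1 g2 g3.

(* The circle S^1 = [0,1) (= R/Z), anticlockwise = increasing angle   *)
Definition S1 : Type := { x : R | 0 <= x < 1 }.

Definition cyc (x y z : S1) : Prop :=
  let a := proj1_sig x in let b := proj1_sig y in let c := proj1_sig z in
  (a < b < c) \/ (b < c < a) \/ (c < a < b).

Definition cdist (x y : S1) : R :=
  Rmin (Rabs (proj1_sig x - proj1_sig y)) (1 - Rabs (proj1_sig x - proj1_sig y)).

Definition ccontinuous (f : S1 -> S1) : Prop :=
  forall x eps, 0 < eps -> exists delta, 0 < delta /\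
    forall y, cdist x y < delta -> cdist (f x) (f y) < eps.

Definition is_homeo (f : S1 -> S1) : Prop :=
  exists g : S1 -> S1, (forall x, g (f x) = x) /\ (forall x, f (g x) = x) /\
    ccontinuous f /\ ccontinuous g.

Definition orient_pres (f : S1 -> S1) : Prop :=
  forall x y z, cyc x y z -> cyc (f x) (f y) (f z).

Definition homeo_plus (f : S1 -> S1) : Prop := is_homeo f /\ orient_pres f.

Definition arc_cc (x y : S1) : S1 -> Prop := fun z => z = x \/ z = y \/ cyc x z y.
Definition arc_oo (x y : S1) : S1 -> Prop := fun z => cyc x z y.

Definition seteq (P Q : S1 -> Prop) : Prop := forall z, P z <-> Q z.
Definition image (f : S1 -> S1) (P : S1 -> Prop) : S1 -> Prop :=
  fun z => exists w, P w /\ f w = z.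

Definition is_action (phi : G -> S1 -> S1) : Prop :=
  (forall g, homeo_plus (phi g)) /\
  (forall x, phi Ge x = x) /\
  (forall g h x, phi (Gmul g h) x = phi g (phi h x)).

Definition orbit (phi : G -> S1 -> S1) (x0 : S1) : S1 -> Prop :=
  fun z => exists g, phi g x0 = z.

Definition closure (P : S1 -> Prop) : S1 -> Prop :=
  fun z => forall eps, 0 < eps -> exists w, P w /\ cdist z w < eps.

Definition tight_at (phi : G -> S1 -> S1) (x0 : S1) : Prop :=
  (forall g, phi g x0 = x0 -> g = Ge) /\
  (forall u v, u <> v ->
     closure (orbit phi x0) u -> closure (orbit phi x0) v ->
     (forall z, arc_oo u v z -> ~ closure (orbit phi x0) z) ->
     orbit phi x0 u /\ orbit phi x0 v).

Definition dynamical_realization (c : G -> G -> G -> Z)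
           (phi : G -> S1 -> S1) (x0 : S1) : Prop :=
  is_action phi /\ tight_at phi x0 /\
  forall g1 g2 g3,
    (cyc (phi g1 x0) (phi g2 x0) (phi g3 x0) -> c g1 g2 g3 = 1%Z) /\
    (cyc (phi g3 x0) (phi g2 x0) (phi g1 x0) -> c g1 g2 g3 = (-1)%Z).

Definition arcs_union (l : list (S1 * S1)) : S1 -> Prop :=
  fun z => exists p, In p l /\ arc_cc (fst p) (snd p) z.

Definition consecutive (X : S1 -> Prop) (I J : S1 * S1) : Prop :=
  forall z, arc_oo (snd I) (fst J) z -> ~ X z.

Definition s0 : S1 := exist _ 0 (conj (Rle_refl 0) Rlt_0_1).

Definition markov_system (a b : S1 -> S1) (A B Bi : S1 -> Prop) : Prop :=
  homeo_plus a /\ (forall x, a (a x) = x) /\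
  homeo_plus b /\ (forall x, b (b (b x)) = x) /\ (exists x, b x <> x) /\
  exists (k : nat) (la lb lbi : list (S1 * S1)),
    let all := la ++ lb ++ lbi in
    let X := fun z => A z \/ B z \/ Bi z in
    let gap (I J : S1 * S1) := arc_oo (snd I) (fst J) in
    let principal (P : S1 -> Prop) :=
      exists I J, In I all /\ In J all /\ consecutive X I J /\
        ((In I la /\ In J (lb ++ lbi)) \/ (In I (lb ++ lbi) /\ In J la)) /\
        seteq P (gap I J) in
    let complementary (P : S1 -> Prop) :=
      exists I J, In I all /\ In J all /\ consecutive X I J /\
        ((In I lb /\ In J lbi) \/ (In I lbi /\ In J lb)) /\
        seteq P (gap I J) in
    let BB := fun z => B z \/ Bi z \/ exists P, complementary P /\ P z in
    let edge (P Q : S1 -> Prop) :=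
      principal P /\ principal Q /\
      (seteq (image a P) Q \/ seteq (image b P) Q \/
       seteq (fun z => P (b z)) Q (* image of P under b^-1 *)) in
    (1 <= k)%nat /\ length la = k /\ length lb = k /\ length lbi = k /\
    (forall p, In p all -> fst p <> snd p) /\
    (forall i j, (i < length all)%nat -> (j < length all)%nat -> i <> j ->
       forall z, arc_cc (fst (nth i all (s0, s0))) (snd (nth i all (s0, s0))) z ->
                 ~ arc_cc (fst (nth j all (s0, s0))) (snd (nth j all (s0, s0))) z) /\
    seteq A (arcs_union la) /\ seteq B (arcs_union lb) /\ seteq Bi (arcs_union lbi) /\
    (forall I J, In I la -> In J la -> ~ consecutive X I J) /\
    (forall I J, In I lb -> In J lb -> ~ consecutive X I J) /\
    (forall I J, In I lbi -> In J lbi -> ~ consecutive X I J) /\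
    seteq (image a A) BB /\
    seteq (image b A) B /\ seteq (image b B) Bi /\
    (forall P Q, principal P -> principal Q -> clos_refl_trans _ edge P Q).

(* Main.v *)
(* Types of words are their first letters.  The heart of the proof is that, for
   a sufficiently large ball of [G], two elements outside the ball that lie in
   the same gap of the ball have the same type.  Otherwise one could conjugate
   one of the two generators by a homeomorphism supported in such a gap and move
   one point past another one of different type, without changing the order on
   the ball; comparing the deformed action and the given one lexicographically
   resolves the ties and yields a second circular order in the given
   neighbourhood of [c].

   It follows that the orbit of [x0] is discrete: if orbit points accumulated at
   it, tracking the types of nearby points along an orbit would produce
   infinitely many elements of the ball.  Hence the limit set of the orbit is
   closed and invariant, carries a locally constant type, and, by tightness, [G]
   permutes its gaps transitively.  The intervals of the Markov system are
   obtained by filling in the gaps whose two ends have equal type.  All other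
   gaps meet the ball, so there are finitely many of them; every gap is carried
   to one of them by successively stripping its first letter, and this yields
   both the nondegeneracy of the intervals and the connectedness of the graph
   of principal gaps. *)
Require Import Defs.
From Stdlib Require Import Reals List Relations ZArith.
From Stdlib Require Import Lra Lia Bool Eqdep_dec ClassicalEpsilon FinFun.
From Stdlib Require Import FunctionalExtensionality PropExtensionality.
Import ListNotations.

(** * Words *)

(* A bump of a generator displaces only elements reached through that generator, so two elements can
   be swapped only if they are reached from the ball through different generators. This dictates the
   filtration: [ballA j] is [beta]-invariant, [ballM j] adjoins its [alpha]-translate and is
   [alpha]-invariant, and the [beta]-translates of [ballM j] make up [ballA (S j)]. A bump of the
   generator preserving a stage, supported in a gap of that stage, fixes the stage and its
   translates by the other generator, but moves a translate by the bumped generator that lands in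
   the support. Invariance also forbids an element and its image under that generator to share a
   gap, so the source of the moved element can be kept outside the support.

   The deformed orbit of the base point may hit a point twice, so the undeformed position is carried
   along as a second coordinate. Deforming by conjugation preserves both relations together with
   their integer translations, hence the pair of actions descends to one quotient.

   Tightness serves to put an orbit point into every gap of the limit set. *)
Infix "**" := Gmul (at level 40, left associativity).

Lemma G_eq (g h : G) : proj1_sig g = proj1_sig h -> g = h.
Proof.
  destruct g as [u p], h as [v q]; simpl; intros ->.
  f_equal. apply (UIP_dec bool_dec).
Qed.

(** The relations are asked only on [P] because [push] satisfies them only on reduced words and
    [step] only over [0,1). The first instance gives associativity in [G], the second makes
    evaluation of words in the deformed generators an action. *)
Definition letter_action {X} (f : letter -> X -> X) (P : X -> Prop) : Prop :=
  (forall l x, P x -> P (f l x)) /\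
  (forall x, P x -> f LA (f LA x) = x) /\
  (forall x, P x -> f LB (f LB x) = f LBi x) /\
  (forall x, P x -> f LB (f LBi x) = x).

Section LetterAction.
Context {X : Type} (f : letter -> X -> X) (P : X -> Prop) (Hf : letter_action f P).

Lemma letter_action_BiB x : P x -> f LBi (f LB x) = x.
Proof. destruct Hf as (H0 & _ & H2 & H3). intros; rewrite <- (H2 (f LB x)), (H2 x); auto. Qed.

Lemma letter_action_BiBi x : P x -> f LBi (f LBi x) = f LB x.
Proof. destruct Hf as (H0 & _ & H2 & H3). intros; rewrite <- (H2 (f LBi x)), H3; auto. Qed.

Lemma fold_closed w x : P x -> P (fold_right f x w).
Proof. destruct Hf as (H0 & _). induction w; simpl; auto. Qed.

Lemma fold_push l w x :
  P x -> fold_right f x (push l w) = f l (fold_right f x w).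
Proof.
  intros Hx. pose proof letter_action_BiB as H4. pose proof letter_action_BiBi as H5.
  destruct Hf as (H0 & H1 & H2 & H3).
  destruct w as [|m w]; [destruct l; reflexivity|].
  pose proof (fold_closed w x Hx) as Hw.
  destruct l, m; simpl; try reflexivity; symmetry; auto.
Qed.

Lemma fold_fold_push u v x :
  P x -> fold_right f x (fold_right push v u) = fold_right f (fold_right f x v) u.
Proof.
  intros Hx. induction u; simpl; [reflexivity|]. rewrite fold_push by assumption.
  now rewrite IHu.
Qed.
End LetterAction.

Lemma push_letter_action : letter_action push (fun w => reducedb w = true).
Proof.
  repeat split.
  - apply push_reduced.
  - intros [|[] [|[] w]]; simpl; easy.
  - intros [|[] [|[] w]]; simpl; easy.
  - intros [|[] [|[] w]]; simpl; easy.
Qed.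

Lemma Gmul_assoc g h k : g ** h ** k = g ** (h ** k).
Proof.
  apply G_eq. destruct g as [u p], h as [v q], k as [w r]. simpl.
  apply (fold_fold_push push _ push_letter_action). exact r.
Qed.

Lemma Gmul_e_l g : Ge ** g = g.
Proof. now apply G_eq. Qed.

Lemma reduced_push l w : reducedb (l :: w) = true -> push l w = l :: w.
Proof. destruct l, w as [|[] w]; simpl; easy. Qed.

Lemma Gmul_e_r g : g ** Ge = g.
Proof.
  apply G_eq. destruct g as [w p]. simpl. induction w as [|l w IH]; [reflexivity|].
  simpl fold_right. rewrite IH by exact (reducedb_tail _ _ p). now apply reduced_push.
Qed.

Definition letter_inv (l : letter) : letter :=
  match l with LA => LA | LB => LBi | LBi => LB end.

Definition Ginv (g : G) : G :=
  exist _ (fold_right push [] (rev (map letter_inv (proj1_sig g))))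
          (foldr_push_reduced _ [] eq_refl).

Lemma push_letter_inv l w : reducedb w = true -> push (letter_inv l) (push l w) = w.
Proof. destruct l, w as [|[] [|[] w]]; simpl; easy. Qed.

Lemma Ginv_l g : Ginv g ** g = Ge.
Proof.
  apply G_eq. destruct g as [w p]. simpl.
  assert (H : forall u v, reducedb v = true ->
    fold_right push v (fold_right push [] u) = fold_right push v u).
  { intros u v Hv. rewrite (fold_fold_push push _ push_letter_action u [] v Hv). reflexivity. }
  rewrite H by exact p. clear H.
  assert (H : forall u v, reducedb v = true ->
    fold_right push (fold_right push v u) (rev (map letter_inv u)) = v).
  { induction u as [|l u IH]; simpl; intros v Hv; [reflexivity|].
    rewrite fold_right_app. simpl. rewrite push_letter_inv; auto using foldr_push_reduced. }
  specialize (H w [] eq_refl).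
  replace (fold_right push [] w) with w in H; [exact H|].
  pose proof (Gmul_e_r (exist _ w p)) as E. apply (f_equal (@proj1_sig _ _)) in E.
  simpl in E. now symmetry.
Qed.

Lemma Ginv_r g : g ** Ginv g = Ge.
Proof.
  rewrite <- (Gmul_e_l (g ** Ginv g)), <- (Ginv_l (Ginv g)), Gmul_assoc.
  now rewrite <- (Gmul_assoc (Ginv g) g), Ginv_l, Gmul_e_l, Ginv_l.
Qed.

Lemma Gmul_inv_cancel g h : g ** (Ginv g ** h) = h.
Proof. now rewrite <- Gmul_assoc, Ginv_r, Gmul_e_l. Qed.

Lemma Ginv_mul_cancel g h : Ginv g ** (g ** h) = h.
Proof. now rewrite <- Gmul_assoc, Ginv_l, Gmul_e_l. Qed.

Lemma Gmul_inj g h k : g ** h = g ** k -> h = k.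
Proof. intros E. rewrite <- (Ginv_mul_cancel g h), E. apply Ginv_mul_cancel. Qed.

Lemma alpha_alpha g : alpha ** (alpha ** g) = g.
Proof. rewrite <- Gmul_assoc. rewrite <- (Gmul_e_l g) at 2. f_equal. now apply G_eq. Qed.

Lemma beta_beta_beta g : beta ** (beta ** (beta ** g)) = g.
Proof.
  rewrite <- !Gmul_assoc. rewrite <- (Gmul_e_l g) at 2. f_equal. now apply G_eq.
Qed.

(** This count replaces word length because left multiplication by [beta] preserves it and by
    [alpha] changes it by exactly one; as the letters alternate, it still bounds the number of
    reduced words. *)
Fixpoint count_a (w : list letter) : nat :=
  match w with
  | [] => 0
  | LA :: w => S (count_a w)
  | _ :: w => count_a w
  end.

Definition cnt (g : G) : nat := count_a (proj1_sig g).

(* The identity is given the type [LA], so that left multiplication by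
   [beta] always rotates types. *)
Definition ty (g : G) : letter :=
  match proj1_sig g with [] => LA | l :: _ => l end.

Definition rot (l : letter) : letter :=
  match l with LA => LB | LB => LBi | LBi => LA end.

Lemma rot3 l : rot (rot (rot l)) = l.
Proof. now destruct l. Qed.

Lemma rot_inj l m : rot l = rot m -> l = m.
Proof. now destruct l, m. Qed.

Lemma letter_dec (l m : letter) : {l = m} + {l <> m}.
Proof. decide equality. Qed.

Lemma ty_beta g : ty (beta ** g) = rot (ty g).
Proof. destruct g as [[|[] [|[] w]] p]; try discriminate p; reflexivity. Qed.

Lemma cnt_beta g : cnt (beta ** g) = cnt g.
Proof. destruct g as [[|[] [|[] w]] p]; try discriminate p; reflexivity. Qed.

Lemma alpha_nonA g : ty g <> LA -> ty (alpha ** g) = LA /\ cnt (alpha ** g) = S (cnt g).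
Proof. destruct g as [[|[] [|[] w]] p]; try discriminate p; cbv [ty cnt]; simpl; easy. Qed.

Lemma alpha_A g :
  ty g = LA -> (1 <= cnt g)%nat -> cnt g = S (cnt (alpha ** g)).
Proof.
  destruct g as [[|[] [|[] w]] p]; try discriminate p; cbv [ty cnt]; simpl; try easy; lia.
Qed.

(** The exceptions come from giving [Ge] the type [LA]: [alpha] exchanges [Ge] and [alpha], both of
    that type. They lie in every ball of radius at least one, whence the later bound [1 <= j0]. *)
Lemma alpha_A_ty g : ty g = LA -> g <> Ge -> g <> alpha -> ty (alpha ** g) <> LA.
Proof.
  destruct g as [[|[] [|[] w]] p]; try discriminate p; cbv [ty cnt]; simpl; try easy.
  - intros _ H _; contradict H; now apply G_eq.
  - intros _ _ H; contradict H; now apply G_eq.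
Qed.

Lemma cnt_Ge : cnt Ge = 0%nat. Proof. reflexivity. Qed.
Lemma cnt_alpha : cnt alpha = 1%nat. Proof. reflexivity. Qed.

Lemma cnt_alpha_le g : (cnt (alpha ** g) <= S (cnt g))%nat.
Proof. destruct g as [[|[] [|[] w]] p]; try discriminate p; cbv [ty cnt]; simpl; lia. Qed.

(* Induction along reduced words: the prefixed letter creates no cancellation,
   so that [cnt] never decreases on the way. *)
Lemma G_ind_reduced (P : G -> Prop) :
  P Ge ->
  (forall g, cnt (alpha ** g) = S (cnt g) -> ty (alpha ** g) = LA -> P g -> P (alpha ** g)) ->
  (forall g, ty (beta ** g) <> LA -> P g -> P (beta ** g)) ->
  forall g, P g.
Proof.
  intros H0 Ha Hb [w p]. induction w as [|l w IH].
  - replace (exist _ [] p) with Ge; [exact H0|now apply G_eq].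
  - assert (p' := reducedb_tail _ _ p). specialize (IH p').
    destruct l.
    + replace (exist _ (LA :: w) p) with (alpha ** exist _ w p').
      * apply Ha; auto; destruct w as [|[] w]; try discriminate p; reflexivity.
      * apply G_eq. now apply (reduced_push LA).
    + replace (exist _ (LB :: w) p) with (beta ** exist _ w p').
      * apply Hb; auto; destruct w as [|[] w]; try discriminate p; easy.
      * apply G_eq. now apply (reduced_push LB).
    + replace (exist _ (LBi :: w) p) with (beta ** (beta ** exist _ w p')).
      { apply Hb; [|apply Hb; auto]; destruct w as [|[] w]; try discriminate p; easy. }
      apply G_eq. simpl. destruct w as [|[] w]; try discriminate p; reflexivity.
Qed.

Arguments Gmul : simpl never.

Lemma rotate_to_A l : l = LA \/ rot l = LA \/ rot (rot l) = LA.
Proof. destruct l; auto. Qed.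

(** Some power of [beta] brings an element to type [LA] without changing its count; stripping that
    first letter then lowers a positive count. *)
Lemma G_finite_ball j : exists L : list G, forall g, (cnt g <= j)%nat -> In g L.
Proof.
  assert (Hrot : forall (Q : G -> Prop), (forall g, Q g -> Q (beta ** g)) ->
            (forall g, ty g = LA -> Q g) -> forall g, Q g).
  { intros Q Hb HA g. destruct (rotate_to_A (ty g)) as [E|[E|E]]; [auto| |];
      rewrite <- !ty_beta in E; rewrite <- (beta_beta_beta g); auto. }
  induction j as [|j [L HL]].
  - exists [Ge; beta; beta ** beta]. intros g Hg.
    revert g Hg. apply (Hrot (fun g => (cnt g <= 0)%nat -> _)).
    + intros g IH. rewrite cnt_beta. intros H. specialize (IH H).
      destruct IH as [<-|[<-|[<-|[]]]].
      * right; left. symmetry; apply Gmul_e_r.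
      * right; right; left; reflexivity.
      * left. symmetry. rewrite <- (Gmul_e_r beta) at 3. apply beta_beta_beta.
    + intros g Ht Hc. left. symmetry. destruct g as [[|[] w] p]; try discriminate Ht.
      * now apply G_eq.
      * cbv [cnt] in Hc; simpl in Hc; lia.
  - exists (L ++ flat_map (fun g => [alpha ** g; beta ** (alpha ** g);
                                     beta ** (beta ** (alpha ** g))]) L).
    intros g Hg.
    assert (H : forall g, (cnt g <= S j)%nat ->
      exists h, (cnt h <= j)%nat /\ (g = h \/ In g [alpha ** h; beta ** (alpha ** h);
                                     beta ** (beta ** (alpha ** h))])).
    { clear g Hg. apply (Hrot (fun g => (cnt g <= S j)%nat -> _)).
      - intros g IH. rewrite cnt_beta. intros H. destruct (IH H) as (h & Hh & D).
        destruct D as [->|[<-|[<-|[<-|[]]]]].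
        + exists (beta ** h). rewrite cnt_beta. auto.
        + exists h; simpl; tauto.
        + exists h; simpl; tauto.
        + exists h; rewrite beta_beta_beta; simpl; tauto.
      - intros g Ht Hc. destruct (le_lt_dec 1 (cnt g)) as [H1|H1].
        + exists (alpha ** g). pose proof (alpha_A g Ht H1). split; [lia|].
          right. left. apply alpha_alpha.
        + exists g. split; [lia|auto]. }
    destruct (H g Hg) as (h & Hh & [->|D]); apply in_or_app; [left; auto|right].
    apply in_flat_map. exists h; auto.
Qed.

(** * Lifts to the line *)

Definition frac (x : R) : R := x - IZR (Int_part x).

Lemma frac_bound x : 0 <= frac x < 1.
Proof. unfold frac. destruct (base_Int_part x). lra. Qed.

Lemma Int_part_eq x n : IZR n <= x < IZR n + 1 -> Int_part x = n.
Proof. intros. symmetry. apply Int_part_spec. lra. Qed.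

Lemma Int_part_shift x n : Int_part (x + IZR n) = (Int_part x + n)%Z.
Proof. apply Int_part_eq. rewrite plus_IZR. pose proof (frac_bound x). unfold frac in *. lra. Qed.

Lemma frac_shift x n : frac (x + IZR n) = frac x.
Proof. unfold frac. rewrite Int_part_shift, plus_IZR. lra. Qed.

Lemma frac_id x : 0 <= x < 1 -> frac x = x.
Proof. intros. unfold frac. rewrite (Int_part_eq x 0); simpl; lra. Qed.

Lemma frac_spec x : exists n, x = frac x + IZR n.
Proof. exists (Int_part x). unfold frac. lra. Qed.

Definition toS (x : R) : S1 := exist _ (frac x) (frac_bound x).

Lemma S1_eq (x y : S1) : proj1_sig x = proj1_sig y -> x = y.
Proof.
  destruct x as [x p], y as [y q]; simpl. intros ->. f_equal. apply proof_irrelevance.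
Qed.

Lemma S1_neq (x y : S1) : x <> y -> proj1_sig x <> proj1_sig y.
Proof. intros H E. apply H. now apply S1_eq. Qed.

Lemma toS_proj z : toS (proj1_sig z) = z.
Proof. apply S1_eq. simpl. apply frac_id. exact (proj2_sig z). Qed.

Lemma toS_shift x n : toS (x + IZR n) = toS x.
Proof. apply S1_eq, frac_shift. Qed.

Lemma toS_eq x y : toS x = toS y -> exists n, x = y + IZR n.
Proof.
  intros E. apply (f_equal (@proj1_sig _ _)) in E. simpl in E.
  exists (Int_part x - Int_part y)%Z. rewrite minus_IZR. unfold frac in E. lra.
Qed.

Definition degree_one (F : R -> R) : Prop :=
  (forall x y, x < y -> F x < F y) /\ (forall x, F (x + 1) = F x + 1).

Lemma degree_one_shift F x n : degree_one F -> F (x + IZR n) = F x + IZR n.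
Proof.
  intros [_ H].
  assert (P : forall n : nat, forall x, F (x + INR n) = F x + INR n).
  { clear x n. induction n as [|n IH]; intros x; [simpl; rewrite !Rplus_0_r; reflexivity|].
    rewrite S_INR. replace (x + (INR n + 1)) with (x + INR n + 1) by lra.
    rewrite H, IH. lra. }
  destruct (Z_le_dec 0 n) as [Hn|Hn].
  - rewrite <- (Z2Nat.id n Hn), <- INR_IZR_INZ. apply P.
  - replace n with (- Z.of_nat (Z.to_nat (- n)))%Z by lia.
    rewrite opp_IZR, <- INR_IZR_INZ.
    set (m := INR _). pose proof (P (Z.to_nat (- n)) (x + - m)) as E. fold m in E.
    replace (x + - m + m) with x in E by lra. lra.
Qed.

Lemma degree_one_comp F H : degree_one F -> degree_one H -> degree_one (fun x => F (H x)).
Proof.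
  intros [F1 F2] [H1 H2]; split; intros; [auto|]. rewrite H2. apply F2.
Qed.

(** The circle is cut open at [s0]: on [0,1), a value of [f] below that at [s0] has passed the
    origin once and is raised by 1. This restores monotonicity on the fundamental domain, and the
    integer part extends the lift. *)
Lemma degree_one_lift (f : S1 -> S1) :
  (forall x y, f x = f y -> x = y) -> orient_pres f ->
  exists F, degree_one F /\ forall x, toS (F x) = f (toS x).
Proof.
  intros Hinj Ho.
  pose (val := fun z : S1 => proj1_sig (f z)).
  pose (F := fun x => val (toS x) + IZR (Int_part x) +
     (if Rlt_dec (val (toS x)) (val s0) then 1 else 0)).
  assert (Hval : forall z, 0 <= val z < 1) by (intros; apply (proj2_sig (f z))).
  assert (Hper : forall x n, F (x + IZR n) = F x + IZR n).
  { intros. unfold F. rewrite toS_shift, Int_part_shift, plus_IZR. lra. }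
  assert (Hfund : forall x, 0 <= x < 1 -> val s0 <= F x < val s0 + 1).
  { intros x Hx. unfold F. rewrite (Int_part_eq x 0) by (simpl; lra).
    pose proof (Hval (toS x)). pose proof (Hval s0). destruct Rlt_dec; simpl; lra. }
  assert (Hmono : forall x y, 0 <= x < 1 -> 0 <= y < 1 -> x < y -> F x < F y).
  { intros x y Hx Hy Hxy.
    assert (Ey : val (toS y) <> val s0).
    { intros E. apply S1_eq, Hinj in E. apply (f_equal (@proj1_sig _ _)) in E.
      simpl in E. rewrite frac_id in E by lra. lra. }
    unfold F. rewrite (Int_part_eq x 0), (Int_part_eq y 0) by (simpl; lra).
    pose proof (Hval (toS x)). pose proof (Hval (toS y)). pose proof (Hval s0).
    destruct (Req_dec x 0) as [->|Hx0].
    - replace (toS 0) with s0 by (apply S1_eq; simpl; rewrite frac_id; lra).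
      repeat destruct Rlt_dec; simpl; lra.
    - assert (C : cyc s0 (toS x) (toS y)).
      { left. simpl. rewrite !frac_id by lra. lra. }
      apply Ho in C. unfold cyc in C. fold (val s0) (val (toS x)) (val (toS y)) in C.
      repeat destruct Rlt_dec; simpl; lra. }
  exists F. split; [split|].
  - intros x y Hxy. destruct (frac_spec x) as [n En], (frac_spec y) as [m Em].
    pose proof (frac_bound x). pose proof (frac_bound y).
    rewrite En, Em, !Hper.
    assert (n <= m)%Z.
    { apply Z.lt_succ_r, lt_IZR. rewrite succ_IZR. lra. }
    destruct (Z.eq_dec n m) as [<-|Hnm].
    + assert (F (frac x) < F (frac y)) by (apply Hmono; lra). lra.
    + assert (Hle : (n + 1 <= m)%Z) by lia. apply IZR_le in Hle. rewrite plus_IZR in Hle.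
      pose proof (Hfund _ H). pose proof (Hfund _ H0). lra.
  - intros. apply (Hper x 1%Z).
  - intros x. unfold F. rewrite <- (toS_proj (f (toS x))).
    fold (val (toS x)).
    destruct Rlt_dec.
    + replace 1 with (IZR 1) by reflexivity. now rewrite !toS_shift.
    + replace 0 with (IZR 0) by reflexivity. now rewrite !toS_shift.
Qed.

(** Each point moves by some integer, and monotonicity between 0 and 1 leaves only the integer
    belonging to 0. *)
Lemma degree_one_deck F :
  degree_one F -> (forall x, toS (F x) = toS x) -> exists k, forall x, F x = x + IZR k.
Proof.
  intros HF H. destruct (toS_eq _ _ (H 0)) as [k Hk]. exists k.
  assert (P : forall x, 0 <= x < 1 -> F x = x + IZR k).
  { intros x Hx. destruct (Req_dec x 0) as [->|Hx0]; [exact Hk|].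
    destruct (toS_eq _ _ (H x)) as [l Hl]. rewrite Hl.
    assert (F 0 < F x) by (apply HF; lra).
    assert (F x < F 1) by (apply HF; lra).
    destruct HF as [_ HF2]. pose proof (HF2 0) as E. rewrite Rplus_0_l in E.
    assert (k < l + 1)%Z by (apply lt_IZR; rewrite plus_IZR; lra).
    assert (l < k + 1)%Z by (apply lt_IZR; rewrite plus_IZR; lra).
    replace l with k by lia. reflexivity. }
  intros x. destruct (frac_spec x) as [n En]. rewrite En.
  rewrite degree_one_shift by assumption. rewrite (P (frac x) (frac_bound x)). lra.
Qed.

(** * Cyclic signs and the lexicographic plane *)

Definition sgnR (x y : R) : Z :=
  if Rlt_dec x y then 1%Z else if Rlt_dec y x then (-1)%Z else 0%Z.

(** As [sgnR] is antisymmetric, this is its coboundary, so the cocycle identity is automatic; on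
    distinct points two of the three signs agree with the orientation and the third opposes it. *)
Definition cycR (x y z : R) : Z := (sgnR x y + sgnR y z + sgnR z x)%Z.

Definition sgn_lex (p q : R * R) : Z :=
  if Req_dec_T (fst p) (fst q) then sgnR (snd p) (snd q) else sgnR (fst p) (fst q).

Ltac sgn_cases := repeat destruct Rlt_dec; repeat destruct Req_dec_T; try lia; try (exfalso; lra).

Lemma sgn_lex_antisym p q : sgn_lex q p = (- sgn_lex p q)%Z.
Proof. unfold sgn_lex, sgnR. repeat destruct Req_dec_T; sgn_cases. Qed.

Lemma sgn_lex_vals p q : sgn_lex p q = 1%Z \/ sgn_lex p q = (-1)%Z \/ p = q.
Proof.
  unfold sgn_lex, sgnR. destruct Req_dec_T; repeat destruct Rlt_dec; auto.
  - right; right. destruct p, q; simpl in *. f_equal; lra.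
  - exfalso. apply n. lra.
Qed.

Lemma sgn_lex_refl p : sgn_lex p p = 0%Z.
Proof. pose proof (sgn_lex_antisym p p). lia. Qed.

Lemma sgn_lex_trans p q r :
  sgn_lex p q = 1%Z -> sgn_lex q r = 1%Z -> sgn_lex p r = 1%Z.
Proof. unfold sgn_lex, sgnR. repeat destruct Req_dec_T; sgn_cases. Qed.

Definition cyc_lex (p q r : R * R) : Z := (sgn_lex p q + sgn_lex q r + sgn_lex r p)%Z.

Lemma cyc_lex_vals p q r :
  cyc_lex p q r = 1%Z \/ cyc_lex p q r = (-1)%Z \/
  (cyc_lex p q r = 0%Z /\ (p = q \/ q = r \/ p = r)).
Proof.
  unfold cyc_lex.
  pose proof (sgn_lex_antisym p q) as A1. pose proof (sgn_lex_antisym q r) as A2.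
  pose proof (sgn_lex_antisym p r) as A3.
  pose proof (sgn_lex_trans p q r). pose proof (sgn_lex_trans r q p).
  pose proof (sgn_lex_refl p). pose proof (sgn_lex_refl q). pose proof (sgn_lex_refl r).
  destruct (sgn_lex_vals p q) as [V1|[V1|V1]]; [| |subst q; right; right; split; [lia|auto]];
  (destruct (sgn_lex_vals q r) as [V2|[V2|V2]]; [| |subst r; right; right; split; [lia|auto]]);
  (destruct (sgn_lex_vals p r) as [V3|[V3|V3]]; [| |subst r; right; right; split; [lia|auto]]);
  lia.
Qed.

Lemma cyc_lex_zero p q r : (p = q \/ q = r \/ p = r) -> cyc_lex p q r = 0%Z.
Proof.
  unfold cyc_lex.
  pose proof (sgn_lex_refl p). pose proof (sgn_lex_refl q).
  pose proof (sgn_lex_antisym p q). pose proof (sgn_lex_antisym p r).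
  intros [ ->|[ ->| ->]]; lia.
Qed.

(* [step U V] is the map induced by [(U, V)] on the quotient of the
   lexicographic plane by the translation [(1, 1)], written in the fundamental
   domain [[0,1) x R]. *)
Definition step (U V : R -> R) (p : R * R) : R * R :=
  (frac (U (fst p)), V (snd p) - IZR (Int_part (U (fst p)))).

Lemma step_step U V U' V' p :
  degree_one U -> degree_one V ->
  step U V (step U' V' p) = step (fun x => U (U' x)) (fun x => V (V' x)) p.
Proof.
  intros HU HV. unfold step; simpl.
  set (n := Int_part (U' (fst p))).
  replace (frac (U' (fst p))) with (U' (fst p) + IZR (- n)) by
    (unfold frac; fold n; rewrite opp_IZR; lra).
  replace (V' (snd p) - IZR n) with (V' (snd p) + IZR (- n)) by (rewrite opp_IZR; lra).
  rewrite (degree_one_shift U), (degree_one_shift V) by assumption.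
  rewrite frac_shift, Int_part_shift, plus_IZR, opp_IZR.
  f_equal. lra.
Qed.

Lemma step_deck U V k p :
  (forall x, U x = x + IZR k) -> (forall x, V x = x + IZR k) -> 0 <= fst p < 1 ->
  step U V p = p.
Proof.
  intros HU HV Hp. unfold step. rewrite HU, HV, frac_shift, Int_part_shift, plus_IZR.
  rewrite frac_id by assumption. rewrite (Int_part_eq (fst p) 0) by (simpl; lra).
  destruct p; simpl. f_equal; lra.
Qed.

(** The map cuts the fundamental domain in two, and the part that overflows is brought back below
    the rest. The correction is a function of [q] minus the same function of [p], so it cancels in
    [cyc_lex], which is therefore invariant. *)
Lemma sgn_lex_step U V p q :
  degree_one U -> degree_one V -> 0 <= fst p < 1 -> 0 <= fst q < 1 ->
  sgn_lex (step U V p) (step U V q) =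
  (sgn_lex p q - 2 * (Int_part (U (fst q)) - Int_part (U (fst p))))%Z.
Proof.
  intros [U1 U2] [V1 _].
  assert (W : forall p q, 0 <= fst p < 1 -> 0 <= fst q < 1 -> fst p < fst q ->
     sgn_lex (step U V p) (step U V q) =
     (sgn_lex p q - 2 * (Int_part (U (fst q)) - Int_part (U (fst p))))%Z).
  { clear p q. intros [x v] [y w]; cbn [fst snd]. intros Hx Hy Hxy.
    pose proof (U1 _ _ Hxy). assert (U y < U x + 1) by (rewrite <- U2; apply U1; lra).
    pose proof (frac_bound (U x)) as Bx. pose proof (frac_bound (U y)) as By.
    unfold sgn_lex, step, sgnR, frac in *; cbn [fst snd] in *.
    set (n := Int_part (U x)) in *. set (m := Int_part (U y)) in *.
    assert (n < m + 1)%Z by (apply lt_IZR; rewrite plus_IZR; lra).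
    assert (m < n + 2)%Z by (apply lt_IZR; rewrite plus_IZR; lra).
    assert (Hm : m = n \/ m = (n + 1)%Z) by lia.
    clearbody n m. destruct Hm as [->| ->]; rewrite ?plus_IZR in *;
      repeat destruct Req_dec_T; sgn_cases. }
  intros Hp Hq. destruct (Rtotal_order (fst p) (fst q)) as [L|[E|L]].
  - now apply W.
  - rewrite E. unfold sgn_lex, step, sgnR; cbn [fst snd]. rewrite E.
    destruct Req_dec_T; [|lra]. destruct Req_dec_T; [|lra].
    pose proof (V1 (snd p) (snd q)). pose proof (V1 (snd q) (snd p)).
    destruct (Rtotal_order (snd p) (snd q)) as [L|[L|L]].
    + specialize (H L). sgn_cases.
    + rewrite L. sgn_cases.
    + specialize (H0 L). sgn_cases.
  - rewrite (sgn_lex_antisym _ (step U V p)), sgn_lex_antisym.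
    rewrite sgn_lex_antisym, W by assumption. rewrite (sgn_lex_antisym p q). lia.
Qed.

(** * Deformations of circular orders *)

(** [u g] stands for the position of the orbit point of [g], measured anticlockwise from the base
    point. [A] and [B] lift the two generators; [ka] and [kb] are the translations by which the
    group relations fail on the line. *)
Record lifted (u : G -> R) (A B : R -> R) (ka kb : Z) : Prop := {
  u_bound : forall g, 0 <= u g < 1;
  u_e : u Ge = 0;
  u_inj : forall g h, u g = u h -> g = h;
  A_one : degree_one A;
  B_one : degree_one B;
  A_sq : forall x, A (A x) = x + IZR ka;
  B_cube : forall x, B (B (B x)) = x + IZR kb;
  u_alpha : forall g, u (alpha ** g) = frac (A (u g));
  u_beta : forall g, u (beta ** g) = frac (B (u g))
}.

Record shift_pair (h h' : R -> R) : Prop := {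
  sp_one : degree_one h;
  sp_one' : degree_one h';
  sp_l : forall x, h' (h x) = x;
  sp_r : forall x, h (h' x) = x
}.

Section Deform.
Context (u : G -> R) (A B : R -> R) (ka kb : Z) (HL : lifted u A B ka kb).
Context (hA hA' hB hB' : R -> R) (SA : shift_pair hA hA') (SB : shift_pair hB hB').

Let A1 x := hA (A (hA' x)).
Let B1 x := hB (B (hB' x)).

Let A1_one : degree_one A1.
Proof.
  apply (degree_one_comp hA (fun x => A (hA' x))); [apply SA|].
  apply (degree_one_comp A hA'); [apply HL|apply SA].
Qed.

Let B1_one : degree_one B1.
Proof.
  apply (degree_one_comp hB (fun x => B (hB' x))); [apply SB|].
  apply (degree_one_comp B hB'); [apply HL|apply SB].
Qed.

(** A conjugator of degree one commutes with integer translations, so [ka] is unchanged. It must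
    agree for [A1] and [A], since only diagonal translations die in the quotient on which [step]
    acts. *)
Let A1_sq x : A1 (A1 x) = x + IZR ka.
Proof.
  unfold A1. rewrite (sp_l _ _ SA), (A_sq _ _ _ _ _ HL).
  rewrite degree_one_shift, (sp_r _ _ SA); auto. apply SA.
Qed.

Let B1_cube x : B1 (B1 (B1 x)) = x + IZR kb.
Proof.
  unfold B1. rewrite !(sp_l _ _ SB), (B_cube _ _ _ _ _ HL).
  rewrite degree_one_shift, (sp_r _ _ SB); auto. apply SB.
Qed.

Let f (l : letter) (p : R * R) : R * R :=
  match l with
  | LA => step A1 A p
  | LB => step B1 B p
  | LBi => step B1 B (step B1 B p)
  end.

Let in_dom (p : R * R) : Prop := 0 <= fst p < 1.

Let in_dom_step U V p : in_dom (step U V p).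
Proof. unfold in_dom. simpl. apply frac_bound. Qed.

Let f_action : letter_action f in_dom.
Proof.
  pose proof (A_one _ _ _ _ _ HL). pose proof (B_one _ _ _ _ _ HL).
  repeat split; try (destruct l; apply in_dom_step).
  - intros p Hp. unfold f. rewrite step_step by assumption.
    apply (step_deck _ _ ka); auto. apply HL.
  - intros p Hp. unfold f. rewrite !step_step; auto using degree_one_comp.
    apply (step_deck _ _ kb); auto. apply HL.
Qed.

Let ev (g : G) : R * R := fold_right f (0, 0) (proj1_sig g).

Let base_dom : in_dom (0, 0).
Proof. unfold in_dom; simpl; lra. Qed.

Let ev_dom g : in_dom (ev g).
Proof. apply (fold_closed f in_dom f_action). exact base_dom. Qed.

Let ev_mul g h : ev (g ** h) = fold_right f (ev h) (proj1_sig g).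
Proof. apply (fold_fold_push f in_dom f_action). exact base_dom. Qed.

(** The integer subtracted from the second coordinate depends on the deformed map, so only the
    fractional part is known. That part suffices: it is the undeformed position and determines
    [g]. *)
Let ev_snd g : frac (snd (ev g)) = u g.
Proof.
  assert (E : forall V, degree_one V -> forall U p w,
    frac (snd p) = w -> frac (snd (step U V p)) = frac (V w)).
  { intros V HV U p w <-. unfold step; simpl. destruct (frac_spec (snd p)) as [n En].
    rewrite En at 1. rewrite degree_one_shift by assumption.
    set (m := Int_part _). replace (V (frac (snd p)) + IZR n - IZR m)
      with (V (frac (snd p)) + IZR (n - m)) by (rewrite minus_IZR; lra).
    apply frac_shift. }
  revert g. apply G_ind_reduced.
  - unfold ev; simpl. rewrite (u_e _ _ _ _ _ HL). apply frac_id. lra.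
  - intros g _ _ IH. rewrite ev_mul, (u_alpha _ _ _ _ _ HL). simpl.
    apply E; [apply HL|exact IH].
  - intros g _ IH. rewrite ev_mul, (u_beta _ _ _ _ _ HL). simpl.
    apply E; [apply HL|exact IH].
Qed.

Lemma deform :
  exists (c' : G -> G -> G -> Z) (v : G -> R),
    is_circular_order c' /\ (forall g, 0 <= v g < 1) /\ v Ge = 0 /\
    (forall g, v (alpha ** g) = frac (hA (A (hA' (v g))))) /\
    (forall g, v (beta ** g) = frac (hB (B (hB' (v g))))) /\
    (forall g1 g2 g3, v g1 <> v g2 -> v g2 <> v g3 -> v g1 <> v g3 ->
       c' g1 g2 g3 = cycR (v g1) (v g2) (v g3)).
Proof.
  exists (fun g1 g2 g3 => cyc_lex (ev g1) (ev g2) (ev g3)), (fun g => fst (ev g)).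
  split; [|split; [|split; [|split; [|split]]]].
  - split; [|split; [|split]].
    + intros. destruct (cyc_lex_vals (ev g1) (ev g2) (ev g3)) as [H|[H|[H _]]]; auto.
    + intros.
      assert (I : forall g h, ev g = ev h -> g = h).
      { intros g h E. apply (u_inj _ _ _ _ _ HL). rewrite <- !ev_snd. now rewrite E. }
      split.
      * destruct (cyc_lex_vals (ev g1) (ev g2) (ev g3)) as [H|[H|[H D]]]; try lia.
        intros _. destruct D as [D|[D|D]]; auto.
      * intros D. apply cyc_lex_zero. destruct D as [ ->|[ ->| ->]]; auto.
    + intros. unfold cyc_lex.
      rewrite (sgn_lex_antisym (ev g2) (ev g4)), (sgn_lex_antisym (ev g1) (ev g4)),
        (sgn_lex_antisym (ev g1) (ev g3)). lia.
    + intros g1 g2 g3 g4. rewrite !ev_mul.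
      assert (S : forall U V p q r, degree_one U -> degree_one V ->
        in_dom p -> in_dom q -> in_dom r ->
        cyc_lex (step U V p) (step U V q) (step U V r) = cyc_lex p q r).
      { intros. unfold cyc_lex. rewrite !sgn_lex_step by assumption. lia. }
      pose proof (A_one _ _ _ _ _ HL). pose proof (B_one _ _ _ _ _ HL).
      pose proof (fold_closed f in_dom f_action) as C.
      induction (proj1_sig g4) as [|l w IH]; [reflexivity|]. simpl.
      rewrite <- IH. destruct l; unfold f at 1 3 5; rewrite ?S; auto.
  - intros. apply ev_dom.
  - reflexivity.
  - intros. rewrite ev_mul. reflexivity.
  - intros. rewrite ev_mul. reflexivity.
  - intros. unfold cyc_lex, cycR, sgn_lex. repeat destruct Req_dec_T; congruence.
Qed.
End Deform.

(* The piecewise linear homeomorphism of the line commuting with [x -> x + 1],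
   supported on the translates of [[al, be]] and sending [r] to [r']. *)
Definition bump (al be r r' : R) (x : R) : R :=
  let n := Int_part (x - al) in
  let y := x - IZR n in
  IZR n +
  (if Rle_dec y r then al + (y - al) * ((r' - al) / (r - al))
   else if Rle_dec y be then be - (be - y) * ((be - r') / (be - r))
   else y).

Lemma bump_fund al be r r' y n :
  al <= y < al + 1 ->
  bump al be r r' (y + IZR n) = IZR n +
  (if Rle_dec y r then al + (y - al) * ((r' - al) / (r - al))
   else if Rle_dec y be then be - (be - y) * ((be - r') / (be - r))
   else y).
Proof.
  intros Hy. unfold bump. replace (Int_part (y + IZR n - al)) with n.
  - replace (y + IZR n - IZR n) with y by lra. reflexivity.
  - symmetry. apply Int_part_eq. lra.
Qed.

Lemma fund_spec al x : exists y n, al <= y < al + 1 /\ x = y + IZR n.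
Proof.
  exists (al + frac (x - al)), (Int_part (x - al)). pose proof (frac_bound (x - al)).
  unfold frac in *. lra.
Qed.

Ltac dle := match goal with |- context [Rle_dec ?a ?b] => destruct (Rle_dec a b) end.

Section Bump.
Context (al be r r' : R).
Context (H1 : al < r < be) (H2 : al < r' < be) (H3 : be <= al + 1).

Let sl : 0 < (r' - al) / (r - al).
Proof. apply Rdiv_lt_0_compat; lra. Qed.
Let sr : 0 < (be - r') / (be - r).
Proof. apply Rdiv_lt_0_compat; lra. Qed.

Let g (y : R) : R :=
  if Rle_dec y r then al + (y - al) * ((r' - al) / (r - al))
  else if Rle_dec y be then be - (be - y) * ((be - r') / (be - r))
  else y.

Let left_le y : y <= r -> al + (y - al) * ((r' - al) / (r - al)) <= r'.
Proof.
  intros. assert (E : (r - al) * ((r' - al) / (r - al)) = r' - al) by (field; lra).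
  pose proof sl. nra.
Qed.

Let right_gt y : r < y -> r' < be - (be - y) * ((be - r') / (be - r)).
Proof.
  intros. assert (E : (be - r) * ((be - r') / (be - r)) = be - r') by (field; lra).
  pose proof sr. nra.
Qed.

Let g_mono y z : al <= y -> y < z -> g y < g z.
Proof.
  intros Hy Hyz. unfold g. pose proof sl. pose proof sr.
  pose proof (left_le y). pose proof (right_gt z).
  destruct (Rle_dec y r), (Rle_dec z r), (Rle_dec y be), (Rle_dec z be);
    try lra; try nra.
Qed.

Let g_al : g al = al.
Proof. unfold g. destruct Rle_dec; lra. Qed.

Let g_top : g (al + 1) = al + 1.
Proof.
  unfold g. destruct Rle_dec; [lra|]. destruct Rle_dec; [|lra].
  replace (be - (al + 1)) with 0 by lra. lra.
Qed.

Lemma bump_degree_one : degree_one (bump al be r r').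
Proof.
  split.
  - intros x y Hxy. destruct (fund_spec al x) as (x0 & n & Hx & ->).
    destruct (fund_spec al y) as (y0 & m & Hy & ->). rewrite !bump_fund by assumption.
    fold (g x0) (g y0).
    assert (n <= m)%Z.
    { apply Z.lt_succ_r, lt_IZR. rewrite succ_IZR. lra. }
    assert (g x0 < al + 1) by (rewrite <- g_top; apply g_mono; lra).
    assert (al <= g y0).
    { destruct (Req_dec y0 al) as [->|]; [rewrite g_al; lra|].
      apply Rlt_le. rewrite <- g_al at 1. apply g_mono; lra. }
    destruct (Z.eq_dec n m) as [<-|Hnm].
    + assert (g x0 < g y0) by (apply g_mono; lra). lra.
    + assert (Hle : (n + 1 <= m)%Z) by lia. apply IZR_le in Hle. rewrite plus_IZR in Hle.
      lra.
  - intros x. destruct (fund_spec al x) as (x0 & n & Hx & ->).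
    replace (x0 + IZR n + 1) with (x0 + IZR (n + 1)) by (rewrite plus_IZR; lra).
    rewrite !bump_fund by assumption. rewrite plus_IZR. lra.
Qed.

Lemma bump_at : bump al be r r' r = r'.
Proof.
  replace r with (r + IZR 0) at 2 by (simpl; lra). rewrite bump_fund by lra.
  destruct Rle_dec; [|lra]. simpl. field. lra.
Qed.

Lemma bump_inv x : bump al be r' r (bump al be r r' x) = x.
Proof.
  destruct (fund_spec al x) as (y & n & Hy & ->). rewrite bump_fund by assumption.
  fold (g y). rewrite (Rplus_comm (IZR n)).
  assert (al <= g y < al + 1).
  { split; [|rewrite <- g_top; apply g_mono; lra].
    destruct (Req_dec y al) as [->|]; [rewrite g_al; lra|].
    apply Rlt_le. rewrite <- g_al at 1. apply g_mono; lra. }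
  rewrite bump_fund by assumption. rewrite Rplus_comm. f_equal.
  pose proof (left_le y). pose proof (right_gt y). pose proof sl. pose proof sr. unfold g in *.
  destruct (Rle_dec y r).
  - dle; [|lra]. field. lra.
  - destruct (Rle_dec y be).
    + dle; [lra|]. dle; [field; lra|]. nra.
    + dle; [lra|]. dle; lra.
Qed.

Lemma bump_outside x : 0 <= al -> be <= 1 -> 0 <= x < 1 -> ~ (al < x < be) ->
  bump al be r r' x = x.
Proof.
  intros Ha Hb Hx Hn. destruct (Rlt_dec x al) as [L|L].
  (* [bump] reads points in the fundamental domain starting at [al], so a point left of [al] is seen
     as [x + 1] with integer part -1. *)
  - replace x with (x + 1 + IZR (-1)) at 1 by (simpl; lra). rewrite bump_fund by lra.
    destruct Rle_dec; [lra|].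
    destruct Rle_dec; [|simpl; lra]. replace (be - (x + 1)) with 0 by lra. simpl. lra.
  - replace x with (x + IZR 0) at 1 by (simpl; lra). rewrite bump_fund by lra.
    destruct Rle_dec.
    + assert (x = al) by lra. subst. simpl. lra.
    + destruct Rle_dec; [|simpl; lra]. replace (be - x) with 0 by lra. simpl; lra.
Qed.
End Bump.

Lemma bump_shift_pair al be r r' :
  al < r < be -> al < r' < be -> be <= al + 1 ->
  shift_pair (bump al be r r') (bump al be r' r).
Proof. split; auto using bump_degree_one, bump_inv. Qed.

(** * Separation of word types *)

Lemma avoid (L : list R) (Q : R -> Prop) m M :
  (forall a, In a L -> Q a -> a < m \/ M < a) ->
  exists al be, al < m /\ M < be /\ forall a, In a L -> Q a -> ~ (al < a < be).
Proof.
  induction L as [|a L IH]; intros H.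
  - exists (m - 1), (M + 1). simpl. split; [|split]; try lra. intros a [].
  - destruct IH as (al & be & Hal & Hbe & Hav); [intros; apply H; simpl; auto|].
    destruct (classic (Q a)) as [Qa|Qa].
    + destruct (H a (or_introl eq_refl) Qa) as [L1|L1].
      * exists (Rmax al a), be. split; [apply Rmax_lub_lt; lra|]. split; [lra|].
        pose proof (Rmax_l al a). pose proof (Rmax_r al a).
        intros b [<-|Hb] Qb; [lra|]. specialize (Hav b Hb Qb). lra.
      * exists al, (Rmin be a). split; [lra|]. split; [apply Rmin_glb_lt; lra|].
        pose proof (Rmin_l be a). pose proof (Rmin_r be a).
        intros b [<-|Hb] Qb; [lra|]. specialize (Hav b Hb Qb). lra.
    + exists al, be. split; [|split]; auto. intros b [<-|Hb] Qb; [tauto|auto].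
Qed.

Lemma shift_pair_id : shift_pair (fun x => x) (fun x => x).
Proof. repeat split; auto. Qed.

(** The stages interlace: [ballA j] is contained in [ballM j], and [ballM j] in [ballA (S j)]. The
    middle one is the union of [ballA j] with its translate by [alpha]. *)
Definition ballA (j : nat) (g : G) : Prop := (cnt g <= j)%nat.
Definition ballM (j : nat) (g : G) : Prop := (cnt g <= j)%nat \/ (cnt g = S j /\ ty g = LA).

Lemma ballA_beta j g : ballA j g <-> ballA j (beta ** g).
Proof. unfold ballA. now rewrite cnt_beta. Qed.

Lemma ballM_alpha j g : ballM j g <-> ballM j (alpha ** g).
Proof.
  assert (H : forall g, ballM j g -> ballM j (alpha ** g)).
  { clear g. intros g H. unfold ballM in *. destruct (letter_dec (ty g) LA) as [E|E].
    - destruct (le_lt_dec 1 (cnt g)) as [L|L].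
      + pose proof (alpha_A g E L). left. lia.
      + pose proof (cnt_alpha_le g). destruct (le_lt_dec 1 j); [left; lia|].
        destruct (le_lt_dec (cnt (alpha ** g)) 0); [left; lia|right].
        destruct g as [[|[] w] p]; try discriminate E.
        * split; [|reflexivity]. replace (exist _ [] p) with Ge by now apply G_eq.
          rewrite Gmul_e_r, cnt_alpha. lia.
        * cbv [cnt] in L; simpl in L; lia.
    - destruct (alpha_nonA g E) as [T C]. destruct H as [H|[H1 H2]]; [|tauto].
      rewrite C. destruct (le_lt_dec (S (cnt g)) j); [auto|right; split; [lia|auto]]. }
  split; [apply H|]. intros H'. rewrite <- (alpha_alpha g). auto.
Qed.

Section Separation.
Context (c : G -> G -> G -> Z) (u : G -> R) (A B : R -> R) (ka kb : Z).
Context (HL : lifted u A B ka kb).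
Context (Hc : forall g1 g2 g3, c g1 g2 g3 = cycR (u g1) (u g2) (u g3)).
Context (Hco : is_circular_order c).
Context (j0 : nat).
Context (Hiso : forall c', is_circular_order c' ->
  (forall g1 g2 g3, ballA j0 g1 -> ballA j0 g2 -> ballA j0 g3 -> c' g1 g2 g3 = c g1 g2 g3) ->
  forall g1 g2 g3, c' g1 g2 g3 = c g1 g2 g3).

Let ub : forall g, 0 <= u g < 1 := u_bound _ _ _ _ _ HL.
Let ue : u Ge = 0 := u_e _ _ _ _ _ HL.
Let ui : forall g h, u g = u h -> g = h := u_inj _ _ _ _ _ HL.

Let u_pos g : g <> Ge -> 0 < u g.
Proof.
  intros H. pose proof (ub g). destruct (Req_dec (u g) 0) as [E|E]; [|lra].
  rewrite <- ue in E. apply ui in E. contradiction.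
Qed.

(** The circle is cut at [Ge], which has coordinate 0. When [P] contains [Ge], comparisons on the
    line decide whether [P] separates two points on the circle. *)
Definition same_gap (P : G -> Prop) (x y : G) : Prop :=
  ~ P x /\ ~ P y /\ forall n, P n -> (u n < u x <-> u n < u y).

Lemma same_gap_sym P x y : same_gap P x y -> same_gap P y x.
Proof. intros (H1 & H2 & H3); repeat split; auto; apply H3; auto. Qed.

Lemma same_gap_trans P x y z : same_gap P x y -> same_gap P y z -> same_gap P x z.
Proof.
  intros (H1 & H2 & H3) (H4 & H5 & H6); split; [auto|split; [auto|]].
  intros n Hn. rewrite H3 by auto. auto.
Qed.

(** Expressed by [c], the relation is visibly compatible with left multiplication, which the
    coordinate [u], cut at one point, is not. *)
Lemma same_gap_c (P : G -> Prop) x y : P Ge ->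
  same_gap P x y <->
  ~ P x /\ ~ P y /\ forall n1 n2, P n1 -> P n2 -> c n1 n2 x = c n1 n2 y.
Proof.
  intros HP. split; intros (Hx & Hy & H); split; auto; split; auto.
  - intros n1 n2 P1 P2. rewrite !Hc. pose proof (H n1 P1). pose proof (H n2 P2).
    assert (forall n z, P n -> ~ P z -> u n <> u z) by (intros n z Hn Hz E; apply ui in E; congruence).
    pose proof (H2 n1 x P1 Hx). pose proof (H2 n1 y P1 Hy).
    pose proof (H2 n2 x P2 Hx). pose proof (H2 n2 y P2 Hy).
    unfold cycR, sgnR. repeat destruct Rlt_dec; try lia; try (exfalso; lra); tauto.
  - intros n Pn.
    assert (Hn : forall z, ~ P z -> (u n < u z <-> c Ge n z = 1%Z \/ n = Ge)).
    { intros z Pz. assert (u n <> u z) by (intros E; apply ui in E; congruence).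
      assert (0 < u z) by (apply u_pos; congruence).
      destruct (classic (n = Ge)) as [->|Hne].
      - rewrite ue. tauto.
      - pose proof (u_pos n Hne). rewrite Hc, ue. unfold cycR, sgnR.
        repeat destruct Rlt_dec; split; intros; try lra; auto; destruct H3; try lia; congruence. }
    rewrite !Hn by assumption. now rewrite H by assumption.
Qed.

Lemma same_gap_move (P : G -> Prop) g x y :
  P Ge -> (forall x, P x <-> P (g ** x)) -> same_gap P x y -> same_gap P (g ** x) (g ** y).
Proof.
  intros He Hg. rewrite !same_gap_c by assumption. intros (H1 & H2 & H3).
  rewrite <- !Hg. split; auto. split; auto. intros n1 n2 P1 P2.
  rewrite <- (Gmul_inv_cancel g n1), <- (Gmul_inv_cancel g n2) in *.
  destruct Hco as (_ & _ & _ & I). rewrite !I. apply H3; apply Hg; assumption.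
Qed.

(** In a common gap, [x] would see the three sides of the triangle formed by [Ge] and its two other
    [beta]-translates with the same non-zero sign. The cocycle identity would then make the
    orientation of this triangle equal to plus or minus 3. *)
Lemma same_gap_beta (P : G -> Prop) x :
  P Ge -> (forall x, P x <-> P (beta ** x)) -> ~ same_gap P x (beta ** x).
Proof.
  intros He Hb. rewrite same_gap_c by assumption. intros (H1 & H2 & H3).
  destruct Hco as (_ & Z0 & CC & I).
  assert (T : forall n1 n2, P n1 -> P n2 -> c (beta ** n1) (beta ** n2) x = c n1 n2 x).
  { intros. rewrite H3, I; auto; now apply (proj1 (Hb _)). }
  set (b := beta ** Ge). set (bb := beta ** b).
  assert (Pb : P b) by exact (proj1 (Hb _) He).
  assert (Pbb : P bb) by exact (proj1 (Hb _) Pb).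
  assert (Ebb : beta ** bb = Ge) by apply beta_beta_beta.
  pose proof (T Ge b He Pb) as T1. pose proof (T b bb Pb Pbb) as T2. rewrite Ebb in T2.
  fold b in T1. fold bb in T1, T2.
  pose proof (CC Ge b bb x) as E.
  assert (c bb Ge x <> 0%Z).
  { rewrite Z0. intros [D|[D|D]]; try congruence.
    unfold bb, b in D. rewrite Gmul_e_r in D. discriminate. }
  assert (c Ge bb x = (- c bb Ge x)%Z).
  { rewrite !Hc. unfold cycR, sgnR. repeat destruct Rlt_dec; try lia; lra. }
  destruct Hco as (V & _). pose proof (V Ge b bb). lia.
Qed.

Lemma same_gap_beta2 (P : G -> Prop) x :
  P Ge -> (forall x, P x <-> P (beta ** x)) -> ~ same_gap P x (beta ** (beta ** x)).
Proof.
  intros He Hb H. apply (same_gap_move _ beta) in H; auto. rewrite beta_beta_beta in H.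
  apply same_gap_sym in H. revert H. now apply same_gap_beta.
Qed.

(** [alpha] reverses the pair formed by [Ge] and [alpha], so in a common gap [x] would see this pair
    with a sign equal to its own negative, although the sign is not zero. *)
Lemma same_gap_alpha (P : G -> Prop) x :
  P Ge -> (forall x, P x <-> P (alpha ** x)) -> ~ same_gap P x (alpha ** x).
Proof.
  intros He Hb. rewrite same_gap_c by assumption. intros (H1 & H2 & H3).
  destruct Hco as (_ & Z0 & CC & I).
  set (a := alpha ** Ge).
  assert (Pa : P a) by exact (proj1 (Hb _) He).
  pose proof (H3 Ge a He Pa) as T1.
  pose proof (I a Ge x alpha) as T2.
  replace (alpha ** a) with Ge in T2 by (symmetry; apply alpha_alpha). fold a in T2.
  assert (c Ge a x <> 0%Z).
  { rewrite Z0. intros [D|[D|D]]; try congruence.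
    unfold a in D. rewrite Gmul_e_r in D. discriminate. }
  assert (c a Ge x = (- c Ge a x)%Z).
  { rewrite !Hc. unfold cycR, sgnR. repeat destruct Rlt_dec; try lia; lra. }
  lia.
Qed.

Lemma not_between (P : G -> Prop) x y z :
  same_gap P x y -> ~ P z -> ~ same_gap P z y ->
  u z < Rmin (u x) (u y) \/ Rmax (u x) (u y) < u z.
Proof.
  intros (H1 & H2 & H3) Hz Hn.
  destruct (Rlt_dec (u z) (Rmin (u x) (u y))) as [L|L]; [auto|].
  destruct (Rlt_dec (Rmax (u x) (u y)) (u z)) as [L'|L']; [auto|].
  exfalso. apply Hn. split; [auto|split; [auto|]]. intros n Pn.
  assert (u n <> u z) by (intros E; apply ui in E; congruence).
  assert (u n <> u x) by (intros E; apply ui in E; congruence).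
  assert (u n <> u y) by (intros E; apply ui in E; congruence).
  pose proof (H3 n Pn). unfold Rmin, Rmax in *. repeat destruct Rle_dec; lra.
Qed.

Lemma window (P : G -> Prop) j x y z :
  P Ge -> (forall g, P g -> ballA j g) ->
  same_gap P x y -> ~ P z -> ~ same_gap P z y ->
  exists al be, 0 <= al /\ be <= 1 /\ al < u x < be /\ al < u y < be /\
    (forall n, P n -> ~ (al < u n < be)) /\ ~ (al < u z < be).
Proof.
  intros He Hball Hxy Pz Hz. pose proof (not_between P x y z Hxy Pz Hz) as Nz.
  destruct Hxy as (H1 & H2 & H3).
  destruct (G_finite_ball j) as [L HLL].
  (* The value 1 stands for the base point at the far end of the cut circle; together with [Ge] at 0
     it keeps the window inside [0,1]. *)
  destruct (avoid (1 :: u z :: map u L) (fun a => a = 1 \/ a = u z \/ exists n, P n /\ u n = a)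
              (Rmin (u x) (u y)) (Rmax (u x) (u y))) as (al & be & Hal & Hbe & Hav).
  - pose proof (ub x). pose proof (ub y).
    intros a _ [->|[->|(n & Pn & <-)]]; auto.
    + right. apply Rmax_lub_lt; lra.
    + assert (u n <> u x) by (intros E; apply ui in E; congruence).
      assert (u n <> u y) by (intros E; apply ui in E; congruence).
      pose proof (H3 n Pn). unfold Rmin, Rmax in *. repeat destruct Rle_dec; lra.
  - assert (HP : forall n, P n -> ~ (al < u n < be)).
    { intros n Pn. apply Hav; [|eauto]. right; right. apply in_map, HLL, Hball, Pn. }
    pose proof (HP Ge He) as HP0. rewrite ue in HP0.
    pose proof (Hav 1 (or_introl eq_refl) (or_introl eq_refl)) as HP1.
    pose proof (ub x). pose proof (ub y).
    pose proof (Rmin_l (u x) (u y)). pose proof (Rmin_r (u x) (u y)).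
    pose proof (Rmax_l (u x) (u y)). pose proof (Rmax_r (u x) (u y)).
    assert (0 < u x) by (apply u_pos; congruence).
    exists al, be. repeat split; auto; try lra.
    apply Hav; simpl; auto.
Qed.

Lemma other_side al be p r :
  al < p < be -> al < r < be -> p <> r ->
  exists r', al < r' < be /\ (r < p < r' \/ r' < p < r).
Proof.
  intros. destruct (Rlt_dec r p).
  - exists ((p + be) / 2). lra.
  - exists ((al + p) / 2). lra.
Qed.

(** Agreement on the ball forces [c'] to equal [c], but carrying [r] across [p] reverses the sign of
    the triple [Ge], [p], [r]. *)
Lemma swap_contradiction c' v p r r' :
  is_circular_order c' -> v Ge = 0 ->
  (forall g1 g2 g3, v g1 <> v g2 -> v g2 <> v g3 -> v g1 <> v g3 ->
       c' g1 g2 g3 = cycR (v g1) (v g2) (v g3)) ->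
  (forall g, ballA j0 g -> v g = u g) ->
  p <> Ge -> r <> Ge -> v p = u p -> v r = r' -> 0 < r' ->
  (u r < u p < r' \/ r' < u p < u r) -> False.
Proof.
  intros C' ve Hv Hball Hp Hr vp vr Hr' Hs.
  assert (E : c' Ge p r = c Ge p r).
  { apply Hiso; auto. intros g1 g2 g3 B1 B2 B3.
    assert (D : g1 = g2 \/ g2 = g3 \/ g1 = g3 -> c' g1 g2 g3 = c g1 g2 g3).
    { intros D. destruct C' as (_ & Z1 & _), Hco as (_ & Z2 & _).
      rewrite (proj2 (Z1 _ _ _) D), (proj2 (Z2 _ _ _) D). reflexivity. }
    destruct (classic (g1 = g2)); [auto|]. destruct (classic (g2 = g3)); [auto|].
    destruct (classic (g1 = g3)); [auto|].
    rewrite Hv, Hc, !Hball by (rewrite ?Hball by assumption; try (intros E; apply ui in E); auto).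
    reflexivity. }
  pose proof (u_pos p Hp). pose proof (u_pos r Hr).
  rewrite Hv, Hc, ue, ve, vp, vr in E by (rewrite ?ve, ?vp, ?vr; lra).
  unfold cycR, sgnR in E. repeat destruct Rlt_dec; lra || lia.
Qed.

(** Along a conjugated generator the deformed position stays the [h]-image of the original one. The
    relation is kept modulo integers because [frac] and [h'] commute only up to integers. *)
Lemma conj_step F h h' w x y :
  shift_pair h h' -> degree_one F ->
  (exists n, h' w = x + IZR n) -> y = frac (F x) ->
  exists n, h' (frac (h (F (h' w)))) = y + IZR n.
Proof.
  intros S HF [n Hn] ->. rewrite Hn, (degree_one_shift F) by assumption.
  destruct (frac_spec (h (F x + IZR n))) as [m Hm].
  exists (Int_part (F x) + n - m)%Z.
  apply (f_equal h') in Hm. rewrite (sp_l _ _ S), degree_one_shift in Hm by apply S.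
  unfold frac at 2. rewrite minus_IZR, plus_IZR. lra.
Qed.

Lemma conj_value h h' w x n :
  shift_pair h h' -> h' w = x + IZR n -> 0 <= w < 1 -> w = frac (h x).
Proof.
  intros S E Hw. apply (f_equal h) in E. rewrite (sp_r _ _ S), degree_one_shift in E by apply S.
  replace (h x) with (w + IZR (- n)) by (rewrite opp_IZR; lra).
  now rewrite frac_shift, frac_id.
Qed.

Lemma beta_orbit_A r : ty r <> LA ->
  exists p, ty p = LA /\ cnt p = cnt r /\ (r = beta ** p \/ r = beta ** (beta ** p)).
Proof.
  intros H. destruct (rotate_to_A (ty r)) as [E|[E|E]]; [tauto| |].
  - exists (beta ** r). rewrite ty_beta, cnt_beta, beta_beta_beta. auto.
  - exists (beta ** (beta ** r)). rewrite !ty_beta, !cnt_beta, beta_beta_beta. auto.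
Qed.

(** Here [beta] is bumped in a window around [p] and [r]. The element [p] stays although it lies in
    the window, being reached from the ball by the undeformed [alpha]. The element [r] is a power of
    [beta] applied to [p'] of type [LA]; [p'] also stays and is kept outside the window, so [r]
    moves with the bump and can be carried across [p]. *)
Lemma level_beta j p r : (j0 <= j)%nat ->
  cnt p = S j -> ty p = LA -> cnt r = S j -> ty r <> LA ->
  ~ same_gap (ballA j) p r.
Proof.
  intros Hj Cp Tp Cr Tr H.
  destruct (beta_orbit_A r Tr) as (p' & Tp' & Cp' & Er).
  assert (He : ballA j Ge) by (unfold ballA; rewrite cnt_Ge; lia).
  destruct (window (ballA j) j p r p') as (al & be & Hal & Hbe & Wp & Wr & HP & Wz); auto.
  { unfold ballA; lia. }
  { destruct Er as [->| ->]; [apply same_gap_beta|apply same_gap_beta2]; auto;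
      apply ballA_beta. }
  assert (Npr : u p <> u r) by (intros E; apply ui in E; congruence).
  destruct (other_side al be (u p) (u r) Wp Wr Npr) as (r' & Wr' & Hs).
  assert (SB : shift_pair (bump al be (u r) r') (bump al be r' (u r))).
  { apply bump_shift_pair; lra. }
  destruct (deform u A B ka kb HL _ _ _ _ shift_pair_id SB)
    as (c' & v & C' & vb & ve & va & vbt & Hv).
  set (h := bump al be (u r) r') in *. set (h' := bump al be r' (u r)) in *.
  assert (Fix : forall x, 0 <= x < 1 -> ~ (al < x < be) -> h x = x /\ h' x = x).
  { intros; split; apply bump_outside; auto; lra. }
  assert (Vb : forall g, (exists n, h' (v g) = u g + IZR n) ->
                 exists n, h' (v (beta ** g)) = u (beta ** g) + IZR n).
  { intros g Hg. rewrite vbt. apply (conj_step B h h' (v g) (u g)); auto; apply HL. }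
  assert (V0 : forall g, v g = u g -> ~ (al < u g < be) -> exists n, h' (v g) = u g + IZR n).
  { intros g E W. exists 0%Z. rewrite E. simpl. rewrite Rplus_0_r. apply Fix; auto. }
  assert (Vbk : forall g, (exists n, h' (v g) = u g + IZR n) -> v g = frac (h (u g))).
  { intros g [n Hn]. apply (conj_value h h' _ _ n); auto. }
  assert (Vball : forall g, ballA j g -> v g = u g).
  { apply (G_ind_reduced (fun g => ballA j g -> v g = u g)).
    - now rewrite ve, ue.
    - unfold ballA. intros g Cg _ IH Hg. rewrite va, (u_alpha _ _ _ _ _ HL), IH; auto; lia.
    - intros g _ IH Hg. pose proof (proj2 (ballA_beta j g) Hg) as Hg'.
      rewrite (Vbk _ (Vb g (V0 g (IH Hg') (HP g Hg')))).
      rewrite (proj1 (Fix _ (ub _) (HP _ Hg))). apply frac_id, ub. }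
  assert (Vlift : forall g, cnt g = S j -> ty g = LA -> v g = u g).
  { intros g Cg Tg. rewrite <- (alpha_alpha g), va, (u_alpha _ _ _ _ _ HL).
    rewrite Vball; auto. pose proof (alpha_A g Tg). unfold ballA. lia. }
  assert (Vr : v r = r').
  { assert (Gr : exists n, h' (v r) = u r + IZR n).
    { assert (G0 := V0 p' (Vlift p' (eq_trans Cp' Cr) Tp') Wz).
      destruct Er as [->| ->]; auto. }
    rewrite (Vbk r Gr). unfold h. rewrite bump_at by lra. apply frac_id. lra. }
  assert (r <> Ge /\ p <> Ge).
  { split; intros ->; [rewrite cnt_Ge in Cr|rewrite cnt_Ge in Cp]; lia. }
  apply (swap_contradiction c' v p r r'); auto; try tauto; try lra.
  intros g Hg. apply Vball. unfold ballA in *. lia.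
Qed.

(** The counterpart of [level_beta] with the generators exchanged: [x] is reached from [ballM j] by
    the undeformed [beta] and stays, while [alpha ** r] follows the bump because [r] is kept outside
    the window. *)
Lemma level_alpha j x r : (j0 <= j)%nat ->
  cnt x = S j -> ty x <> LA -> cnt r = S j -> ty r <> LA ->
  ~ same_gap (ballM j) x (alpha ** r).
Proof.
  intros Hj Cx Tx Cr Tr H. set (y := alpha ** r) in *.
  assert (He : ballM j Ge) by (left; rewrite cnt_Ge; lia).
  assert (Nr : ~ ballM j r) by (unfold ballM; intros [D|D]; [lia|tauto]).
  destruct (window (ballM j) (S j) x y r) as (al & be & Hal & Hbe & Wp & Wr & HP & Wz); auto.
  { unfold ballM, ballA. intros; lia. }
  { apply same_gap_alpha; auto. apply ballM_alpha. }
  destruct (alpha_nonA r Tr) as [Ty Cy]. fold y in Ty, Cy.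
  assert (Npr : u x <> u y) by (intros E; apply ui in E; congruence).
  destruct (other_side al be (u x) (u y) Wp Wr Npr) as (r' & Wr' & Hs).
  assert (SA : shift_pair (bump al be (u y) r') (bump al be r' (u y))).
  { apply bump_shift_pair; lra. }
  destruct (deform u A B ka kb HL _ _ _ _ SA shift_pair_id)
    as (c' & v & C' & vb & ve & va & vbt & Hv).
  set (h := bump al be (u y) r') in *. set (h' := bump al be r' (u y)) in *.
  assert (Fix : forall x, 0 <= x < 1 -> ~ (al < x < be) -> h x = x /\ h' x = x).
  { intros; split; apply bump_outside; auto; lra. }
  assert (Va : forall g, (exists n, h' (v g) = u g + IZR n) ->
                 exists n, h' (v (alpha ** g)) = u (alpha ** g) + IZR n).
  { intros g Hg. rewrite va. apply (conj_step A h h' (v g) (u g)); auto; apply HL. }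
  assert (V0 : forall g, v g = u g -> ~ (al < u g < be) -> exists n, h' (v g) = u g + IZR n).
  { intros g E W. exists 0%Z. rewrite E. simpl. rewrite Rplus_0_r. apply Fix; auto. }
  assert (Vbk : forall g, (exists n, h' (v g) = u g + IZR n) -> v g = frac (h (u g))).
  { intros g [n Hn]. apply (conj_value h h' _ _ n); auto. }
  assert (Vb : forall g, v g = u g -> v (beta ** g) = u (beta ** g)).
  { intros g E. now rewrite vbt, (u_beta _ _ _ _ _ HL), E. }
  assert (Vball : forall g, ballM j g -> v g = u g).
  { apply (G_ind_reduced (fun g => ballM j g -> v g = u g)).
    - now rewrite ve, ue.
    - intros g Cg Tg IH Hg. pose proof (proj2 (ballM_alpha j g) Hg) as Hg'.
      rewrite (Vbk _ (Va g (V0 g (IH Hg') (HP g Hg')))).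
      rewrite (proj1 (Fix _ (ub _) (HP _ Hg))). apply frac_id, ub.
    - intros g Tg IH [Hg|[_ Hg]]; [|contradiction]. apply Vb, IH. left.
      now rewrite cnt_beta in Hg. }
  assert (Vlift : forall g, cnt g = S j -> ty g <> LA -> v g = u g).
  { intros g Cg Tg. destruct (beta_orbit_A g Tg) as (p & Tp & Cp & Eg).
    assert (Ep : v p = u p) by (apply Vball; right; split; [lia|auto]).
    destruct Eg as [->| ->]; auto. }
  assert (Vy : v y = r').
  { rewrite (Vbk y). { unfold h. rewrite bump_at by lra. apply frac_id. lra. }
    apply Va, V0; auto. }
  assert (x <> Ge /\ y <> Ge).
  { split; intros E; rewrite E in *; rewrite cnt_Ge in *; lia. }
  apply (swap_contradiction c' v x y r'); auto; try tauto; try lra.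
  intros g Hg. apply Vball. left. unfold ballA in *. lia.
Qed.

(** The new elements all lie in other gaps of [P], hence outside the segment between [x] and [y]. *)
Lemma same_gap_enlarge (P Q : G -> Prop) x y :
  same_gap P x y -> ~ Q x -> ~ Q y -> (forall z, Q z -> ~ same_gap P z x) ->
  same_gap Q x y.
Proof.
  intros H Qx Qy HQ. split; [auto|split; [auto|]]. intros n Qn.
  assert (Hn := HQ n Qn). assert (Nx : u n <> u x) by (intros E; apply ui in E; congruence).
  assert (Ny : u n <> u y) by (intros E; apply ui in E; congruence).
  destruct (classic (P n)) as [Pn|Pn]; [destruct H as (_ & _ & H); auto|].
  assert (Hn' : ~ same_gap P n y).
  { intros D. apply Hn. apply (same_gap_trans _ _ y); auto. now apply same_gap_sym. }
  pose proof (not_between P x y n H Pn Hn') as D.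
  unfold Rmin, Rmax in D. repeat destruct Rle_dec; lra.
Qed.

(** Induction on the excess of the counts over the radius. If the gap misses the next ball, the
    radius can grow. Otherwise some [r] of that ball lies in the gap and serves as reference. Up to
    rotation, the bad case is [q] of type [LA] with [r] of another type: by [level_beta] their gap
    survives in [ballM j], then [alpha] is applied, and by [level_alpha] the gap survives in the
    next ball, where induction applies. *)
Lemma same_gap_type d : forall j x y, (j0 <= j)%nat ->
  (cnt x <= j + d)%nat -> (cnt y <= j + d)%nat -> same_gap (ballA j) x y -> ty x = ty y.
Proof.
  induction d as [d IH] using lt_wf_ind. intros j x y Hj Cx Cy H.
  assert (He : forall j, ballA j Ge) by (intros; unfold ballA; rewrite cnt_Ge; lia).
  assert (HeM : forall j, ballM j Ge) by (intros; left; apply He).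
  assert (Nx := proj1 H). assert (Ny := proj1 (proj2 H)). unfold ballA in Nx, Ny.
  destruct (classic (exists r, ballA (S j) r /\ same_gap (ballA j) r x)) as [(r & Br & Hr)|Hnr].
  2: { destruct (letter_dec (ty x) (ty y)) as [E|E]; [exact E|].
       apply (IH (d - 1)%nat) with (j := S j); try lia.
       assert (forall z, same_gap (ballA j) z x -> ~ ballA (S j) z) by eauto.
       apply (same_gap_enlarge (ballA j)); auto.
       - apply (H0 x). apply (same_gap_trans _ _ y); auto using same_gap_sym.
       - apply (H0 y). now apply same_gap_sym.
       - intros z Bz Hz. exact (H0 z Hz Bz). }
  assert (Key : forall q, (cnt q <= j + d)%nat -> same_gap (ballA j) r q -> ty r = ty q).
  { clear x y Cx Cy H Nx Ny Hr. intros q Cq H.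
    assert (KeyA : forall r q, ballA (S j) r -> (cnt q <= j + d)%nat ->
              same_gap (ballA j) r q -> ty q = LA -> ty r = LA).
    { clear r q Br Cq H. intros r q Br Cq H Tq.
      destruct (letter_dec (ty r) LA) as [Tr|Tr]; [exact Tr|exfalso].
      assert (Cr : cnt r = S j) by (destruct H as (H & _); unfold ballA in *; lia).
      assert (Nq : ~ ballA j q) by apply H.
      assert (HM : same_gap (ballM j) r q).
      { apply (same_gap_enlarge (ballA j)); auto.
        - intros [D|[_ D]]; [lia|contradiction].
        - intros [D|[D D']]; [contradiction|].
          apply (level_beta j q r); auto using same_gap_sym.
        - intros z [Bz|[Cz Tz]] Hz; [destruct Hz; contradiction|].
          exact (level_beta j z r Hj Cz Tz Cr Tr Hz). }
      apply (same_gap_move _ alpha) in HM; [|apply HeM|apply ballM_alpha].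
      destruct (alpha_nonA r Tr) as [Tar Car].
      assert (NMq : ~ ballM j q).
      { rewrite ballM_alpha. apply HM. }
      assert (Taq : ty (alpha ** q) <> LA).
      { apply alpha_A_ty; auto; intros ->; apply NMq; [apply HeM|].
        rewrite <- (Gmul_e_r alpha). apply ballM_alpha, HeM. }
      assert (Caq : cnt q = S (cnt (alpha ** q))).
      { apply alpha_A; auto. unfold ballA in Nq. lia. }
      assert (NA : forall z, ballA (S j) z -> ~ ballM j z -> cnt z = S j /\ ty z <> LA).
      { intros z Bz NM. unfold ballA, ballM in *.
        assert (~ (cnt z <= j)%nat) by tauto. split; [lia|]. intros E. apply NM; right.
        split; [lia|auto]. }
      assert (HB : ~ ballA (S j) (alpha ** q)).
      { intros D. destruct (NA _ D (proj1 (proj2 HM))) as [C T].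
        apply (level_alpha j (alpha ** q) r); auto using same_gap_sym. }
      assert (HN : same_gap (ballA (S j)) (alpha ** r) (alpha ** q)).
      { apply (same_gap_enlarge (ballM j)); auto.
        - unfold ballA. lia.
        - intros z Bz Hz. destruct (NA z Bz (proj1 Hz)) as [C T].
          apply (level_alpha j z r); auto. }
      unfold ballA in HB, Nq.
      (* [alpha] lowers the count of [q] by one while the radius rises by one, so the excess drops
         by two. *)
      assert (E : ty (alpha ** r) = ty (alpha ** q)).
      { apply (IH (d - 2)%nat) with (j := S j); auto; lia. }
      congruence. }
    (* Since [ballA j] is [beta]-invariant, both elements may be rotated together until [q] has type
       [LA]. *)
    assert (Hrot : forall n r q, ballA (S j) r -> (cnt q <= j + d)%nat ->
              same_gap (ballA j) r q -> Nat.iter n rot (ty q) = LA ->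
              Nat.iter n rot (ty r) = LA).
    { clear r q Br Cq H. induction n as [|n IHn]; intros r q Br Cq H Tq.
      - now apply (KeyA r q).
      - rewrite Nat.iter_succ_r, <- ty_beta in *. apply IHn with (q := beta ** q); auto.
        + exact (proj1 (ballA_beta _ _) Br).
        + now rewrite cnt_beta.
        + apply same_gap_move; auto. apply ballA_beta. }
    destruct (rotate_to_A (ty q)) as [E|[E|E]].
    - rewrite E. exact (Hrot 0%nat r q Br Cq H E).
    - pose proof (Hrot 1%nat r q Br Cq H E) as E'. simpl in E'. apply rot_inj. congruence.
    - pose proof (Hrot 2%nat r q Br Cq H E) as E'. simpl in E'. apply rot_inj, rot_inj.
      congruence. }
  transitivity (ty r); [symmetry; now apply Key|apply Key; auto].
  apply (same_gap_trans _ _ x); auto.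
Qed.

Lemma type_separation x y :
  ~ ballA j0 x -> ~ ballA j0 y -> ty x <> ty y ->
  exists n1 n2, ballA j0 n1 /\ ballA j0 n2 /\ c x n1 y = 1%Z /\ c y n2 x = 1%Z.
Proof.
  intros Nx Ny Hty.
  assert (He : ballA j0 Ge) by (unfold ballA; rewrite cnt_Ge; lia).
  assert (H : ~ forall n, ballA j0 n -> (u n < u x <-> u n < u y)).
  { intros H. apply Hty. apply (same_gap_type (cnt x + cnt y) j0); try lia.
    split; auto. }
  apply not_all_ex_not in H. destruct H as [n H].
  assert (Hn : ballA j0 n) by tauto.
  assert (u n <> u x) by (intros E; apply ui in E; congruence).
  assert (u n <> u y) by (intros E; apply ui in E; congruence).
  assert (0 < u x) by (apply u_pos; congruence).
  assert (0 < u y) by (apply u_pos; congruence).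
  destruct (Rlt_dec (u n) (u x)).
  - assert (u y < u n) by (destruct (Rlt_dec (u n) (u y)); [tauto|lra]).
    (* [Ge] separates on the arc through the cut, [n] on the opposite arc. *)
    exists Ge, n. split; [auto|split; [auto|]]. rewrite !Hc, ue. unfold cycR, sgnR.
    repeat destruct Rlt_dec; try lra; auto.
  - assert (u n < u y) by (destruct (Rlt_dec (u n) (u y)); [auto|tauto]).
    exists n, Ge. split; [auto|split; [auto|]]. rewrite !Hc, ue. unfold cycR, sgnR.
    repeat destruct Rlt_dec; try lra; auto.
Qed.
End Separation.

(** * The given action *)

Lemma S1_eq_iff (x y : S1) : x = y <-> proj1_sig x = proj1_sig y.
Proof. split; [now intros ->|apply S1_eq]. Qed.

(** In coordinates on [0,1) the cyclic order is a disjunction of linear inequalities, so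
    configurations of finitely many points are settled by linear arithmetic. *)
Ltac circ :=
  intros; unfold arc_cc, arc_oo in *; rewrite ?S1_eq_iff in *; unfold cyc in *; lra.

Lemma cyc_total x y z : x <> y -> y <> z -> x <> z -> cyc x y z \/ cyc z y x.
Proof. circ. Qed.
Lemma cyc_rot x y z : cyc x y z -> cyc y z x.
Proof. circ. Qed.

Section Orbit.
Context (c : G -> G -> G -> Z) (phi : G -> S1 -> S1) (x0 : S1).
Context (Hact : is_action phi).

Lemma act_mul g h x : phi (g ** h) x = phi g (phi h x).
Proof. apply Hact. Qed.

Lemma act_inv_l g x : phi (Ginv g) (phi g x) = x.
Proof. rewrite <- act_mul, Ginv_l. apply Hact. Qed.

Lemma act_inv_r g x : phi g (phi (Ginv g) x) = x.
Proof. rewrite <- act_mul, Ginv_r. apply Hact. Qed.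

Lemma act_inj g x y : phi g x = phi g y -> x = y.
Proof. intros E. rewrite <- (act_inv_l g x), E. apply act_inv_l. Qed.

Lemma act_cyc g x y z : cyc x y z -> cyc (phi g x) (phi g y) (phi g z).
Proof. destruct Hact as [H _]. destruct (H g) as [_ O]. apply O. Qed.

Lemma act_cyc_inv g x y z : cyc (phi g x) (phi g y) (phi g z) -> cyc x y z.
Proof. intros H. apply (act_cyc (Ginv g)) in H. now rewrite !act_inv_l in H. Qed.

Context (Hfree : forall g, phi g x0 = x0 -> g = Ge).

Lemma orbit_inj g h : phi g x0 = phi h x0 -> g = h.
Proof.
  intros E. apply (Gmul_inj (Ginv g)). rewrite Ginv_l. symmetry. apply Hfree.
  rewrite act_mul, <- E. apply act_inv_l.
Qed.

Lemma orbit_neq g h : g <> h -> phi g x0 <> phi h x0.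
Proof. intros H E. apply H. now apply orbit_inj. Qed.

Let th := proj1_sig x0.
Let u (g : G) : R := frac (proj1_sig (phi g x0) - th).

Let u_toS g : toS (u g + th) = phi g x0.
Proof.
  rewrite <- (toS_proj (phi g x0)). unfold u, frac.
  set (n := Int_part _). replace (proj1_sig (phi g x0))
    with (proj1_sig (phi g x0) - th - IZR n + th + IZR n) by lra.
  rewrite toS_shift. f_equal. lra.
Qed.

Let u_unique r g : toS (r + th) = phi g x0 -> u g = frac r.
Proof.
  intros E. rewrite <- u_toS in E. destruct (toS_eq _ _ E) as [n En].
  replace r with (u g + IZR n) by lra. rewrite frac_shift. symmetry.
  apply frac_id, frac_bound.
Qed.

Lemma orbit_lifted : exists A B ka kb, lifted u A B ka kb.
Proof.
  assert (L : forall g, exists A, degree_one A /\ forall x, toS (A x + th) = phi g (toS (x + th))).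
  { intros g. destruct (degree_one_lift (phi g)) as (F & HF & EF).
    - intros x y. apply act_inj.
    - intros x y z. apply act_cyc.
    - exists (fun x => F (x + th) - th). split; [split|].
      + intros x y Hxy. assert (F (x + th) < F (y + th)) by (apply HF; lra). lra.
      + intros x. replace (x + 1 + th) with (x + th + 1) by lra.
        destruct HF as [_ HF]. rewrite HF. lra.
      + intros x. rewrite <- EF. f_equal. lra. }
  destruct (L alpha) as (A & HA & EA), (L beta) as (B & HB & EB).
  assert (D : forall F, degree_one F -> (forall x, toS (F x + th) = toS (x + th)) ->
            exists k, forall x, F x = x + IZR k).
  { intros F HF EF. apply degree_one_deck; auto. intros x.
    destruct (toS_eq _ _ (EF x)) as [n En]. replace (F x) with (x + IZR n) by lra.
    apply toS_shift. }
  destruct (D (fun x => A (A x))) as [ka Ka].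
  { now apply degree_one_comp. }
  { intros x. rewrite !EA, <- act_mul. replace (alpha ** alpha) with Ge by now apply G_eq.
    apply Hact. }
  destruct (D (fun x => B (B (B x)))) as [kb Kb].
  { apply (degree_one_comp B (fun x => B (B x))); auto. now apply degree_one_comp. }
  { intros x. rewrite !EB, <- !act_mul.
    replace (beta ** beta ** beta) with Ge by now apply G_eq. apply Hact. }
  exists A, B, ka, kb. split; auto.
  - intros g. apply frac_bound.
  - unfold u. destruct Hact as (_ & E & _). rewrite E. unfold th.
    replace (proj1_sig x0 - proj1_sig x0) with 0 by lra. apply frac_id. lra.
  - intros g h E. apply orbit_inj. rewrite <- !u_toS. now rewrite E.
  - intros g. apply u_unique. rewrite EA, u_toS. symmetry. apply act_mul.
  - intros g. apply u_unique. rewrite EB, u_toS. symmetry. apply act_mul.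
Qed.

Let u_val g : (th <= proj1_sig (phi g x0) /\ u g = proj1_sig (phi g x0) - th) \/
              (proj1_sig (phi g x0) < th /\ u g = proj1_sig (phi g x0) - th + 1).
Proof.
  pose proof (proj2_sig (phi g x0)) as Hp. pose proof (proj2_sig x0) as H0. simpl in Hp, H0.
  fold th in H0.
  unfold u. set (p := proj1_sig (phi g x0)) in *.
  destruct (Rlt_dec p th); [right|left]; split; auto; try lra.
  - replace (p - th) with (p - th + 1 + IZR (-1)) at 1 by (simpl; lra).
    rewrite frac_shift. apply frac_id. lra.
  - apply frac_id. lra.
Qed.

Context (Hco : is_circular_order c).
Context (Hc : forall g1 g2 g3,
    (cyc (phi g1 x0) (phi g2 x0) (phi g3 x0) -> c g1 g2 g3 = 1%Z) /\
    (cyc (phi g3 x0) (phi g2 x0) (phi g1 x0) -> c g1 g2 g3 = (-1)%Z)).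

Lemma order_cycR g1 g2 g3 : c g1 g2 g3 = cycR (u g1) (u g2) (u g3).
Proof.
  destruct (classic (g1 = g2 \/ g2 = g3 \/ g1 = g3)) as [D|D].
  - rewrite (proj2 (proj1 (proj2 Hco) g1 g2 g3) D). unfold cycR, sgnR.
    destruct D as [ ->|[ ->| ->]]; repeat destruct Rlt_dec; try lia; lra.
  - destruct (Hc g1 g2 g3) as [H1 H2].
    assert (D1 : phi g1 x0 <> phi g2 x0) by (apply orbit_neq; tauto).
    assert (D2 : phi g2 x0 <> phi g3 x0) by (apply orbit_neq; tauto).
    assert (D3 : phi g1 x0 <> phi g3 x0) by (apply orbit_neq; tauto).
    pose proof (proj2_sig (phi g1 x0)). pose proof (proj2_sig (phi g2 x0)).
    pose proof (proj2_sig (phi g3 x0)). simpl in *.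
    pose proof (u_val g1). pose proof (u_val g2). pose proof (u_val g3).
    destruct (cyc_total _ _ _ D1 D2 D3) as [C|C];
      [rewrite (H1 C)|rewrite (H2 C)]; clear H1 H2; unfold cyc in C; unfold cycR, sgnR;
      repeat destruct Rlt_dec; try reflexivity; exfalso; lra.
Qed.

Lemma orbit_type_separation :
  isolated_CO c ->
  exists j0, (1 <= j0)%nat /\ forall x y, ~ ballA j0 x -> ~ ballA j0 y -> ty x <> ty y ->
    exists n1 n2, ballA j0 n1 /\ ballA j0 n2 /\
      cyc (phi x x0) (phi n1 x0) (phi y x0) /\ cyc (phi y x0) (phi n2 x0) (phi x x0).
Proof.
  intros [_ [F HF]].
  assert (Hj : exists j, forall g1 g2 g3, In (g1, g2, g3) F ->
             ballA j g1 /\ ballA j g2 /\ ballA j g3).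
  { clear HF. induction F as [|[[h1 h2] h3] F [j IH]].
    - exists 0%nat. intros g1 g2 g3 [].
    (* A crude sum of counts bounds all entries of the finite neighbourhood. *)
    - exists (j + cnt h1 + cnt h2 + cnt h3)%nat. intros g1 g2 g3 [E|Hin].
      + injection E as -> -> ->. unfold ballA. lia.
      + apply IH in Hin. unfold ballA in *. lia. }
  (* The radius is raised by one so that the ball contains [alpha], the second exception in
     [alpha_A_ty]. *)
  destruct Hj as [j Hj]. exists (S j). split; [lia|].
  destruct orbit_lifted as (A & B & ka & kb & HL).
  intros x y Nx Ny Hty.
  destruct (type_separation c u A B ka kb HL order_cycR Hco (S j)) with (x := x) (y := y)
    as (n1 & n2 & B1 & B2 & C1 & C2); auto.
  { intros c' Hc' Hag. apply HF; auto. intros g1 g2 g3 Hin.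
    destruct (Hj _ _ _ Hin) as (? & ? & ?). apply Hag; unfold ballA in *; lia. }
  assert (W : forall g1 g2 g3, c g1 g2 g3 = 1%Z -> cyc (phi g1 x0) (phi g2 x0) (phi g3 x0)).
  { intros g1 g2 g3 E.
    assert (D : ~ (g1 = g2 \/ g2 = g3 \/ g1 = g3)).
    { intros D. apply (proj1 (proj2 Hco)) in D. lia. }
    destruct (Hc g1 g2 g3) as [_ H2].
    destruct (cyc_total (phi g1 x0) (phi g2 x0) (phi g3 x0)) as [C|C]; auto;
      try (apply orbit_neq; tauto). apply H2 in C. lia. }
  exists n1, n2. auto.
Qed.
End Orbit.

(** * The orbit is discrete *)

Lemma cdist_lt_iff x y e :
  cdist x y < e <->
  (proj1_sig x - proj1_sig y < e /\ proj1_sig y - proj1_sig x < e) \/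
  1 - e < proj1_sig x - proj1_sig y \/ 1 - e < proj1_sig y - proj1_sig x.
Proof.
  unfold cdist, Rmin, Rabs. destruct Rcase_abs; destruct Rle_dec; lra.
Qed.

Lemma cdist_half z w y e : cdist z w < e / 2 -> cdist w y < e / 2 -> cdist z y < e.
Proof.
  rewrite !cdist_lt_iff.
  pose proof (proj2_sig z). pose proof (proj2_sig w). pose proof (proj2_sig y).
  simpl in *. lra.
Qed.

Lemma cdist_sym z w e : cdist z w < e -> cdist w z < e.
Proof. rewrite !cdist_lt_iff. lra. Qed.

Lemma cdist_pos z w : z <> w -> 0 < cdist z w.
Proof.
  intros H. apply S1_neq in H. unfold cdist.
  pose proof (proj2_sig z). pose proof (proj2_sig w). simpl in *.
  unfold Rmin, Rabs. destruct Rcase_abs; destruct Rle_dec; lra.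
Qed.

Lemma cdist_toS x y e : Rabs (x - y) < e -> cdist (toS x) (toS y) < e.
Proof.
  intros H. rewrite cdist_lt_iff. simpl. pose proof (frac_bound x). pose proof (frac_bound y).
  unfold frac in *. set (n := Int_part x) in *. set (m := Int_part y) in *.
  apply Rabs_def2 in H.
  assert (D : (n = m \/ n = m + 1 \/ n = m - 1 \/ n <= m - 2 \/ m + 2 <= n)%Z) by lia.
  destruct D as [ ->|[ ->|[ ->|[D|D]]]].
  - lra.
  - rewrite plus_IZR. lra.
  - rewrite minus_IZR. lra.
  - apply IZR_le in D. rewrite minus_IZR in D. left. lra.
  - apply IZR_le in D. rewrite plus_IZR in D. left. lra.
Qed.

(* A ball not containing [p] and [q] lies on one side of them. *)
Lemma cyc_near e u x p q :
  cdist u x < e -> ~ cdist u p < e -> ~ cdist u q < e -> cyc p q u -> cyc p q x.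
Proof.
  rewrite !cdist_lt_iff. unfold cyc.
  pose proof (proj2_sig u). pose proof (proj2_sig x). pose proof (proj2_sig p).
  pose proof (proj2_sig q). simpl in *. lra.
Qed.

(** * Nearest points of closed sets *)

Definition closedS (L : S1 -> Prop) : Prop :=
  forall z, ~ L z -> exists e, 0 < e /\ forall w, cdist z w < e -> ~ L w.

Lemma next_right (L : S1 -> Prop) z :
  closedS L -> (exists l, L l) -> ~ L z ->
  exists v, L v /\ forall w, cyc z w v -> ~ L w.
Proof.
  intros HL [l Hl] Hz. set (z0 := proj1_sig z).
  assert (Hrep : forall w, L w -> exists x, z0 < x <= z0 + 1 /\ toS x = w /\
             (x = proj1_sig w \/ x = proj1_sig w + 1)).
  { intros w Lw. assert (proj1_sig w <> z0) by (apply S1_neq; congruence).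
    pose proof (proj2_sig w). pose proof (proj2_sig z). simpl in *. fold z0 in H1.
    destruct (Rlt_dec z0 (proj1_sig w)).
    - exists (proj1_sig w). split; [lra|]. split; [apply toS_proj|auto].
    - exists (proj1_sig w + 1). split; [lra|]. split; [|auto].
      rewrite (toS_shift _ 1). apply toS_proj. }
  (* Completeness provides suprema, so the lifts of [L] beyond [z0] are reflected to obtain their
     infimum. *)
  destruct (completeness (fun y => z0 < - y /\ L (toS (- y)))) as [m [Hub Hlub]].
  { exists (- z0). intros y [Hy _]. lra. }
  { destruct (Hrep l Hl) as (x & Hx & E & _). exists (- x). rewrite Ropp_involutive, E.
    split; [lra|auto]. }
  set (v := - m).
  assert (Hv : forall x, z0 < x -> L (toS x) -> v <= x).
  { intros x Hx Lx. assert (- x <= m); [|unfold v; lra].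
    apply Hub. rewrite Ropp_involutive. auto. }
  assert (Lv : L (toS v)).
  { destruct (classic (L (toS v))) as [H|H]; [exact H|exfalso].
    destruct (HL _ H) as (e & He & Hf).
    assert (m <= m - e); [|lra]. apply Hlub. intros y [Hy Ly].
    destruct (Rle_dec y (m - e)) as [D|D]; [exact D|exfalso].
    pose proof (Hv _ Hy Ly). apply (Hf (toS (- y))); [|exact Ly].
    apply cdist_toS. unfold v. apply Rabs_def1; unfold v in *; lra. }
  assert (Hv0 : z0 <= v).
  { assert (m <= - z0); [|unfold v; lra]. apply Hlub. intros y [Hy _]. lra. }
  assert (v <> z0).
  { intros E. rewrite E in Lv. unfold z0 in Lv. rewrite toS_proj in Lv. contradiction. }
  assert (v <= z0 + 1).
  { destruct (Hrep l Hl) as (x & Hx & E & _). assert (v <= x); [|lra].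
    apply Hv; [lra|]. now rewrite E. }
  exists (toS v). split; [exact Lv|].
  intros w C Lw. destruct (Hrep w Lw) as (x & Hx & E & D).
  assert (v <= x) by (apply Hv; [lra|now rewrite E]).
  pose proof (proj2_sig w). pose proof (proj2_sig z). simpl in *. fold z0 in H3.
  unfold cyc in C. fold z0 in C. simpl in C.
  assert (F : (v < 1 /\ frac v = v) \/ (1 <= v /\ frac v = v - 1)).
  { destruct (Rlt_dec v 1); [left; split; auto; apply frac_id; lra|right; split; [lra|]].
    rewrite <- (frac_id (v - 1)) by lra. rewrite <- (frac_shift (v - 1) 1). f_equal. simpl. lra. }
  lra.
Qed.

Lemma next_left (L : S1 -> Prop) z :
  closedS L -> (exists l, L l) -> ~ L z ->
  exists v, L v /\ forall w, cyc v w z -> ~ L w.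
Proof.
  intros HL [l Hl] Hz. set (z0 := proj1_sig z).
  assert (Hrep : forall w, L w -> exists x, z0 - 1 <= x < z0 /\ toS x = w /\
             (x = proj1_sig w \/ x = proj1_sig w - 1)).
  { intros w Lw. assert (proj1_sig w <> z0) by (apply S1_neq; congruence).
    pose proof (proj2_sig w). pose proof (proj2_sig z). simpl in *. fold z0 in H1.
    destruct (Rlt_dec (proj1_sig w) z0).
    - exists (proj1_sig w). split; [lra|]. split; [apply toS_proj|auto].
    - exists (proj1_sig w - 1). split; [lra|]. split; [|auto].
      rewrite <- (toS_shift _ 1). simpl. rewrite <- (toS_proj w). f_equal.
      rewrite toS_proj. lra. }
  destruct (completeness (fun y => y < z0 /\ L (toS y))) as [v [Hub Hlub]].
  { exists z0. intros y [Hy _]. lra. }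
  { destruct (Hrep l Hl) as (x & Hx & E & _). exists x. rewrite E.
    split; [lra|auto]. }
  assert (Hv : forall x, x < z0 -> L (toS x) -> x <= v).
  { intros x Hx Lx. apply Hub. auto. }
  assert (Lv : L (toS v)).
  { destruct (classic (L (toS v))) as [H|H]; [exact H|exfalso].
    destruct (HL _ H) as (e & He & Hf).
    assert (v <= v - e); [|lra]. apply Hlub. intros y [Hy Ly].
    destruct (Rle_dec y (v - e)) as [D|D]; [exact D|exfalso].
    pose proof (Hv _ Hy Ly). apply (Hf (toS y)); [|exact Ly].
    apply cdist_toS. apply Rabs_def1; lra. }
  assert (Hv0 : v <= z0).
  { apply Hlub. intros y [Hy _]. lra. }
  assert (v <> z0).
  { intros E. rewrite E in Lv. unfold z0 in Lv. rewrite toS_proj in Lv. contradiction. }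
  assert (z0 - 1 <= v).
  { destruct (Hrep l Hl) as (x & Hx & E & _). assert (x <= v); [|lra].
    apply Hv; [lra|]. now rewrite E. }
  exists (toS v). split; [exact Lv|].
  intros w C Lw. destruct (Hrep w Lw) as (x & Hx & E & D).
  assert (x <= v) by (apply Hv; [lra|now rewrite E]).
  pose proof (proj2_sig w). pose proof (proj2_sig z). simpl in *. fold z0 in H3.
  unfold cyc in C. fold z0 in C. simpl in C.
  assert (F : (0 <= v /\ frac v = v) \/ (v < 0 /\ frac v = v + 1)).
  { destruct (Rle_dec 0 v); [left; split; auto; apply frac_id; lra|right; split; [lra|]].
    rewrite <- (frac_id (v + 1)) by lra. symmetry. apply (frac_shift v 1). }
  lra.
Qed.

Section Discrete.
Context (phi : G -> S1 -> S1) (x0 : S1) (Hact : is_action phi).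
Context (Hfree : forall g, phi g x0 = x0 -> g = Ge).
Context (j0 : nat) (Hj0 : (1 <= j0)%nat).
Context (Hsep : forall x y, ~ ballA j0 x -> ~ ballA j0 y -> ty x <> ty y ->
    exists n1 n2, ballA j0 n1 /\ ballA j0 n2 /\
      cyc (phi x x0) (phi n1 x0) (phi y x0) /\ cyc (phi y x0) (phi n2 x0) (phi x x0)).

Let o (g : G) : S1 := phi g x0.

Let o_inj g h : o g = o h -> g = h.
Proof. apply (orbit_inj phi x0 Hact Hfree). Qed.

Let o_mul g h : o (g ** h) = phi g (o h).
Proof. apply (act_mul phi Hact). Qed.

Let o_cyc g x y z : cyc (o x) (o y) (o z) -> cyc (o (g ** x)) (o (g ** y)) (o (g ** z)).
Proof. rewrite !o_mul. apply (act_cyc phi Hact). Qed.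

(* [germ k s]: the orbit points just to the right of [o k] lie outside the ball
   and are indexed by words of type [s]. *)
Let germ (k : G) (s : letter) : Prop :=
  exists m, m <> k /\ forall x, cyc (o k) (o x) (o m) -> ~ ballA j0 x /\ ty x = s.

Section Accumulation.
Context (Hacc : forall g, g <> Ge -> exists h, cyc (o Ge) (o h) (o g)).

Let acc k g : g <> k -> exists h, cyc (o k) (o h) (o g).
Proof.
  intros H. destruct (Hacc (Ginv k ** g)) as [h Hh].
  - intros E. apply H. apply (Gmul_inj (Ginv k)). now rewrite Ginv_l.
  - exists (k ** h). apply (o_cyc k) in Hh. now rewrite Gmul_e_r, Gmul_inv_cancel in Hh.
Qed.

Let closer k m m' : m <> k -> m' <> k ->
  exists m'', m'' <> k /\ forall x, cyc (o k) (o x) (o m'') ->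
     cyc (o k) (o x) (o m) /\ cyc (o k) (o x) (o m').
Proof.
  intros H H'. destruct (classic (cyc (o k) (o m) (o m'))) as [C|C].
  - exists m. split; auto. intros x Cx. split; auto. clear - C Cx. circ.
  - exists m'. split; auto. intros x Cx. split; auto.
    assert (o k <> o m) by (intros E; apply o_inj in E; congruence).
    clear - C Cx H0. circ.
Qed.

(** Choose [m] so near that no ball element lies between [k] and [m]. Orbit points of different
    types in this arc would be separated by ball elements on both sides, and one of these sides lies
    within the arc. *)
Let germ_exists k : exists s, germ k s.
Proof.
  destruct (G_finite_ball j0) as [L HL].
  assert (Hm : forall L : list G, exists m, m <> k /\ forall n, In n L -> ~ cyc (o k) (o n) (o m)).
  { clear L HL. induction L as [|n L [m [Hm IH]]].
    - destruct (classic (k = Ge)) as [->|E]; [exists alpha|exists Ge]; split; auto; discriminate.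
    - destruct (classic (cyc (o k) (o n) (o m))) as [C|C].
      + exists n. split.
        * intros ->. clear - C. circ.
        * intros p [<-|Hp] D; [clear - D; circ|].
          apply (IH p Hp). clear - C D. circ.
      + exists m. split; auto. intros p [<-|Hp]; auto. }
  destruct (Hm L) as (m & Hmk & HmL).
  assert (Hout : forall x, cyc (o k) (o x) (o m) -> ~ ballA j0 x).
  { intros x C Bx. apply (HmL x); auto. }
  destruct (acc k m Hmk) as [y Cy]. exists (ty y), m. split; auto.
  intros x Cx. split; [auto|].
  destruct (letter_dec (ty x) (ty y)) as [E|E]; [exact E|exfalso].
  destruct (Hsep x y (Hout x Cx) (Hout y Cy) E) as (n1 & n2 & B1 & B2 & C1 & C2).
  fold (o x) (o y) (o n1) (o n2) in *.
  pose proof (HmL n1 (HL _ B1)) as F1. pose proof (HmL n2 (HL _ B2)) as F2.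
  clear - Cx Cy C1 C2 F1 F2. circ.
Qed.

Let germ_unique k s s' : germ k s -> germ k s' -> s = s'.
Proof.
  intros (m & Hm & H) (m' & Hm' & H'). destruct (closer k m m' Hm Hm') as (m'' & Hk & C).
  destruct (acc k m'' Hk) as [x Cx]. apply C in Cx. destruct Cx as [C1 C2].
  apply H in C1. apply H' in C2. destruct C1 as [_ <-], C2 as [_ <-]. reflexivity.
Qed.

(** If the types differed, a ball element would separate [k] from the points just to its right,
    inside an arc free of ball elements. *)
Let germ_outside k : ~ ballA j0 k -> germ k (ty k).
Proof.
  intros Hk. destruct (germ_exists k) as [s (m & Hm & H)]. exists m. split; auto.
  intros x Cx. destruct (H x Cx) as [Hx _]. split; auto.
  destruct (letter_dec (ty x) (ty k)) as [E|E]; [exact E|exfalso].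
  destruct (Hsep x k Hx Hk E) as (n1 & n2 & B1 & B2 & C1 & C2).
  destruct (H n2) as [D _]; [|contradiction]. fold (o x) (o k) (o n2) in *.
  clear - Cx C2. circ.
Qed.

Let germ_beta k s : germ k s -> germ (beta ** k) (rot s).
Proof.
  intros (m & Hm & H). exists (beta ** m). split.
  - intros E. apply Gmul_inj in E. contradiction.
  - intros x Cx. rewrite <- (beta_beta_beta x) in Cx |- *. set (y := beta ** (beta ** x)) in *.
    destruct (H y) as [H1 H2].
    { apply (o_cyc (Ginv beta)) in Cx. now rewrite !Ginv_mul_cancel in Cx. }
    unfold ballA in *. now rewrite cnt_beta, ty_beta, H2.
Qed.

Let germ_alpha k s : germ k LA -> germ (alpha ** k) s -> s <> LA.
Proof.
  intros (m & Hm & H) (m' & Hm' & H').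
  destruct (closer (alpha ** k) (alpha ** m) m') as (m'' & Hk & C); auto.
  { intros E. apply Gmul_inj in E. contradiction. }
  destruct (acc _ m'' Hk) as [x Cx]. apply C in Cx. destruct Cx as [C1 C2].
  apply H' in C2. destruct C2 as [_ <-].
  apply (o_cyc alpha) in C1. rewrite !alpha_alpha in C1. apply H in C1.
  destruct C1 as [Hb Ht]. unfold ballA in Hb.
  rewrite <- (alpha_alpha x). apply alpha_A_ty; auto; intros E; rewrite E in Hb.
  - rewrite cnt_Ge in Hb; lia.
  - rewrite cnt_alpha in Hb; lia.
Qed.

(** A mismatch between the type of [k] and its germ reproduces itself: rotate until the germ is
    [LA], then apply [alpha], after which [k] has type [LA] and the germ does not. The count grows
    by one each time, whereas [germ_outside] allows mismatches only inside the ball. *)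
Lemma accumulation_absurd : False.
Proof.
  assert (Hstep : forall k s, germ k s -> s <> ty k ->
            exists k' s', cnt k' = S (cnt k) /\ germ k' s' /\ s' <> ty k').
  { assert (HA : forall k, germ k LA -> LA <> ty k ->
            exists k' s', cnt k' = S (cnt k) /\ germ k' s' /\ s' <> ty k').
    { intros k H Hs. destruct (germ_exists (alpha ** k)) as [s' H'].
      destruct (alpha_nonA k) as [T C]; [congruence|].
      exists (alpha ** k), s'. split; [auto|split; [auto|]]. rewrite T.
      apply (germ_alpha k s' H H'). }
    intros k s H Hs. destruct (rotate_to_A s) as [->|[E|E]]; [auto| |].
    - pose proof (germ_beta _ _ H) as H1. rewrite E in H1.
      rewrite <- (cnt_beta k). apply HA; auto. rewrite ty_beta, <- E.
      intros D. apply rot_inj in D. contradiction.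
    - pose proof (germ_beta _ _ (germ_beta _ _ H)) as H1. rewrite E in H1.
      rewrite <- (cnt_beta k), <- (cnt_beta (beta ** k)). apply HA; auto.
      rewrite !ty_beta, <- E. intros D. apply rot_inj, rot_inj in D. contradiction. }
  (* [Ge] and [alpha] both have type [LA], but their germs cannot both be [LA]. *)
  assert (Hbase : exists k s, germ k s /\ s <> ty k).
  { destruct (germ_exists Ge) as [s Hs]. destruct (letter_dec s LA) as [->|E].
    - destruct (germ_exists (alpha ** Ge)) as [s' H']. exists (alpha ** Ge), s'.
      split; auto. exact (germ_alpha Ge s' Hs H').
    - exists Ge, s. auto. }
  assert (Hall : forall n, exists k s, (n <= cnt k)%nat /\ germ k s /\ s <> ty k).
  { induction n as [|n (k & s & Hn & Hg & Hs)].
    - destruct Hbase as (k & s & H). exists k, s. split; [lia|auto].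
    - destruct (Hstep k s Hg Hs) as (k' & s' & C & H). exists k', s'. split; [lia|auto]. }
  destruct (Hall (S j0)) as (k & s & Hk & Hg & Hs). apply Hs.
  apply (germ_unique k); auto. apply germ_outside. unfold ballA. lia.
Qed.
End Accumulation.

(** The order is left invariant, so the successor of [Ge] is carried to a successor of every
    element: right multiplication by [t] is the successor map. *)
Lemma orbit_successor : exists t, t <> Ge /\ forall g h, ~ cyc (o g) (o h) (o (g ** t)).
Proof.
  apply NNPP. intros H. apply accumulation_absurd. intros t Ht. apply NNPP. intros Hn.
  apply H. exists t. split; auto. intros g h C. apply Hn. exists (Ginv g ** h).
  apply (o_cyc (Ginv g)) in C. now rewrite Ginv_l, Ginv_mul_cancel in C.
Qed.

Lemma orbit_isolated k : exists e, 0 < e /\ forall g, cdist (o k) (o g) < e -> g = k.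
Proof.
  destruct orbit_successor as (t & Ht & Hs).
  assert (Hpn : forall g h, g <> h -> o g <> o h) by (intros g h H E; apply o_inj in E; auto).
  assert (Hk1 : k ** t <> k).
  { intros E. apply Ht. apply (Gmul_inj k). now rewrite Gmul_e_r. }
  set (p := k ** Ginv t).
  assert (Hp : p ** t = k) by (unfold p; now rewrite Gmul_assoc, Ginv_l, Gmul_e_r).
  assert (Hk2 : p <> k).
  { intros E. rewrite E in Hp. contradiction. }
  exists (Rmin (cdist (o k) (o p)) (cdist (o k) (o (k ** t)))). split.
  { apply Rmin_glb_lt; apply cdist_pos; auto. }
  intros g Hg. apply NNPP. intros Hgk.
  assert (Dp : ~ cdist (o k) (o p) < Rmin (cdist (o k) (o p)) (cdist (o k) (o (k ** t)))).
  { pose proof (Rmin_l (cdist (o k) (o p)) (cdist (o k) (o (k ** t)))). lra. }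
  assert (Dt : ~ cdist (o k) (o (k ** t)) < Rmin (cdist (o k) (o p)) (cdist (o k) (o (k ** t)))).
  { pose proof (Rmin_r (cdist (o k) (o p)) (cdist (o k) (o (k ** t)))). lra. }
  pose proof (Hs p g) as S1'. rewrite Hp in S1'. pose proof (Hs k g) as S2'.
  pose proof (Hs p (k ** t)) as S3'. rewrite Hp in S3'.
  pose proof (Hpn _ _ Hgk). pose proof (Hpn _ _ Hk1). pose proof (Hpn _ _ Hk2).
  assert (Hgp : g <> p) by (intros ->; exact (Dp Hg)).
  assert (Hgt : g <> k ** t) by (intros ->; exact (Dt Hg)).
  apply Hpn in Hgp, Hgt.
  destruct (classic (p = k ** t)) as [E|E].
  - rewrite <- E in *. clear - S1' S2' H H0 Hgp. circ.
  - apply Hpn in E. pose proof (cyc_near _ _ _ (o (k ** t)) (o p) Hg Dt Dp) as C.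
    clear - C S1' S2' S3' H H0 H1 Hgp Hgt E. circ.
Qed.
End Discrete.

(** * Gaps of the limit set *)

Lemma filter_length_lt {T} (f g : T -> bool) l a :
  (forall x, f x = true -> g x = true) -> In a l -> g a = true -> f a = false ->
  (length (filter f l) < length (filter g l))%nat.
Proof.
  intros H. assert (Hle : forall l, (length (filter f l) <= length (filter g l))%nat).
  { clear l. induction l as [|x l IH]; simpl; [lia|].
    specialize (H x). destruct (f x); [rewrite H by auto; simpl; lia|].
    destruct (g x); simpl; lia. }
  induction l as [|x l IH]; simpl; intros Hin Ga Fa; [contradiction|].
  destruct Hin as [->|Hin].
  - rewrite Ga, Fa. simpl. specialize (Hle l). lia.
  - specialize (IH Hin Ga Fa). specialize (H x).
    destruct (f x); [rewrite H by auto; simpl; lia|]. destruct (g x); simpl; lia.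
Qed.

Section Gaps.
Context (phi : G -> S1 -> S1) (x0 : S1) (Hact : is_action phi).
Context (Htight : tight_at phi x0).
Context (j0 : nat) (Hj0 : (1 <= j0)%nat).
Context (Hsep : forall x y, ~ ballA j0 x -> ~ ballA j0 y -> ty x <> ty y ->
    exists n1 n2, ballA j0 n1 /\ ballA j0 n2 /\
      cyc (phi x x0) (phi n1 x0) (phi y x0) /\ cyc (phi y x0) (phi n2 x0) (phi x x0)).

Let Hfree : forall g, phi g x0 = x0 -> g = Ge := proj1 Htight.
Let o (g : G) : S1 := phi g x0.

Let o_inj g h : o g = o h -> g = h.
Proof. apply (orbit_inj phi x0 Hact Hfree). Qed.

Let o_mul g h : o (g ** h) = phi g (o h).
Proof. apply (act_mul phi Hact). Qed.

Let o_isolated k : exists e, 0 < e /\ forall g, cdist (o k) (o g) < e -> g = k.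
Proof. exact (orbit_isolated phi x0 Hact Hfree j0 Hj0 Hsep k). Qed.

Lemma act_continuous g z e :
  0 < e -> exists d, 0 < d /\ forall w, cdist z w < d -> cdist (phi g z) (phi g w) < e.
Proof. destruct Hact as [H _]. destruct (H g) as [(h & _ & _ & Hc & _) _]. apply Hc. Qed.

(** As orbit points are isolated, these are exactly the accumulation points of the orbit. *)
Definition limit_pt (z : S1) : Prop :=
  closure (orbit phi x0) z /\ ~ orbit phi x0 z.

Lemma limit_pt_near z e : limit_pt z -> 0 < e -> exists g, cdist z (o g) < e.
Proof. intros [H _] He. destruct (H e He) as (w & [g <-] & Hw). exists g. exact Hw. Qed.

Lemma limit_pt_orbit g : ~ limit_pt (o g).
Proof. intros [_ H]. apply H. now exists g. Qed.

Lemma limit_pt_act g z : limit_pt z -> limit_pt (phi g z).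
Proof.
  intros H. split.
  - intros e He. destruct (act_continuous g z e He) as (d & Hd & Hc).
    destruct (limit_pt_near z d H Hd) as [h Hh]. exists (o (g ** h)). split; [now exists (g ** h)|].
    rewrite o_mul. auto.
  - intros [h Hh]. apply H. exists (Ginv g ** h).
    rewrite (act_mul phi Hact), Hh. apply (act_inv_l phi Hact).
Qed.

Lemma limit_pt_closed : closedS limit_pt.
Proof.
  intros z Hz. destruct (classic (orbit phi x0 z)) as [[k <-]|Ho].
  - destruct (o_isolated k) as (e & He & Hi). exists (e / 2). split; [lra|].
    intros w Hw Lw. assert (w <> o k) by (intros ->; exact (limit_pt_orbit k Lw)).
    destruct (limit_pt_near w (Rmin (e / 2) (cdist w (o k))) Lw) as [g Hg].
    { apply Rmin_glb_lt; [lra|now apply cdist_pos]. }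
    pose proof (Rmin_l (e / 2) (cdist w (o k))). pose proof (Rmin_r (e / 2) (cdist w (o k))).
    assert (g = k).
    { apply Hi. apply (cdist_half _ w); [exact Hw|lra]. }
    subst g. lra.
  - assert (Hc : ~ closure (orbit phi x0) z) by (intros D; apply Hz; split; auto).
    apply not_all_ex_not in Hc. destruct Hc as [e Hc].
    assert (He : 0 < e) by tauto. exists (e / 2). split; [lra|].
    intros w Hw Lw. destruct (limit_pt_near w (e / 2) Lw) as [g Hg]; [lra|].
    apply Hc. intros _. exists (o g). split; [now exists g|]. now apply (cdist_half _ w).
Qed.

(** The powers of [alpha ** beta], an infinite sequence whose terms are told apart by their
    counts. *)
Fixpoint alternating (n : nat) : G :=
  match n with O => Ge | S n => alpha ** (beta ** alternating n) end.

Lemma alternating_spec n : ty (alternating n) = LA /\ cnt (alternating n) = n.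
Proof.
  induction n as [|n [T C]]; [auto|]. simpl.
  destruct (alpha_nonA (beta ** alternating n)) as [T' C'].
  - rewrite ty_beta, T. discriminate.
  - now rewrite T', C', cnt_beta, C.
Qed.

Lemma limit_pt_exists : exists z, limit_pt z.
Proof.
  set (un := fun n => proj1_sig (o (alternating n))).
  destruct (Bolzano_Weierstrass un (fun x => 0 <= x <= 1) (compact_P3 0 1)) as [l Hl].
  { intros n. unfold un. pose proof (proj2_sig (o (alternating n))). simpl in *. lra. }
  assert (Hn : forall e, 0 < e -> forall N, exists p, (N <= p)%nat /\
             cdist (toS l) (o (alternating p)) < e).
  { intros e He N. destruct (Hl (disc l (mkposreal e He)) N) as (p & Hp & D).
    - exists (mkposreal e He). intros y Hy. exact Hy.
    - exists p. split; auto. rewrite <- (toS_proj (o (alternating p))). apply cdist_toS.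
      rewrite Rabs_minus_sym. exact D. }
  (* The cluster value may be 1, hence the passage to the circle. *)
  exists (toS l). split.
  - intros e He. destruct (Hn e He O) as (p & _ & Hp). eexists; split; [|exact Hp].
    now exists (alternating p).
  - intros [k Hk]. destruct (o_isolated k) as (e & He & Hi).
    assert (Hc : forall p, cdist (toS l) (o (alternating p)) < e -> p = cnt k).
    { intros p Hp. rewrite <- Hk in Hp. apply Hi in Hp. rewrite <- Hp.
      symmetry. apply alternating_spec. }
    destruct (Hn e He (S (cnt k))) as (p & Hp & D). apply Hc in D. lia.
Qed.

Definition gap (u v : S1) : Prop :=
  limit_pt u /\ limit_pt v /\ u <> v /\ forall z, cyc u z v -> ~ limit_pt z.

(** Fixing [z] while exchanging [o Ge] and [o alpha] would reverse an orientation. Consequently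
    there are at least two limit points, which makes the ends of a gap distinct. *)
Lemma alpha_no_fixpoint z : limit_pt z -> phi alpha z <> z.
Proof.
  intros Lz E. pose proof (limit_pt_orbit Ge) as N.
  assert (D1 : z <> o Ge) by congruence.
  assert (D2 : o Ge <> o alpha) by (intros D; apply o_inj in D; discriminate).
  assert (D3 : z <> o alpha) by (intros ->; exact (limit_pt_orbit alpha Lz)).
  assert (E1 : phi alpha (o Ge) = o alpha) by (rewrite <- o_mul, Gmul_e_r; reflexivity).
  assert (E2 : phi alpha (o alpha) = o Ge).
  { rewrite <- o_mul. f_equal. now apply G_eq. }
  destruct (cyc_total _ _ _ D1 D2 D3) as [C|C];
    pose proof (act_cyc phi Hact alpha _ _ _ C) as C'; rewrite E, E1, E2 in C';
    clear - C C'; circ.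
Qed.

Lemma gap_at z : ~ limit_pt z -> exists u v, gap u v /\ cyc u z v.
Proof.
  intros Hz. destruct limit_pt_exists as [l Hl].
  destruct (next_right limit_pt z limit_pt_closed) as (v & Lv & Hv); eauto.
  destruct (next_left limit_pt z limit_pt_closed) as (u & Lu & Hu); eauto.
  assert (D1 : u <> z) by congruence. assert (D2 : v <> z) by congruence.
  assert (Huv : u <> v).
  { intros ->. pose proof (limit_pt_act alpha v Lv) as L.
    pose proof (alpha_no_fixpoint v Lv) as E.
    assert (phi alpha v <> z) by congruence.
    apply (Hu (phi alpha v)); auto. pose proof (Hv (phi alpha v)) as F.
    assert (F' : ~ cyc z (phi alpha v) v) by tauto.
    clear - F' D1 E H. circ. }
  assert (C : cyc u z v).
  { pose proof (Hu v) as F. assert (F' : ~ cyc u v z) by tauto. clear - F' D1 D2 Huv. circ. }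
  exists u, v. split; auto. split; [|split; [|split]]; auto. intros w Cw.
  destruct (classic (w = z)) as [->|E]; auto.
  destruct (classic (cyc u w z)) as [C'|C']; auto.
  apply Hv. clear - C Cw C' E. circ.
Qed.

(** Without an orbit point this would be a gap of the orbit closure, and tightness would put its
    ends into the orbit, although they are limit points. *)
Lemma gap_orbit u v : gap u v -> exists g, cyc u (o g) v.
Proof.
  intros (Lu & Lv & Huv & H). apply NNPP. intros Hn.
  destruct (proj2 Htight u v Huv) as [Ou _].
  - apply Lu.
  - apply Lv.
  - intros z Cz Hcl. apply (H z Cz). split; auto. intros [g Hg]. apply Hn. exists g.
    unfold o. now rewrite Hg.
  - apply Lu, Ou.
Qed.

Lemma gap_act g u v : gap u v -> gap (phi g u) (phi g v).
Proof.
  intros (Lu & Lv & Huv & H). split; [|split; [|split]]; try now apply limit_pt_act.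
  - intros E. apply (act_inj phi Hact) in E. contradiction.
  - intros z Cz Lz. apply (H (phi (Ginv g) z)).
    + apply (act_cyc_inv phi Hact g). now rewrite (act_inv_r phi Hact).
    + now apply limit_pt_act.
Qed.

Lemma gap_unique u v u' v' z :
  gap u v -> gap u' v' -> cyc u z v -> cyc u' z v' -> u = u' /\ v = v'.
Proof.
  intros (Lu & Lv & Huv & H) (Lu' & Lv' & Huv' & H') C C'.
  assert (F1 : ~ cyc u u' v) by (intros D; exact (H _ D Lu')).
  assert (F2 : ~ cyc u v' v) by (intros D; exact (H _ D Lv')).
  assert (F3 : ~ cyc u' u v') by (intros D; exact (H' _ D Lu)).
  assert (F4 : ~ cyc u' v v') by (intros D; exact (H' _ D Lv)).
  split; clear - C C' F1 F2 F3 F4; circ.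
Qed.

(** Gaps are determined by the orbit points they contain, and on these [G] is transitive. *)
Lemma gap_transitive u v u' v' :
  gap u v -> gap u' v' -> exists g, phi g u = u' /\ phi g v = v'.
Proof.
  intros H H'. destruct (gap_orbit u v H) as [k Ck]. destruct (gap_orbit u' v' H') as [h Ch].
  exists (h ** Ginv k). apply (gap_unique _ _ _ _ (o h)); auto using gap_act.
  replace h with (h ** Ginv k ** k) at 2 by (rewrite Gmul_assoc, Ginv_l; apply Gmul_e_r).
  rewrite o_mul. now apply (act_cyc phi Hact).
Qed.

(** * Types of limit points *)

Definition col (z : S1) (s : letter) : Prop :=
  exists e, 0 < e /\ forall g, cdist z (o g) < e -> ~ ballA j0 g /\ ty g = s.

Lemma orbit_far z L :
  (forall g, z <> o g) -> exists e, 0 < e /\ forall n, In n L -> ~ cdist z (o n) < e.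
Proof.
  intros Hz. induction L as [|n L (e & He & IH)].
  - exists 1. split; [lra|]. intros n [].
  - exists (Rmin e (cdist z (o n))). split.
    + apply Rmin_glb_lt; auto. apply cdist_pos, Hz.
    + pose proof (Rmin_l e (cdist z (o n))). pose proof (Rmin_r e (cdist z (o n))).
      intros m [<-|Hm]; [lra|]. specialize (IH m Hm). lra.
Qed.

Lemma limit_pt_neq z g : limit_pt z -> z <> o g.
Proof. intros L ->. exact (limit_pt_orbit g L). Qed.

(** Near [z] there are no ball elements. Two nearby orbit points of different types would be
    separated by ball elements on both arcs between them, but one of these arcs stays near [z]. *)
Lemma col_exists z : limit_pt z -> exists s, col z s.
Proof.
  intros Lz. destruct (G_finite_ball j0) as [L HL].
  destruct (orbit_far z L) as (e & He & Hf); [intros; now apply limit_pt_neq|].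
  destruct (limit_pt_near z e Lz He) as [y Hy]. exists (ty y), e. split; auto.
  assert (Hout : forall g, cdist z (o g) < e -> ~ ballA j0 g).
  { intros g Hg Bg. apply (Hf g); auto. }
  intros x Hx. split; auto.
  destruct (letter_dec (ty x) (ty y)) as [E|E]; [exact E|exfalso].
  destruct (Hsep x y (Hout x Hx) (Hout y Hy) E) as (n1 & n2 & B1 & B2 & C1 & C2).
  fold (o x) (o y) (o n1) (o n2) in *.
  pose proof (Hf n1 (HL _ B1)) as F1. pose proof (Hf n2 (HL _ B2)) as F2.
  pose proof (cyc_near e z (o x) (o n1) (o n2) Hx F1 F2) as X12.
  pose proof (cyc_near e z (o y) (o n1) (o n2) Hy F1 F2) as Y12.
  pose proof (cyc_near e z (o x) (o n2) (o n1) Hx F2 F1) as X21.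
  pose proof (cyc_near e z (o y) (o n2) (o n1) Hy F2 F1) as Y21.
  pose proof (limit_pt_neq z n1 Lz) as D1. pose proof (limit_pt_neq z n2 Lz) as D2.
  clear - C1 C2 X12 X21 Y12 Y21 D1 D2. circ.
Qed.

Lemma col_unique z s s' : limit_pt z -> col z s -> col z s' -> s = s'.
Proof.
  intros Lz (e & He & H) (e' & He' & H').
  destruct (limit_pt_near z (Rmin e e') Lz) as [g Hg]; [now apply Rmin_glb_lt|].
  pose proof (Rmin_l e e'). pose proof (Rmin_r e e').
  destruct (H g) as [_ <-]; [lra|]. destruct (H' g) as [_ <-]; [lra|]. reflexivity.
Qed.

Lemma col_pullback g z e : 0 < e ->
  exists d, 0 < d /\ forall h, cdist (phi g z) (o h) < d -> cdist z (o (Ginv g ** h)) < e.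
Proof.
  intros He. destruct (act_continuous (Ginv g) (phi g z) e He) as (d & Hd & H).
  exists d. split; auto. intros h Hh. apply H in Hh.
  now rewrite (act_inv_l phi Hact), <- o_mul in Hh.
Qed.

Lemma col_beta z s : col z s -> col (phi beta z) (rot s).
Proof.
  intros (e & He & H). destruct (col_pullback beta z e He) as (d & Hd & Hp).
  exists d. split; auto. intros g Hg. apply Hp, H in Hg. destruct Hg as [Hb Ht].
  rewrite <- (Gmul_inv_cancel beta g), ty_beta, Ht. split; auto. now rewrite <- ballA_beta.
Qed.

Lemma col_alpha_nonA z s : col z s -> s <> LA -> col (phi alpha z) LA.
Proof.
  intros (e & He & H) Hs. destruct (col_pullback alpha z e He) as (d & Hd & Hp).
  exists d. split; auto. intros g Hg. apply Hp, H in Hg. destruct Hg as [Hb Ht].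
  rewrite <- (Gmul_inv_cancel alpha g). destruct (alpha_nonA (Ginv alpha ** g)) as [T C].
  - congruence.
  - split; auto. unfold ballA in *. lia.
Qed.

Lemma col_alpha_A z : limit_pt z -> col z LA -> exists s, s <> LA /\ col (phi alpha z) s.
Proof.
  intros Lz (e & He & H). destruct (col_exists _ (limit_pt_act alpha z Lz)) as [s Hs].
  exists s. split; auto. intros ->. destruct Hs as (e' & He' & H').
  destruct (col_pullback alpha z e He) as (d & Hd & Hp).
  destruct (limit_pt_near _ (Rmin e' d) (limit_pt_act alpha z Lz)) as [g Hg].
  { now apply Rmin_glb_lt. }
  pose proof (Rmin_l e' d). pose proof (Rmin_r e' d).
  destruct (H' g) as [_ T']; [lra|].
  destruct (H (Ginv alpha ** g)) as [B T]; [apply Hp; lra|].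
  rewrite <- (Gmul_inv_cancel alpha g) in T'. revert T'.
  apply alpha_A_ty; auto; intros E; rewrite E in B; apply B; unfold ballA.
  - rewrite cnt_Ge; lia.
  - rewrite cnt_alpha; lia.
Qed.

(** Different types at [u] and [v] would pass to nearby orbit points; the ball element separating
    these in the direction from [u] to [v] would lie in the arc. *)
Lemma col_no_ball u v s : limit_pt u -> limit_pt v -> u <> v ->
  (forall n, ballA j0 n -> ~ cyc u (o n) v) -> col u s -> col v s.
Proof.
  intros Lu Lv Huv Hn Cu. destruct (col_exists v Lv) as [s' Cv].
  destruct (letter_dec s s') as [->|Hs]; [exact Cv|exfalso].
  destruct Cu as (e1 & He1 & H1), Cv as (e2 & He2 & H2).
  pose proof (cdist_pos u v Huv) as Hd.
  (* Half the distance keeps the orbit point chosen near [u] away from [v]. *)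
  set (e := Rmin (Rmin e1 e2) (cdist u v / 2)).
  assert (He : 0 < e) by (repeat apply Rmin_glb_lt; lra).
  assert (B1 : e <= e1 /\ e <= e2 /\ e <= cdist u v / 2).
  { unfold e. pose proof (Rmin_l e1 e2). pose proof (Rmin_r e1 e2).
    pose proof (Rmin_l (Rmin e1 e2) (cdist u v / 2)).
    pose proof (Rmin_r (Rmin e1 e2) (cdist u v / 2)). lra. }
  destruct (limit_pt_near u e Lu He) as [x1 X1]. destruct (limit_pt_near v e Lv He) as [x2 X2].
  destruct (H1 x1) as [N1 T1]; [lra|]. destruct (H2 x2) as [N2 T2]; [lra|].
  destruct (Hsep x1 x2 N1 N2) as (n & _ & Bn & _ & C & _); [congruence|].
  fold (o x1) (o x2) (o n) in C.
  assert (Fu : ~ cdist u (o n) < e).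
  { intros D. destruct (H1 n) as [F _]; [lra|contradiction]. }
  assert (Fv : ~ cdist v (o n) < e).
  { intros D. destruct (H2 n) as [F _]; [lra|contradiction]. }
  assert (Fuv : ~ cdist u v < e) by lra.
  assert (Fvx : ~ cdist v (o x1) < e).
  { intros D. assert (cdist u v < cdist u v); [|lra].
    apply (cdist_half _ (o x1)); [lra|]. apply cdist_sym. lra. }
  pose proof (Hn n Bn) as Hn'.
  pose proof (limit_pt_neq u n Lu) as D1. pose proof (limit_pt_neq v n Lv) as D2.
  assert (C1 : cyc v (o n) u) by (clear - Hn' D1 D2 Huv; circ).
  pose proof (cyc_near e u (o x1) v (o n) X1 Fuv Fu C1) as C2.
  apply cyc_rot in C2.
  pose proof (cyc_near e v (o x2) (o n) (o x1) X2 Fv Fvx C2) as C3.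
  clear - C C3. circ.
Qed.

Definition boundary_gap (u v : S1) : Prop :=
  gap u v /\ exists s s', col u s /\ col v s' /\ s <> s'.

Lemma boundary_gap_ball u v : boundary_gap u v -> exists n, ballA j0 n /\ cyc u (o n) v.
Proof.
  intros ((Lu & Lv & Huv & _) & s & s' & Cu & Cv & Hs). apply NNPP. intros Hn.
  apply Hs. apply (col_unique v); auto. apply (col_no_ball u); auto.
  intros n Bn Cn. apply Hn. eauto.
Qed.

Lemma not_boundary_gap u v s : gap u v -> ~ boundary_gap u v -> col u s -> col v s.
Proof.
  intros H Hn Cu. destruct (col_exists v) as [s' Cv]; [apply H|].
  destruct (letter_dec s s') as [->|Hs]; [exact Cv|].
  exfalso. apply Hn. split; auto. exists s, s'. auto.
Qed.

(** Induction on the number of ball elements in the arc. Such an element sits in a gap that is not a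
    boundary gap; this gap carries the type across, and the arcs left on either side contain fewer
    ball elements. *)
Lemma col_connected u v s : limit_pt u -> limit_pt v -> u <> v ->
  (forall p q w, boundary_gap p q -> cyc p w q -> ~ cyc u w v) -> col u s -> col v s.
Proof.
  destruct (G_finite_ball j0) as [L HL].
  pose (inarc := fun u v n => if excluded_middle_informative (cyc u (o n) v) then true else false).
  remember (length (filter (inarc u v) L)) as k eqn:Ek.
  revert u v s Ek. induction k as [k IH] using lt_wf_ind.
  intros u v s Ek Lu Lv Huv Hb Cu.
  destruct (classic (exists n, In n L /\ cyc u (o n) v)) as [(n & Hin & Cn)|Hno].
  2: { apply (col_no_ball u); auto. intros n Bn Cn. apply Hno. exists n. auto. }
  destruct (gap_at (o n) (limit_pt_orbit n)) as (p & q & Hg & Cpq).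
  destruct Hg as (Lp & Lq & Hpq & Hg).
  assert (F1 : ~ cyc p u q) by (intros D; exact (Hg _ D Lu)).
  assert (F2 : ~ cyc p v q) by (intros D; exact (Hg _ D Lv)).
  assert (Hnb : ~ boundary_gap p q) by (intros D; exact (Hb p q (o n) D Cpq Cn)).
  assert (Hnu : ~ cyc u (o n) p).
  { clear - Cn Cpq F1 F2. circ. }
  assert (Hnv : ~ cyc q (o n) v).
  { clear - Cn Cpq F1 F2. circ. }
  assert (Hsub1 : forall w, u <> p -> cyc u w p -> cyc u w v).
  { intros w E. clear - Cn Cpq F1 F2 E. circ. }
  assert (Hsub2 : forall w, q <> v -> cyc q w v -> cyc u w v).
  { intros w E. clear - Cn Cpq F1 F2 E. circ. }
  assert (Hlt : forall a b, (forall w, cyc a w b -> cyc u w v) -> ~ cyc a (o n) b ->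
            (length (filter (inarc a b) L) < k)%nat).
  { intros a b Hsub Hnot. subst k. apply (filter_length_lt _ _ L n); auto; unfold inarc.
    - intros x. destruct excluded_middle_informative; [|discriminate].
      destruct excluded_middle_informative; auto.
    - destruct excluded_middle_informative; tauto.
    - destruct excluded_middle_informative; tauto. }
  assert (Cp : col p s).
  { destruct (classic (u = p)) as [<-|E]; [exact Cu|].
    apply (IH (length (filter (inarc u p) L))) with (u := u); auto.
    intros p' q' w Hb' Cw Cw'. apply (Hb p' q' w Hb' Cw). auto. }
  assert (Cq : col q s) by (apply (not_boundary_gap p q s); auto; split; auto).
  destruct (classic (q = v)) as [<-|E]; [exact Cq|].
  apply (IH (length (filter (inarc q v) L))) with (u := q); auto.
  intros p' q' w Hb' Cw Cw'. apply (Hb p' q' w Hb' Cw). auto.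
Qed.

(** * Pieces and their components *)

Definition piece (s : letter) (z : S1) : Prop :=
  (limit_pt z /\ col z s) \/
  exists u v, gap u v /\ col u s /\ col v s /\ cyc u z v.

Lemma boundary_gap_piece u v s z : boundary_gap u v -> cyc u z v -> ~ piece s z.
Proof.
  intros (Hg & s1 & s2 & C1 & C2 & Hs) C [(L & _)|(u' & v' & Hg' & Cu & Cv & C')].
  - destruct Hg as (_ & _ & _ & H). now apply (H z).
  - destruct (gap_unique _ _ _ _ _ Hg Hg' C C') as [<- <-]. apply Hs.
    rewrite (col_unique u s1 s), (col_unique v s2 s); auto; apply Hg.
Qed.

Lemma piece_beta s z : piece s z -> piece (rot s) (phi beta z).
Proof.
  intros [(L & C)|(u & v & Hg & Cu & Cv & C)].
  - left. auto using limit_pt_act, col_beta.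
  - right. exists (phi beta u), (phi beta v).
    split; [now apply gap_act|]. split; [|split]; auto using col_beta.
    now apply (act_cyc phi Hact).
Qed.

Lemma boundary_gap_beta u v : boundary_gap u v -> boundary_gap (phi beta u) (phi beta v).
Proof.
  intros (Hg & s & s' & C & C' & Hs). split; [now apply gap_act|].
  exists (rot s), (rot s'). split; [|split]; auto using col_beta.
  intros E. now apply rot_inj in E.
Qed.

(** Otherwise all limit points would share one type, but [beta] rotates types. *)
Lemma boundary_gap_exists : exists u v, boundary_gap u v.
Proof.
  apply NNPP. intros Hn. destruct limit_pt_exists as [l Ll].
  destruct (col_exists l Ll) as [s Cs]. pose proof (col_beta l s Cs) as Cb.
  pose proof (limit_pt_act beta l Ll) as Lb.
  assert (Hs : s <> rot s) by (destruct s; discriminate).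
  assert (D : l <> phi beta l).
  { intros E. rewrite <- E in Cb. apply Hs. now apply (col_unique l). }
  apply Hs. apply (col_unique (phi beta l)); auto. apply (col_connected l); auto.
  intros p q w Hb. exfalso. eauto.
Qed.

Lemma nearest_right z (Q : G -> Prop) L :
  (exists n, In n L /\ Q n) ->
  exists n, In n L /\ Q n /\ forall m, In m L -> Q m -> ~ cyc z (o m) (o n).
Proof.
  induction L as [|a L IH]; intros (n & Hin & Qn); [contradiction|].
  destruct (classic (exists n, In n L /\ Q n)) as [Hex|Hno].
  - destruct (IH Hex) as (m & Hm & Qm & Hnear).
    destruct (classic (Q a /\ cyc z (o a) (o m))) as [[Qa Ca]|Hna].
    + exists a. split; [now left|split; [auto|]]. intros p [<-|Hp] Qp D.
      * clear - D. circ.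
      * apply (Hnear p Hp Qp). clear - Ca D. circ.
    + exists m. split; [now right|split; [auto|]]. intros p [<-|Hp] Qp D; [tauto|].
      exact (Hnear p Hp Qp D).
  - destruct Hin as [->|Hin]; [|exfalso; eauto].
    exists n. split; [now left|split; [auto|]]. intros p [<-|Hp] Qp D.
    + clear - D. circ.
    + apply Hno. eauto.
Qed.

Lemma nearest_left z (Q : G -> Prop) L :
  (exists n, In n L /\ Q n) ->
  exists n, In n L /\ Q n /\ forall m, In m L -> Q m -> ~ cyc (o n) (o m) z.
Proof.
  induction L as [|a L IH]; intros (n & Hin & Qn); [contradiction|].
  destruct (classic (exists n, In n L /\ Q n)) as [Hex|Hno].
  - destruct (IH Hex) as (m & Hm & Qm & Hnear).
    destruct (classic (Q a /\ cyc (o m) (o a) z)) as [[Qa Ca]|Hna].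
    + exists a. split; [now left|split; [auto|]]. intros p [<-|Hp] Qp D.
      * clear - D. circ.
      * apply (Hnear p Hp Qp). clear - Ca D. circ.
    + exists m. split; [now right|split; [auto|]]. intros p [<-|Hp] Qp D; [tauto|].
      exact (Hnear p Hp Qp D).
  - destruct Hin as [->|Hin]; [|exfalso; eauto].
    exists n. split; [now left|split; [auto|]]. intros p [<-|Hp] Qp D.
    + clear - D. circ.
    + apply Hno. eauto.
Qed.

Lemma cyc_convex a b p q w m :
  cyc p w q -> cyc p m q -> ~ cyc p a q -> ~ cyc p b q -> cyc a w b -> cyc a m b.
Proof. circ. Qed.

Let in_boundary (n : G) : Prop := exists u v, boundary_gap u v /\ cyc u (o n) v.

(** Each boundary gap contains a ball element, so the nearest one is found by minimising over a
    finite list. *)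
Lemma next_boundary_right z : (forall p q, boundary_gap p q -> ~ cyc p z q) ->
  exists u v, boundary_gap u v /\ forall p q w, boundary_gap p q -> cyc p w q -> ~ cyc z w u.
Proof.
  intros Hz. destruct (G_finite_ball j0) as [L HL].
  destruct (nearest_right z in_boundary L) as (n & Hn & (u & v & Hb & Cn) & Hnear).
  { destruct boundary_gap_exists as (u & v & Hb).
    destruct (boundary_gap_ball u v Hb) as (n & Bn & Cn). exists n. split; auto.
    exists u, v. auto. }
  exists u, v. split; auto. intros p q w Hpq Cw C.
  destruct (boundary_gap_ball p q Hpq) as (m & Bm & Cm).
  apply (Hnear m); [auto|exists p, q; auto|].
  pose proof (Hz p q Hpq) as F1. pose proof (Hz u v Hb) as F2.
  assert (F3 : ~ cyc p u q).
  { intros D. destruct Hpq as [(_ & _ & _ & H) _]. apply (H u D). apply Hb. }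
  pose proof (cyc_convex z u p q w (o m) Cw Cm F1 F3 C) as C'.
  clear - C' F2 Cn. circ.
Qed.

Lemma next_boundary_left z : (forall p q, boundary_gap p q -> ~ cyc p z q) ->
  exists u v, boundary_gap u v /\ forall p q w, boundary_gap p q -> cyc p w q -> ~ cyc v w z.
Proof.
  intros Hz. destruct (G_finite_ball j0) as [L HL].
  destruct (nearest_left z in_boundary L) as (n & Hn & (u & v & Hb & Cn) & Hnear).
  { destruct boundary_gap_exists as (u & v & Hb).
    destruct (boundary_gap_ball u v Hb) as (n & Bn & Cn). exists n. split; auto.
    exists u, v. auto. }
  exists u, v. split; auto. intros p q w Hpq Cw C.
  destruct (boundary_gap_ball p q Hpq) as (m & Bm & Cm).
  apply (Hnear m); [auto|exists p, q; auto|].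
  pose proof (Hz p q Hpq) as F1. pose proof (Hz u v Hb) as F2.
  assert (F3 : ~ cyc p v q).
  { intros D. destruct Hpq as [(_ & _ & _ & H) _]. apply (H v D). apply Hb. }
  pose proof (cyc_convex v z p q w (o m) Cw Cm F3 F1 C) as C'.
  clear - C' F2 Cn. circ.
Qed.

(** The type is demanded only at [l] and spreads by [col_connected]. If [l = r], the arc is a single
    point, a possibility excluded only in [component_nondegenerate]. *)
Definition component (s : letter) (l r : S1) : Prop :=
  col l s /\ (exists u, boundary_gap u l) /\ (exists v, boundary_gap r v) /\
  forall p q w, boundary_gap p q -> cyc p w q -> ~ arc_cc l r w.

Lemma boundary_gap_limit p q z : boundary_gap p q -> limit_pt z -> ~ cyc p z q.
Proof. intros [(_ & _ & _ & H) _] L D. exact (H z D L). Qed.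

Lemma boundary_gap_point p q : boundary_gap p q -> exists w, cyc p w q.
Proof. intros [Hg _]. destruct (gap_orbit p q Hg) as [g C]. eauto. Qed.

Lemma component_cover s z : piece s z -> exists l r, component s l r /\ arc_cc l r z.
Proof.
  intros Pz.
  assert (Hz : forall p q, boundary_gap p q -> ~ cyc p z q).
  { intros p q Hb C. exact (boundary_gap_piece p q s z Hb C Pz). }
  destruct (next_boundary_right z Hz) as (r & v & Hr & HR).
  destruct (next_boundary_left z Hz) as (u & l & Hl & HLt).
  assert (Ll : limit_pt l) by apply Hl. assert (Lr : limit_pt r) by apply Hr.
  assert (Hin : arc_cc l r z).
  { destruct (boundary_gap_point r v Hr) as [w Cw].
    pose proof (HLt r v w Hr Cw) as F1. pose proof (Hz r v Hr) as F2.
    pose proof (boundary_gap_limit _ _ l Hr Ll) as F3.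
    clear - Cw F1 F2 F3. circ. }
  exists l, r. split; [|exact Hin]. split; [|split; [eauto|split; [eauto|]]].
  (* A point inside a filled gap has no type of its own; the left end of the gap replaces it when
     the type is carried to [l]. *)
  - assert (Hp : exists p, limit_pt p /\ col p s /\ forall w, l <> p -> cyc l w p -> cyc l w z).
    { destruct Pz as [(L & C)|(p & q & Hg & Cp & Cq & C)].
      - exists z. auto.
      - exists p. split; [apply Hg|split; [auto|]]. intros w D Cw.
        assert (F : ~ cyc p l q) by (intros E; destruct Hg as (_ & _ & _ & H); exact (H l E Ll)).
        clear - C D Cw F. circ. }
    destruct Hp as (p & Lp & Cp & Hp). destruct (classic (l = p)) as [->|D]; [auto|].
    destruct (col_exists l Ll) as [s' Cl].
    assert (Cp' : col p s').
    { apply (col_connected l); auto. intros p' q' w Hb Cw Cw'. apply (HLt p' q' w Hb Cw). auto. }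
    now rewrite (col_unique p s s').
  - intros p q w Hb Cw Ha.
    pose proof (HR p q w Hb Cw) as F1. pose proof (HLt p q w Hb Cw) as F2.
    assert (F3 : w <> z) by (intros ->; exact (Hz p q Hb Cw)).
    assert (F4 : w <> l) by (intros ->; exact (boundary_gap_limit _ _ _ Hb Ll Cw)).
    assert (F5 : w <> r) by (intros ->; exact (boundary_gap_limit _ _ _ Hb Lr Cw)).
    clear - Hin Ha F1 F2 F3 F4 F5. circ.
Qed.

Lemma component_limit s l r : component s l r -> limit_pt l /\ limit_pt r.
Proof. intros (_ & [u Hu] & [v Hv] & _). split; [apply Hu|apply Hv]. Qed.

Lemma component_col s l r z : component s l r -> limit_pt z -> arc_cc l r z -> col z s.
Proof.
  intros H Lz Hz. destruct (classic (l = z)) as [<-|D]; [apply H|].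
  destruct (component_limit s l r H) as [Ll Lr].
  apply (col_connected l); auto; [|apply H].
  intros p q w Hb Cw C. destruct H as (_ & _ & _ & H). apply (H p q w Hb Cw).
  clear - Hz C D. circ.
Qed.

Lemma component_col_r s l r : component s l r -> col r s.
Proof.
  intros H. apply (component_col s l r); auto; [apply (component_limit s l r H)|].
  right; now left.
Qed.

Lemma component_piece s l r z : component s l r -> arc_cc l r z -> piece s z.
Proof.
  intros H Hz. destruct (component_limit s l r H) as [Ll Lr].
  destruct (classic (limit_pt z)) as [Lz|Lz].
  - left. split; auto. now apply (component_col s l r).
  - destruct (gap_at z Lz) as (p & q & Hg & C). right. exists p, q. split; auto.
    destruct Hg as (Lp & Lq & Hpq & Hg).
    assert (F1 : ~ cyc p l q) by (intros E; exact (Hg l E Ll)).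
    assert (F2 : ~ cyc p r q) by (intros E; exact (Hg r E Lr)).
    assert (D1 : z <> l) by congruence. assert (D2 : z <> r) by congruence.
    assert (Hp : arc_cc l r p /\ arc_cc l r q) by (clear - Hz C F1 F2 D1 D2; circ).
    destruct Hp as [Hp Hq].
    split; [|split; [|exact C]]; now apply (component_col s l r).
Qed.

Lemma component_start s l r u v : component s l r -> boundary_gap u v -> arc_cc l r v -> v = l.
Proof.
  intros H Hb Hv. apply NNPP. intros D. destruct (boundary_gap_point u v Hb) as [w Cw].
  pose proof (boundary_gap_limit _ _ l Hb (proj1 (component_limit s l r H))) as F.
  destruct H as (_ & _ & _ & H). apply (H u v w Hb Cw). clear - Hv D Cw F. circ.
Qed.

Lemma component_end s l r u v : component s l r -> boundary_gap u v -> arc_cc l r u -> u = r.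
Proof.
  intros H Hb Hv. apply NNPP. intros D. destruct (boundary_gap_point u v Hb) as [w Cw].
  pose proof (boundary_gap_limit _ _ r Hb (proj2 (component_limit s l r H))) as F.
  destruct H as (_ & _ & _ & H). apply (H u v w Hb Cw). clear - Hv D Cw F. circ.
Qed.

Lemma component_unique s s' l r l' r' z :
  component s l r -> component s' l' r' -> arc_cc l r z -> arc_cc l' r' z -> l = l' /\ r = r'.
Proof.
  intros H H' Hz Hz'.
  pose proof H as (_ & [u Hu] & [v Hv] & _). pose proof H' as (_ & [u' Hu'] & [v' Hv'] & _).
  split.
  - assert (D : arc_cc l r l' \/ arc_cc l' r' l) by (clear - Hz Hz'; circ).
    destruct D as [D|D]; [symmetry; exact (component_start s l r u' l' H Hu' D)|
      exact (component_start s' l' r' u l H' Hu D)].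
  - assert (D : arc_cc l r r' \/ arc_cc l' r' r) by (clear - Hz Hz'; circ).
    destruct D as [D|D]; [symmetry; exact (component_end s l r r' v' H Hv' D)|
      exact (component_end s' l' r' r v H' Hv D)].
Qed.

Lemma boundary_gap_component_r u v s : boundary_gap u v -> col v s -> exists r, component s v r.
Proof.
  intros Hb Cv. destruct (component_cover s v) as (l & r & H & Hv).
  - left. split; auto. apply Hb.
  - rewrite (component_start s l r u v H Hb Hv) in *. eauto.
Qed.

Lemma boundary_gap_component_l u v s : boundary_gap u v -> col u s -> exists l, component s l u.
Proof.
  intros Hb Cu. destruct (component_cover s u) as (l & r & H & Hv).
  - left. split; auto. apply Hb.
  - rewrite (component_end s l r u v H Hb Hv) in *. eauto.
Qed.

Lemma beta3 z : phi beta (phi beta (phi beta z)) = z.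
Proof.
  rewrite <- !(act_mul phi Hact). replace (beta ** beta ** beta) with Ge by now apply G_eq.
  apply Hact.
Qed.

Lemma alpha2 z : phi alpha (phi alpha z) = z.
Proof.
  rewrite <- (act_mul phi Hact). replace (alpha ** alpha) with Ge by now apply G_eq.
  apply Hact.
Qed.

Lemma arc_cc_act g l r z : arc_cc l r z -> arc_cc (phi g l) (phi g r) (phi g z).
Proof.
  intros [->|[->|H]]; [now left|right; now left|right; right]. now apply (act_cyc phi Hact).
Qed.

Lemma component_beta s l r : component s l r -> component (rot s) (phi beta l) (phi beta r).
Proof.
  intros (C & [u Hu] & [v Hv] & H). split; [now apply col_beta|].
  split; [exists (phi beta u); now apply boundary_gap_beta|].
  split; [exists (phi beta v); now apply boundary_gap_beta|].
  intros p q w Hb Cw Ha. apply (H (phi beta (phi beta p)) (phi beta (phi beta q))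
    (phi beta (phi beta w))).
  - now repeat apply boundary_gap_beta.
  - now repeat apply (act_cyc phi Hact).
  - rewrite <- (beta3 l), <- (beta3 r). now repeat apply arc_cc_act.
Qed.

(** A component is determined by the boundary gap before its left end, and that gap by any ball
    element in it. *)
Lemma components_finite s :
  exists L : list (S1 * S1), NoDup L /\ forall p, In p L <-> component s (fst p) (snd p).
Proof.
  destruct (G_finite_ball j0) as [B HB].
  assert (Hdec : forall p q : S1 * S1, {p = q} + {p <> q}).
  { intros; apply excluded_middle_informative. }
  assert (H : exists L : list (S1 * S1), forall p, In p L <->
     component s (fst p) (snd p) /\ exists n u, In n B /\ boundary_gap u (fst p) /\
                                     cyc u (o n) (fst p)).
  { clear HB. induction B as [|n B [L IH]].
    - exists []. intros p. split; [intros []|intros (_ & n & _ & [] & _)].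
    - destruct (classic (exists p, component s (fst p) (snd p) /\
         exists u, boundary_gap u (fst p) /\ cyc u (o n) (fst p))) as [(p & Hp & u & Hu & Cu)|Hno].
      + exists (p :: L). intros q. simpl. rewrite IH. split.
        * intros [<-|(Hq & m & w & Hm & D)]; split; auto.
          -- exists n, u. auto.
          -- exists m, w. auto.
        * intros (Hq & m & w & [<-|Hm] & Hw & Cw); [left|right; split; auto; exists m, w; auto].
          destruct (gap_unique _ _ _ _ _ (proj1 Hu) (proj1 Hw) Cu Cw) as [_ E].
          destruct p as [l r], q as [l' r']; simpl in *. subst l'.
          destruct (component_unique s s l r l r' l Hp Hq) as [_ ->]; auto; now left.
      + exists L. intros q. rewrite IH. split.
        * intros (Hq & m & w & Hm & D). split; auto. exists m, w. simpl. auto.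
        * intros (Hq & m & w & [<-|Hm] & D); split; auto; [exfalso; eauto|].
          exists m, w. auto. }
  destruct H as [L HL]. exists (nodup Hdec L). split; [apply NoDup_nodup|].
  intros p. rewrite nodup_In, HL. split; [tauto|]. intros Hp. split; auto.
  pose proof Hp as (_ & [u Hu] & _). destruct (boundary_gap_ball u (fst p) Hu) as (n & Bn & Cn).
  exists n, u. auto.
Qed.

(** * Depth of gaps *)

Lemma boundary_gap_neq_r u v s : boundary_gap u v -> col u s -> ~ col v s.
Proof.
  intros (Hg & s1 & s2 & C1 & C2 & Hs) Cu Cv. apply Hs.
  rewrite (col_unique u s1 s), (col_unique v s2 s); auto; apply Hg.
Qed.

(** [alpha] exchanges type [LA] with the other two types, so ends of which exactly one is [LA] keep
    distinct types. A gap with two different non-[LA] ends instead becomes one with both ends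
    [LA]. *)
Lemma boundary_gap_alpha u v : boundary_gap u v -> col u LA \/ col v LA ->
  boundary_gap (phi alpha u) (phi alpha v).
Proof.
  intros Hb H. pose proof Hb as (Hg & s1 & s2 & C1 & C2 & Hs). split; [now apply gap_act|].
  assert (Lu : limit_pt u) by apply Hg. assert (Lv : limit_pt v) by apply Hg.
  destruct H as [Cu|Cv].
  - rewrite (col_unique u s1 LA) in * by auto. destruct (col_alpha_A u Lu Cu) as (s & Hs' & C).
    exists s, LA. split; [auto|split; [|auto]]. apply (col_alpha_nonA v s2); congruence.
  - rewrite (col_unique v s2 LA) in * by auto. destruct (col_alpha_A v Lv Cv) as (s & Hs' & C).
    exists LA, s. split; [|split; auto]. apply (col_alpha_nonA u s1); congruence.
Qed.

Lemma boundary_gap_alpha_inv u v : boundary_gap u v ->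
  boundary_gap (phi alpha u) (phi alpha v) -> col u LA \/ col v LA.
Proof.
  intros (Hg & s1 & s2 & C1 & C2 & Hs) Hb. destruct (letter_dec s1 LA) as [->|N1]; [auto|].
  destruct (letter_dec s2 LA) as [->|N2]; [auto|]. exfalso.
  apply (boundary_gap_neq_r _ _ LA Hb); eapply col_alpha_nonA; eauto.
Qed.

Definition undo (s : letter) (z : S1) : S1 :=
  match s with
  | LA => phi alpha z
  | LB => phi beta (phi beta z)
  | LBi => phi beta z
  end.

(* [depth Q n u v]: stripping first letters [n] times carries the gap [(u, v)]
   to a boundary gap satisfying [Q]. *)
Fixpoint depth (Q : S1 -> S1 -> Prop) (n : nat) (u v : S1) : Prop :=
  match n with
  | O => boundary_gap u v /\ Q u v
  | S n => gap u v /\ exists s, col u s /\ col v s /\ depth Q n (undo s u) (undo s v)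
  end.

Lemma depth_unique Q Q' n : forall m u v, depth Q n u v -> depth Q' m u v -> n = m.
Proof.
  induction n as [|n IH]; intros [|m] u v; simpl; auto.
  - intros (Hb & _) (_ & s & Cu & Cv & _). exfalso. exact (boundary_gap_neq_r u v s Hb Cu Cv).
  - intros (_ & s & Cu & Cv & _) (Hb & _). exfalso. exact (boundary_gap_neq_r u v s Hb Cu Cv).
  - intros (Hg & s & Cu & Cv & H) (_ & s' & Cu' & Cv' & H').
    rewrite (col_unique u s' s) in H'; auto; [|apply Hg]. f_equal. eauto.
Qed.

Lemma depth_boundary Q n u v : depth Q n u v -> boundary_gap u v -> n = O /\ Q u v.
Proof.
  destruct n as [|n]; simpl; [intros [_ H]; auto|].
  intros (_ & s & Cu & Cv & _) Hb. exfalso. exact (boundary_gap_neq_r u v s Hb Cu Cv).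
Qed.

(** Every gap is a translate of the given one. Its depth is followed along a reduced word: stripping
    retraces any excursion away from the boundary gaps, so [Q] need only be preserved by moves
    between boundary gaps. *)
Lemma depth_all (Q : S1 -> S1 -> Prop) u0 v0 :
  (forall u v, boundary_gap u v -> Q u v -> Q (phi beta u) (phi beta v)) ->
  (forall u v, boundary_gap u v -> Q u v -> boundary_gap (phi alpha u) (phi alpha v) ->
     Q (phi alpha u) (phi alpha v)) ->
  boundary_gap u0 v0 -> Q u0 v0 ->
  forall u v, gap u v -> exists n, depth Q n u v.
Proof.
  intros Qb Qa Hb0 Q0.
  (* For positive depth, rotation adds a letter to type [LA], keeps the depth for type [LB], and
     removes the letter for type [LBi]. *)
  assert (Db : forall n u v, depth Q n u v -> exists m, depth Q m (phi beta u) (phi beta v)).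
  { intros [|n] u v; simpl.
    - intros [Hb HQ]. exists O. split; [now apply boundary_gap_beta|auto].
    - intros (Hg & s & Cu & Cv & H). destruct s; simpl in H.
      + exists (S (S n)). split; [now apply gap_act|]. exists LB.
        split; [now apply (col_beta u LA)|split; [now apply (col_beta v LA)|]].
        unfold undo at 1 2. rewrite !beta3. split; auto. exists LA. auto.
      + exists (S n). split; [now apply gap_act|]. exists LBi.
        split; [now apply (col_beta u LB)|split; [now apply (col_beta v LB)|]]. exact H.
      + exists n. exact H. }
  assert (Da : forall n u v, depth Q n u v -> exists m, depth Q m (phi alpha u) (phi alpha v)).
  { intros [|n] u v; simpl.
    - intros [Hb HQ]. pose proof (gap_act alpha u v (proj1 Hb)) as Hg.
      destruct (classic (boundary_gap (phi alpha u) (phi alpha v))) as [Hb'|Hb'].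
      + exists O. split; auto.
      (* A boundary gap not carried to a boundary gap has no end of type [LA]; its image has both
         ends of that type, and stripping this letter leads back. *)
      + exists 1%nat. split; [exact Hg|]. exists LA. simpl. rewrite !alpha2.
        pose proof Hb as ((Lu & Lv & _) & s1 & s2 & C1 & C2 & Hs).
        assert (N1 : s1 <> LA).
        { intros ->. apply Hb', boundary_gap_alpha; auto. }
        assert (N2 : s2 <> LA).
        { intros ->. apply Hb', boundary_gap_alpha; auto. }
        split; [now apply (col_alpha_nonA u s1)|split; [now apply (col_alpha_nonA v s2)|auto]].
    - intros (Hg & s & Cu & Cv & H). destruct (letter_dec s LA) as [->|Hs].
      + exists n. exact H.
      + exists (S (S n)). split; [now apply gap_act|]. exists LA.
        split; [now apply (col_alpha_nonA u s)|split; [now apply (col_alpha_nonA v s)|]].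
        unfold undo at 1 2. rewrite !alpha2. split; auto. exists s. auto. }
  intros u v Hg. destruct (gap_transitive u0 v0 u v (proj1 Hb0) Hg) as (g & <- & <-).
  clear Hg. revert g. apply G_ind_reduced.
  - exists O. destruct Hact as (_ & E & _). rewrite !E. split; auto.
  - intros g _ _ [n IH]. rewrite !(act_mul phi Hact). eauto.
  - intros g _ [n IH]. rewrite !(act_mul phi Hact). eauto.
Qed.

Let Any (u v : S1) : Prop := True.

Lemma depth_exists u v : gap u v -> exists n, depth Any n u v.
Proof.
  destruct boundary_gap_exists as (u0 & v0 & H0).
  apply (depth_all Any u0 v0); unfold Any; auto.
Qed.

Lemma gap_right_unique v w w' : gap v w -> gap v w' -> w = w'.
Proof.
  intros (_ & Lw & D & H) (_ & Lw' & D' & H').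
  assert (F : ~ cyc v w' w) by (intros C; exact (H _ C Lw')).
  assert (F' : ~ cyc v w w') by (intros C; exact (H' _ C Lw)).
  clear - D D' F F'. circ.
Qed.

(** The ball meets every boundary gap, so there are finitely many; each has at most one right
    neighbour, of a single depth. *)
Lemma depth_right_bounded : exists B, forall u v w n,
  boundary_gap u v -> gap v w -> depth Any n v w -> (n <= B)%nat.
Proof.
  destruct (G_finite_ball j0) as [L HL].
  assert (H : exists B, forall u v w n, (exists m, In m L /\ cyc u (o m) v) ->
    boundary_gap u v -> gap v w -> depth Any n v w -> (n <= B)%nat).
  { clear HL. induction L as [|a L [B IH]].
    - exists O. intros u v w n (m & [] & _).
    - destruct (classic (exists u v w n, cyc u (o a) v /\ boundary_gap u v /\ gap v w /\
                           depth Any n v w)) as [(u & v & w & n & C & Hb & Hg & Hd)|Hno].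
      + exists (Nat.max B n). intros u' v' w' n' (m & [<-|Hm] & C') Hb' Hg' Hd'.
        * destruct (gap_unique _ _ _ _ _ (proj1 Hb) (proj1 Hb') C C') as [<- <-].
          rewrite <- (gap_right_unique _ _ _ Hg Hg') in Hd'.
          rewrite (depth_unique _ _ _ _ _ _ Hd' Hd). lia.
        * assert (n' <= B)%nat by (apply (IH u' v' w'); eauto). lia.
      + exists B. intros u' v' w' n' (m & [<-|Hm] & C') Hb' Hg' Hd'.
        * exfalso. apply Hno. exists u', v', w', n'. auto.
        * apply (IH u' v' w'); eauto. }
  destruct H as [B H]. exists B. intros u v w n Hb. destruct (boundary_gap_ball u v Hb) as (m & Bm & C).
  apply (H u v w n); auto. exists m. auto.
Qed.

(** If [v] has type [LA], [beta] adds a letter to the neighbour. If instead [u] has type [LA],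
    [alpha] does so and keeps the first gap a boundary gap. In the remaining cases one or two
    rotations give [u] the type [LA] without changing the depth of the neighbour. *)
Lemma depth_right_increase u v w n :
  boundary_gap u v -> gap v w -> depth Any (S n) v w ->
  exists u' v' w', boundary_gap u' v' /\ gap v' w' /\ depth Any (S (S n)) v' w'.
Proof.
  assert (Hprin : forall u v w s, boundary_gap u v -> gap v w -> col u LA -> s <> LA ->
     col v s -> col w s -> depth Any (S n) v w ->
     exists u' v' w', boundary_gap u' v' /\ gap v' w' /\ depth Any (S (S n)) v' w').
  { clear u v w. intros u v w s Hb Hg Cu Hs Cv Cw Hd.
    exists (phi alpha u), (phi alpha v), (phi alpha w).
    split; [apply boundary_gap_alpha; auto|split; [now apply gap_act|]].
    split; [now apply gap_act|]. exists LA.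
    split; [now apply (col_alpha_nonA v s)|split; [now apply (col_alpha_nonA w s)|]].
    unfold undo. rewrite !alpha2. exact Hd. }
  intros Hb Hg Hd. pose proof Hd as (_ & s & Cv & Cw & Hd').
  pose proof Hb as (Hguv & su & sv & Cu & Cv' & Hs).
  rewrite (col_unique v sv s) in Hs by (auto; apply Hguv).
  destruct (letter_dec s LA) as [->|Ns].
  - exists (phi beta u), (phi beta v), (phi beta w).
    split; [now apply boundary_gap_beta|split; [now apply gap_act|]].
    split; [now apply gap_act|]. exists LB.
    split; [now apply (col_beta v LA)|split; [now apply (col_beta w LA)|]].
    unfold undo. rewrite !beta3. exact Hd.
  - destruct (letter_dec su LA) as [->|Nsu].
    + exact (Hprin u v w s Hb Hg Cu Ns Cv Cw Hd).
    + destruct s, su; try congruence.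
      * apply (Hprin (phi beta u) (phi beta v) (phi beta w) LBi); try discriminate.
        -- now apply boundary_gap_beta.
        -- now apply gap_act.
        -- now apply (col_beta u LBi).
        -- now apply (col_beta v LB).
        -- now apply (col_beta w LB).
        -- split; [now apply gap_act|]. exists LBi.
           split; [now apply (col_beta v LB)|split; [now apply (col_beta w LB)|]]. exact Hd'.
      * apply (Hprin (phi beta (phi beta u)) (phi beta (phi beta v)) (phi beta (phi beta w)) LB);
          try discriminate.
        -- now repeat apply boundary_gap_beta.
        -- now repeat apply gap_act.
        -- now apply (col_beta _ LBi), (col_beta u LB).
        -- now apply (col_beta _ LA), (col_beta v LBi).
        -- now apply (col_beta _ LA), (col_beta w LBi).
        -- split; [now repeat apply gap_act|]. exists LB.
           split; [now apply (col_beta _ LA), (col_beta v LBi)|].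
           split; [now apply (col_beta _ LA), (col_beta w LBi)|].
           unfold undo. rewrite !beta3. exact Hd'.
Qed.

(** A right neighbour of positive depth could be deepened indefinitely, against
    [depth_right_bounded]. *)
Lemma boundary_gap_right u v w : boundary_gap u v -> gap v w -> boundary_gap v w.
Proof.
  intros Hb Hg. destruct (depth_exists v w Hg) as [[|n] Hd]; [apply Hd|exfalso].
  destruct depth_right_bounded as [B HB].
  assert (H : forall k, exists u v w, boundary_gap u v /\ gap v w /\ depth Any (S (n + k)) v w).
  { induction k as [|k (u' & v' & w' & Hb' & Hg' & Hd')].
    - exists u, v, w. rewrite Nat.add_0_r. auto.
    - rewrite Nat.add_succ_r. exact (depth_right_increase u' v' w' _ Hb' Hg' Hd'). }
  destruct (H B) as (u' & v' & w' & Hb' & Hg' & Hd'). pose proof (HB _ _ _ _ Hb' Hg' Hd'). lia.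
Qed.

Lemma principal_exists : exists u v, boundary_gap u v /\ col u LA.
Proof.
  destruct boundary_gap_exists as (u & v & Hb). pose proof Hb as (_ & s & _ & C & _).
  destruct (rotate_to_A s) as [->|[E|E]].
  - eauto.
  - exists (phi beta u), (phi beta v). split; [now apply boundary_gap_beta|].
    rewrite <- E. now apply col_beta.
  - exists (phi beta (phi beta u)), (phi beta (phi beta v)).
    split; [now repeat apply boundary_gap_beta|]. rewrite <- E. now repeat apply col_beta.
Qed.

(** Rotating a principal gap makes both of its ends differ from [LA]; [alpha] then turns both into
    [LA]. *)
Lemma inner_gap_exists : exists u v, gap u v /\ col u LA /\ col v LA.
Proof.
  destruct principal_exists as (u & v & Hb & Cu). pose proof Hb as (Hg & _ & s & _ & Cv & _).
  assert (Hs : s <> LA) by (intros ->; exact (boundary_gap_neq_r u v LA Hb Cu Cv)).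
  assert (H : exists u v s s', gap u v /\ col u s /\ col v s' /\ s <> LA /\ s' <> LA).
  { destruct s; [congruence| |].
    - exists (phi beta u), (phi beta v), LB, LBi. split; [now apply gap_act|].
      split; [now apply (col_beta u LA)|split; [now apply (col_beta v LB)|]]. split; discriminate.
    - exists (phi beta (phi beta u)), (phi beta (phi beta v)), LBi, LB.
      split; [now repeat apply gap_act|].
      split; [now apply (col_beta _ LB), (col_beta u LA)|].
      split; [now apply (col_beta _ LA), (col_beta v LBi)|]. split; discriminate. }
  destruct H as (p & q & s1 & s2 & Hpq & C1 & C2 & N1 & N2).
  exists (phi alpha p), (phi alpha q). split; [now apply gap_act|].
  split; [now apply (col_alpha_nonA p s1)|now apply (col_alpha_nonA q s2)].
Qed.

(* A degenerate component would give every gap a right neighbour; by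
   [boundary_gap_right] all components would then be single points, although
   one of them contains an inner gap. *)
Lemma component_nondegenerate s v : ~ component s v v.
Proof.
  intros (_ & [u Hu] & [w Hw] & _).
  assert (RN : forall p q, gap p q -> exists r, gap q r).
  { intros p q Hg. destruct (gap_transitive u v p q (proj1 Hu) Hg) as (g & <- & <-).
    exists (phi g w). apply gap_act, Hw. }
  destruct inner_gap_exists as (p & q & Hg & Cp & Cq).
  destruct (gap_orbit p q Hg) as [g Cg].
  destruct (component_cover LA (o g)) as (l & r & H & Hin).
  { right. exists p, q. auto. }
  destruct (component_limit _ _ _ H) as [Ll Lr].
  pose proof H as (_ & [p' Hp'] & _ & Hn). destruct (RN p' l (proj1 Hp')) as [r' Hr'].
  pose proof (boundary_gap_right p' l r' Hp' Hr') as Hb.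
  destruct (boundary_gap_point l r' Hb) as [x Cx].
  pose proof (Hn l r' x Hb Cx) as F.
  pose proof (boundary_gap_limit l r' r Hb Lr) as F'.
  pose proof (limit_pt_neq l g Ll) as D1. pose proof (limit_pt_neq r g Lr) as D2.
  clear - Hin Cx F F' D1 D2. circ.
Qed.

Definition principal_gap (u v : S1) : Prop := boundary_gap u v /\ (col u LA \/ col v LA).

(** A path of boundary gaps may run through complementary ones, where [R] is not controlled. Hence
    [Q] asserts [R] for all principal gaps among the three rotates, which makes it [beta]-invariant;
    moves by [alpha] between boundary gaps involve principal gaps only. *)
Lemma principal_gap_connected (R : S1 -> S1 -> Prop) u0 v0 :
  (forall u v, principal_gap u v -> R u v -> principal_gap (phi alpha u) (phi alpha v) ->
     R (phi alpha u) (phi alpha v)) ->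
  (forall u v, principal_gap u v -> R u v -> principal_gap (phi beta u) (phi beta v) ->
     R (phi beta u) (phi beta v)) ->
  (forall u v, principal_gap u v -> R u v ->
     principal_gap (phi beta (phi beta u)) (phi beta (phi beta v)) ->
     R (phi beta (phi beta u)) (phi beta (phi beta v))) ->
  principal_gap u0 v0 -> R u0 v0 -> forall u v, principal_gap u v -> R u v.
Proof.
  intros Ra Rb Rbb P0 R0.
  pose (Q := fun u v => (principal_gap u v -> R u v) /\
    (principal_gap (phi beta u) (phi beta v) -> R (phi beta u) (phi beta v)) /\
    (principal_gap (phi beta (phi beta u)) (phi beta (phi beta v)) ->
       R (phi beta (phi beta u)) (phi beta (phi beta v)))).
  assert (QR : forall u v, principal_gap u v -> R u v -> Q u v).
  { intros u v P H. split; [auto|split; intros; auto]. }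
  intros u v P. destruct (depth_all Q u0 v0) with (u := u) (v := v) as [n Hd]; auto.
  - intros p q _ (Q1 & Q2 & Q3). split; [auto|split; [auto|]]. now rewrite !beta3.
  - intros p q Hb (Q1 & _) Hb'. pose proof (boundary_gap_alpha_inv p q Hb Hb') as Hc.
    assert (P1 : principal_gap p q) by (split; auto).
    assert (P2 : principal_gap (phi alpha p) (phi alpha q)).
    { split; auto. apply boundary_gap_alpha_inv; auto. now rewrite !alpha2. }
    auto.
  - apply P0.
  - apply P.
  - destruct (depth_boundary Q n u v Hd (proj1 P)) as [_ (H & _)]. auto.
Qed.

(** * The Markov system *)

Let arc_beta (p : S1 * S1) : S1 * S1 := (phi beta (fst p), phi beta (snd p)).

Let arc_beta3 p : arc_beta (arc_beta (arc_beta p)) = p.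
Proof. destruct p. unfold arc_beta; simpl. now rewrite !beta3. Qed.

Let arc_beta_inj p q : arc_beta p = arc_beta q -> p = q.
Proof. intros E. rewrite <- (arc_beta3 p), E. apply arc_beta3. Qed.

Lemma component_list_beta s L :
  (forall p, In p L <-> component s (fst p) (snd p)) ->
  forall p, In p (map arc_beta L) <-> component (rot s) (fst p) (snd p).
Proof.
  intros H p. rewrite in_map_iff. split.
  - intros (q & <- & Hq). apply component_beta. now apply H.
  - intros Hp. exists (arc_beta (arc_beta p)). split; [apply arc_beta3|]. apply H.
    rewrite <- (rot3 s). now do 2 apply component_beta in Hp.
Qed.

Lemma pieces_of_components s L :
  (forall p, In p L <-> component s (fst p) (snd p)) -> seteq (piece s) (arcs_union L).
Proof.
  intros H z. split.
  - intros Hz. destruct (component_cover s z Hz) as (l & r & Hc & Hin).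
    exists (l, r). split; [now apply H|exact Hin].
  - intros (p & Hp & Hin). apply H in Hp. now apply (component_piece s (fst p) (snd p)).
Qed.

Let X (z : S1) : Prop := piece LA z \/ piece LB z \/ piece LBi z.

Lemma limit_pt_piece z : limit_pt z -> X z.
Proof.
  intros L. destruct (col_exists z L) as [s C]. unfold X, piece.
  destruct s; auto 6.
Qed.

Lemma consecutive_components s s' I J :
  component s (fst I) (snd I) -> component s' (fst J) (snd J) ->
  consecutive X I J -> snd I <> fst J -> gap (snd I) (fst J).
Proof.
  intros HI HJ HX D. split; [apply (component_limit _ _ _ HI)|].
  split; [apply (component_limit _ _ _ HJ)|]. split; [exact D|].
  intros z Cz Lz. apply (HX z Cz). now apply limit_pt_piece.
Qed.

Lemma boundary_gap_consecutive l r u v :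
  boundary_gap u v -> consecutive X (l, u) (v, r).
Proof.
  intros Hb z Cz [P|[P|P]]; exact (boundary_gap_piece u v _ z Hb Cz P).
Qed.

Lemma consecutive_col s s' I J :
  component s (fst I) (snd I) -> component s' (fst J) (snd J) ->
  consecutive X I J -> s <> s' ->
  boundary_gap (snd I) (fst J) /\ col (snd I) s /\ col (fst J) s'.
Proof.
  intros HI HJ HX D. pose proof (component_col_r _ _ _ HI) as CI.
  assert (CJ : col (fst J) s') by apply HJ.
  assert (snd I <> fst J).
  { intros E. rewrite E in CI. apply D. apply (col_unique (fst J)); auto.
    apply (component_limit _ _ _ HJ). }
  split; [|auto]. split; [now apply (consecutive_components s s')|]. exists s, s'. auto.
Qed.

(** A gap between two such components would have ends of equal type and thus be filled by the piece;
    a shared endpoint would make the components coincide and degenerate. *)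
Lemma not_consecutive_same s I J :
  component s (fst I) (snd I) -> component s (fst J) (snd J) -> ~ consecutive X I J.
Proof.
  intros HI HJ HX. destruct (classic (snd I = fst J)) as [E|D].
  - destruct (component_unique s s _ _ _ _ (snd I) HI HJ) as [E1 E2].
    + right; now left.
    + now left.
    + rewrite <- E1 in E. apply (component_nondegenerate s (fst I)). now rewrite E in HI.
  - pose proof (consecutive_components s s I J HI HJ HX D) as Hg.
    destruct (gap_orbit _ _ Hg) as [g Cg]. apply (HX (o g) Cg).
    assert (P : piece s (o g)).
    { right. exists (snd I), (fst J). split; [auto|].
      split; [now apply (component_col_r s (fst I))|split; [apply HJ|exact Cg]]. }
    unfold X. destruct s; auto.
Qed.

Lemma image_arc_oo g u v : seteq (image (phi g) (arc_oo u v)) (arc_oo (phi g u) (phi g v)).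
Proof.
  intros z. unfold image, arc_oo. split.
  - intros (w & Cw & <-). now apply (act_cyc phi Hact).
  - intros Cz. exists (phi (Ginv g) z). rewrite (act_inv_r phi Hact). split; auto.
    apply (act_cyc_inv phi Hact g). now rewrite (act_inv_r phi Hact).
Qed.

Lemma preimage_beta_arc_oo u v :
  seteq (fun z => arc_oo u v (phi beta z))
        (arc_oo (phi beta (phi beta u)) (phi beta (phi beta v))).
Proof.
  intros z. unfold arc_oo. split; intros C.
  - rewrite <- (beta3 z). now do 2 apply (act_cyc phi Hact).
  - apply (act_cyc phi Hact beta) in C. now rewrite !beta3 in C.
Qed.

Lemma seteq_eq P Q : seteq P Q -> P = Q.
Proof. intros H. apply functional_extensionality. intros z. apply propositional_extensionality, H. Qed.

Lemma piece_alpha_nonA s z : s <> LA -> piece s z -> piece LA (phi alpha z).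
Proof.
  intros Hs [(L & C)|(u & v & Hg & Cu & Cv & C)].
  - left. split; [now apply limit_pt_act|now apply (col_alpha_nonA z s)].
  - right. exists (phi alpha u), (phi alpha v). split; [now apply gap_act|].
    split; [now apply (col_alpha_nonA u s)|split; [now apply (col_alpha_nonA v s)|]].
    now apply (act_cyc phi Hact).
Qed.

Section Lists.
Context (la : list (S1 * S1)) (Hnd : NoDup la).
Context (Hla : forall p, In p la <-> component LA (fst p) (snd p)).

(** Enumerating the other two families as [beta]-images of [la] makes the three numbers of intervals
    equal by construction. *)
Let lb := map arc_beta la.
Let lbi := map arc_beta lb.
Let all := la ++ lb ++ lbi.

Let Hlb : forall p, In p lb <-> component LB (fst p) (snd p) := component_list_beta LA la Hla.
Let Hlbi : forall p, In p lbi <-> component LBi (fst p) (snd p) := component_list_beta LB lb Hlb.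

Lemma in_all p : In p all <-> exists s, component s (fst p) (snd p).
Proof.
  unfold all. rewrite !in_app_iff, Hla, Hlb, Hlbi. split.
  - intros [H|[H|H]]; eauto.
  - intros [[] H]; auto.
Qed.

Lemma in_component s p : component s (fst p) (snd p) -> In p all.
Proof. intros H. apply in_all. eauto. Qed.

Lemma all_NoDup : NoDup all.
Proof.
  assert (D : forall s s' p, component s (fst p) (snd p) -> component s' (fst p) (snd p) -> s = s').
  { intros s s' p H H'. apply (col_unique (fst p)); [|apply H|apply H'].
    apply (component_limit _ _ _ H). }
  assert (Nb : NoDup lb) by (apply FinFun.Injective_map_NoDup; auto; intros p q; apply arc_beta_inj).
  assert (Nbi : NoDup lbi) by (apply FinFun.Injective_map_NoDup; auto; intros p q; apply arc_beta_inj).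
  unfold all. apply NoDup_app; [exact Hnd|apply NoDup_app; auto|].
  - intros p H1 H2. apply Hlb in H1. apply Hlbi in H2. discriminate (D _ _ _ H1 H2).
  - intros p H1 H2. apply Hla in H1. apply in_app_iff in H2. rewrite Hlb, Hlbi in H2.
    destruct H2 as [H2|H2]; discriminate (D _ _ _ H1 H2).
Qed.

Lemma all_disjoint i j : (i < length all)%nat -> (j < length all)%nat -> i <> j ->
  forall z, arc_cc (fst (nth i all (s0, s0))) (snd (nth i all (s0, s0))) z ->
           ~ arc_cc (fst (nth j all (s0, s0))) (snd (nth j all (s0, s0))) z.
Proof.
  intros Hi Hj D z Ci Cj. apply D.
  apply (proj1 (NoDup_nth all (s0, s0)) all_NoDup i j Hi Hj).
  destruct (proj1 (in_all _) (nth_In all (s0, s0) Hi)) as [s Hs].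
  destruct (proj1 (in_all _) (nth_In all (s0, s0) Hj)) as [s' Hs'].
  destruct (component_unique _ _ _ _ _ _ z Hs Hs' Ci Cj) as [E1 E2].
  now apply injective_projections.
Qed.

Let principal (P : S1 -> Prop) :=
  exists I J, In I all /\ In J all /\ consecutive X I J /\
    ((In I la /\ In J (lb ++ lbi)) \/ (In I (lb ++ lbi) /\ In J la)) /\
    seteq P (arc_oo (snd I) (fst J)).

Let complementary (P : S1 -> Prop) :=
  exists I J, In I all /\ In J all /\ consecutive X I J /\
    ((In I lb /\ In J lbi) \/ (In I lbi /\ In J lb)) /\
    seteq P (arc_oo (snd I) (fst J)).

Let edge (P Q : S1 -> Prop) :=
  principal P /\ principal Q /\
  (seteq (image (phi alpha) P) Q \/ seteq (image (phi beta) P) Q \/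
   seteq (fun z => P (phi beta z)) Q).

Lemma in_b_list I : In I (lb ++ lbi) <-> exists s, s <> LA /\ component s (fst I) (snd I).
Proof.
  rewrite in_app_iff, Hlb, Hlbi. split.
  - intros [H|H]; [exists LB|exists LBi]; split; auto; discriminate.
  - intros [[] [D H]]; auto; congruence.
Qed.

Lemma principal_of_gap u v : principal_gap u v -> principal (arc_oo u v).
Proof.
  intros [Hb Hc]. pose proof Hb as (_ & s & s' & Cu & Cv & Hs).
  destruct (boundary_gap_component_l u v s Hb Cu) as [l Hl].
  destruct (boundary_gap_component_r u v s' Hb Cv) as [r Hr].
  exists (l, u), (v, r). split; [now apply (in_component s)|].
  split; [now apply (in_component s')|]. split; [now apply boundary_gap_consecutive|].
  split; [|intros z; reflexivity].
  assert (Lu : limit_pt u) by apply Hb. assert (Lv : limit_pt v) by apply Hb.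
  rewrite !Hla, !in_b_list. destruct Hc as [C|C].
  - rewrite (col_unique u s LA) in * by auto. left. eauto.
  - rewrite (col_unique v s' LA) in * by auto. right. eauto.
Qed.

Lemma gap_of_principal P : principal P -> exists u v, principal_gap u v /\ P = arc_oo u v.
Proof.
  intros (I & J & _ & _ & HX & HIJ & HP). exists (snd I), (fst J). split; [|now apply seteq_eq].
  rewrite !Hla, !in_b_list in HIJ.
  destruct HIJ as [[HI (s & Hs & HJ)]|[(s & Hs & HI) HJ]].
  - destruct (consecutive_col _ _ I J HI HJ HX) as (Hb & C & _); [congruence|]. split; auto.
  - destruct (consecutive_col _ _ I J HI HJ HX) as (Hb & _ & C); [congruence|]. split; auto.
Qed.

Lemma principal_connected P Q : principal P -> principal Q -> clos_refl_trans _ edge P Q.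
Proof.
  intros HP HQ. destruct (gap_of_principal P HP) as (u0 & v0 & P0 & ->).
  destruct (gap_of_principal Q HQ) as (u & v & Q0 & ->).
  apply (principal_gap_connected
    (fun u v => clos_refl_trans _ edge (arc_oo u0 v0) (arc_oo u v)) u0 v0); auto.
  - intros p q Hpq H H'. apply rt_trans with (1 := H), rt_step.
    split; [|split]; auto using principal_of_gap, image_arc_oo.
  - intros p q Hpq H H'. apply rt_trans with (1 := H), rt_step.
    split; [|split]; auto using principal_of_gap, image_arc_oo.
  - intros p q Hpq H H'. apply rt_trans with (1 := H), rt_step.
    split; [|split]; auto using principal_of_gap, preimage_beta_arc_oo.
  - apply rt_refl.
Qed.

Lemma complementary_of_gap u v s s' : gap u v -> col u s -> col v s' ->
  s <> LA -> s' <> LA -> s <> s' -> complementary (arc_oo u v).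
Proof.
  intros Hg Cu Cv Hs Hs' D. assert (Hb : boundary_gap u v) by (split; eauto 6).
  destruct (boundary_gap_component_l u v s Hb Cu) as [l Hl].
  destruct (boundary_gap_component_r u v s' Hb Cv) as [r Hr].
  exists (l, u), (v, r). split; [now apply (in_component s)|].
  split; [now apply (in_component s')|]. split; [now apply boundary_gap_consecutive|].
  split; [|intros z; reflexivity]. rewrite !Hlb, !Hlbi.
  destruct s, s'; try congruence; [left|right]; split; assumption.
Qed.

(** A filled gap of type [LA] is carried to a gap with both ends of other types: equal ends give a
    filled gap, different ends a complementary one. This is why the blocks include the complementary
    gaps. *)
Lemma image_alpha_piece :
  seteq (image (phi alpha) (piece LA))
        (fun z => piece LB z \/ piece LBi z \/ exists P, complementary P /\ P z).
Proof.
  intros z. split.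
  - intros (w & [(L & C)|(u & v & Hg & Cu & Cv & C)] & <-).
    + destruct (col_alpha_A w L C) as (s & Hs & Cs).
      pose proof (limit_pt_act alpha w L). unfold piece.
      destruct s; [congruence|left|right; left]; left; auto.
    + destruct (col_alpha_A u (proj1 Hg) Cu) as (s & Hs & Cs).
      destruct (col_alpha_A v (proj1 (proj2 Hg)) Cv) as (s' & Hs' & Cs').
      pose proof (gap_act alpha u v Hg) as Hg'. apply (act_cyc phi Hact alpha) in C.
      destruct (letter_dec s s') as [<-|D].
      * assert (Ps : piece s (phi alpha w)) by (right; eauto 8).
        destruct s; [congruence|auto|auto].
      * right; right. exists (arc_oo (phi alpha u) (phi alpha v)).
        split; [now apply (complementary_of_gap _ _ s s')|exact C].
  - intros H. exists (phi alpha z). split; [|apply alpha2].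
    destruct H as [H|[H|(P & (I & J & _ & _ & HX & HIJ & HP) & Pz)]].
    + apply (piece_alpha_nonA LB); [discriminate|auto].
    + apply (piece_alpha_nonA LBi); [discriminate|auto].
    + apply HP in Pz. rewrite !Hlb, !Hlbi in HIJ.
      assert (D : exists s s', s <> LA /\ s' <> LA /\ boundary_gap (snd I) (fst J) /\
                col (snd I) s /\ col (fst J) s').
      { destruct HIJ as [[HI HJ]|[HI HJ]].
        - exists LB, LBi. split; [discriminate|split; [discriminate|]].
          apply consecutive_col; auto. discriminate.
        - exists LBi, LB. split; [discriminate|split; [discriminate|]].
          apply consecutive_col; auto. discriminate. }
      destruct D as (s & s' & Hs & Hs' & Hb & C1 & C2).
      right. exists (phi alpha (snd I)), (phi alpha (fst J)).
      split; [now apply gap_act, Hb|].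
      split; [now apply (col_alpha_nonA _ s)|split; [now apply (col_alpha_nonA _ s')|]].
      now apply (act_cyc phi Hact).
Qed.

Lemma image_beta_piece s : seteq (image (phi beta) (piece s)) (piece (rot s)).
Proof.
  intros z. split.
  - intros (w & Hw & <-). now apply piece_beta.
  - intros H. exists (phi beta (phi beta z)). split; [|apply beta3].
    rewrite <- (rot3 s). now do 2 apply piece_beta.
Qed.

Lemma markov_of_components :
  markov_system (phi alpha) (phi beta) (piece LA) (piece LB) (piece LBi).
Proof.
  split; [apply Hact|split; [exact alpha2|split; [apply Hact|split; [exact beta3|split]]]].
  { exists (o Ge). rewrite <- o_mul, Gmul_e_r. intros E. apply o_inj in E. discriminate. }
  exists (length la), la, lb, lbi. cbv zeta.
  split; [|split; [|split; [|split; [|split; [|split; [|split; [|split; [|split; [|split;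
    [|split; [|split; [|split; [|split; [|split]]]]]]]]]]]]]].
  - destruct limit_pt_exists as [z L].
    assert (H : exists z, piece LA z).
    { destruct (col_exists z L) as [s C].
      destruct (rotate_to_A s) as [->|[E|E]]; [exists z; now left| |];
        [exists (phi beta z)|exists (phi beta (phi beta z))]; rewrite <- E;
        repeat apply piece_beta; now left. }
    destruct H as [w Hw]. destruct (component_cover LA w Hw) as (l & r & Hc & _).
    assert (Hin : In (l, r) la) by now apply Hla. destruct la; [destruct Hin|simpl; lia].
  - reflexivity.
  - apply length_map.
  - unfold lbi, lb. rewrite !length_map. reflexivity.
  - intros p Hp E. apply in_all in Hp. destruct Hp as [s Hs].
    apply (component_nondegenerate s (fst p)). now rewrite <- E in Hs.
  - exact all_disjoint.
  - exact (pieces_of_components LA la Hla).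
  - exact (pieces_of_components LB lb Hlb).
  - exact (pieces_of_components LBi lbi Hlbi).
  - intros I J HI HJ. apply (not_consecutive_same LA); now apply Hla.
  - intros I J HI HJ. apply (not_consecutive_same LB); now apply Hlb.
  - intros I J HI HJ. apply (not_consecutive_same LBi); now apply Hlbi.
  - exact image_alpha_piece.
  - exact (image_beta_piece LA).
  - exact (image_beta_piece LB).
  - exact principal_connected.
Qed.
End Lists.

Lemma markov_of_separation :
  exists A B Bi : S1 -> Prop, markov_system (phi alpha) (phi beta) A B Bi.
Proof.
  destruct (components_finite LA) as (la & Hnd & Hla).
  exists (piece LA), (piece LB), (piece LBi). exact (markov_of_components la Hnd Hla).
Qed.
End Gaps.

Theorem theorem6p1 :
  forall (c : G -> G -> G -> Z) (phi : G -> S1 -> S1) (x0 : S1),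
    isolated_CO c ->
    dynamical_realization c phi x0 ->
    exists A B Bi : S1 -> Prop,
      markov_system (phi alpha) (phi beta) A B Bi.
Proof.
  intros c phi x0 Hiso (Hact & Htight & Hc).
  destruct (orbit_type_separation c phi x0 Hact (proj1 Htight) (proj1 Hiso) Hc Hiso)
    as (j0 & Hj0 & Hsep).
  exact (markov_of_separation phi x0 Hact Htight j0 Hj0 Hsep).
Qed.
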